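(* Let $k\ge 1$ be an integer (the cache size) and $0<\epsilon\le 1$. Define $$\Phi(\epsilon,k) = 1+\sum_{i=1}^{k-1} \frac{1}{\max\{\epsilon^{-1}-i,\,1\}},\qquad H(k)=\sum_{i=1}^k \frac1i,$$ and let $\epsilon' = 1/\lceil \epsilon^{-1}\rceil$. Then the optimal competitive ratios against the $\Delta_\epsilon$-diffuse adversary satisfy: (i) if $\epsilon\le 1/(k+1)$: $\Phi(\epsilon,k)-1 \le \mathcal{R}(\Delta_\epsilon)\le 2\Phi(\epsilon,k)$ and $\Phi(\epsilon',k)-1\le \mathcal{RR}(\Delta_\epsilon)\le 2\Phi(\epsilon,k)$; (ii) if $\epsilon\ge 1/(k+1)$: $\Phi(\epsilon,k)\le \mathcal{R}(\Delta_\epsilon)\le 2\Phi(\epsilon,k)$ and $\mathcal{RR}(\Delta_\epsilon)=H(k)$. Moreover, the upper bound $2\Phi(\epsilon,k)$ on $\mathcal{R}(\Delta_\epsilon,A)$ holds for every lazy deterministic marking algorithm $A$ (e.g. LRU, FIFO); the upper bound $H(k)$ (for $\epsilon\ge 1/(k+1)$) is attained by the randomized algorithms Partition (McGeoch–Sleator) and Equitable (Achlioptas–Chrobak–Noga); and the randomized marking algorithm RMark satisfies $\mathcal{R}(\Delta_\epsilon,\mathrm{RMark})\le 2H(k)-1$ for $\epsilon\ge 1/(k+1)$.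
   Context: Paging problem: input is a cache size $k$ and a finite request sequence $s=s_1\dots s_n$ of items; output is a schedule $S_1\dots S_n$ of sets with $|S_t|\le k$ and $s_t\in S_t$. An item is evicted at time $t$ if it is in $S_{t-1}$ but not $S_t$; the cost is the number of evictions. $\mathrm{Opt}(s)$ is the minimum cost of a schedule for $s$. An algorithm is on-line if the cache contents after each request do not depend on later requests; a randomized on-line algorithm is a probability distribution over deterministic on-line algorithms, and $A(s)$ denotes its expected cost. Algorithms: LRU evicts (only on a fault with a full cache) the item whose most recent request is least recent; FIFO evicts the item that has been in the cache longest; FWF evicts all items. The randomized marking algorithm RMark marks each item when it is requested; when an eviction is needed it first erases all marks if all cached items are marked, then evicts an unmarked cached item chosen uniformly at random. A deterministic marking algorithm maintains marks the same way and evicts only unmarked items; it is lazy if it evicts only when the requested item is not in a full cache, and then evicts exactly one item (LRU and FIFO are lazy marking algorithms; FWF is not). Diffuse adversary: a distribution $D$ on request sequences specifies, for every sequence $s$ and item $x$, the probability $\Pr_D(x\mid s)$ that the next request is $x$ given the prefix so far is $s$. $\Delta_\epsilon$ is the class of such $D$ with $\Pr_D(x\mid s)\le\epsilon$ for all $s,x$. For an algorithm $A$ (deterministic or randomized), $\mathcal{R}(\Delta_\epsilon,A)$ is the infimum of $c$ such that for every $D\in\Delta_\epsilon$ there is a constant $b$ with $\mathbb{E}_D[A(r)]\le c\,\mathbb{E}_D[\mathrm{Opt}(r)]+b$, $r$ drawn from $D$. $\mathcal{R}(\Delta_\epsilon)=\inf_A \mathcal{R}(\Delta_\epsilon,A)$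 over deterministic on-line $A$, and $\mathcal{RR}(\Delta_\epsilon)=\inf_{A_R}\mathcal{R}(\Delta_\epsilon,A_R)$ over randomized on-line $A_R$.
   Formalization: FIFO is dropped as an example of a lazy marking algorithm: for k=3 and requests a b c d b a it evicts the marked b while c is unmarked, and its ratio can exceed 2Φ(ε,k) (e.g. ε=1/k, k=20); the bound for every lazy marking algorithm and for LRU is kept. *)

(* Defs.v *)
From HB Require Import structures.
From mathcomp Require Import all_boot all_order all_algebra finmap.
From mathcomp Require Import all_classical all_reals all_analysis.

Set Implicit Arguments.
Unset Strict Implicit.
Unset Printing Implicit Defensive.

Import Order.TTheory GRing.Theory Num.Theory.

Local Open Scope classical_set_scope.
Local Open Scope fset_scope.
Local Open Scope ring_scope.

(* Items are natural numbers: the universe of items is countably infinite. *)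
Definition item := nat.
Definition cache := {fset item}.

(* [all2] also forces the schedule and the request sequence to have the same
   length. *)
Definition schedule (k : nat) (s : seq item) (S : seq cache) : bool :=
  all2 (fun x (C : cache) => (x \in C) && (#|` C| <= k)%N) s S.

Fixpoint evictions (C : cache) (S : seq cache) : nat :=
  if S is C' :: S' then (#|` C `\` C'| + evictions C' S')%N else 0%N.

(* The cache is initially empty. *)
Definition sched_cost (S : seq cache) : nat := evictions fset0 S.

(* The infimum is a minimum for 0 < k: costs are natural numbers and a schedule
   exists. *)
Definition Opt (R : realType) (k : nat) (s : seq item) : \bar R :=
  ereal_inf [set (sched_cost S)%:R%:E | S in [set S | schedule k s S]].

(* [A s] is the content of the cache once the requests [s] have been served;
   as [A] only sees the prefix served so far, it cannot depend on later
   requests. *)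
Definition alg := seq item -> cache.

Definition online (k : nat) (A : alg) : Prop :=
  A [::] = fset0 /\
  forall s x, x \in A (rcons s x) /\ (#|` A (rcons s x)| <= k)%N.

Definition alg_schedule (A : alg) (s : seq item) : seq cache :=
  [seq A (take t s) | t <- iota 1 (size s)].

Definition cost (A : alg) (s : seq item) : nat := sched_cost (alg_schedule A s).

(* The sigma-algebra on deterministic algorithms is generated by the events
   "the cache is [C] after [s]". *)
Definition cylinders : set (set alg) :=
  [set G | exists (s : seq item) (C : cache), G = [set A : alg | A s = C]].

Definition randalg (R : realType) := probability (g_sigma_algebraType cylinders) R.

Definition rand_online (R : realType) (k : nat) (Q : randalg R) : Prop :=
  Q [set A : alg | online k A] = 1%:E.

Definition ecost (R : realType) (Q : randalg R) (s : seq item) : \bar R :=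
  (\int[Q]_A (cost A s)%:R%:E)%E.

(* [D s x] is the probability that the next request is [x] when the requests so
   far are [s]. *)
Definition diffuse (R : realType) (eps : R) (D : seq item -> item -> R) : Prop :=
  forall s, (forall x, 0 <= D s x <= eps) /\
            (\sum_(0 <= x <oo) (D s x)%:E = 1%:E)%E.

(* Expectation of [F (s ++ r)] where [r] consists of the next [n] requests drawn
   from [D] after [s]; [F] is meant to be nonnegative. *)
Fixpoint expect (R : realType) (D : seq item -> item -> R) (n : nat)
    (s : seq item) (F : seq item -> \bar R) : \bar R :=
  if n is m.+1
  then (\sum_(0 <= x <oo) (D s x)%:E * expect D m (rcons s x) F)%E
  else F s.

(* Competitive ratio of an algorithm with (expected) cost function [F]. For a
   given [D], the constant [b] is uniform in the number [n] of requests. *)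
Definition ratio (R : realType) (k : nat) (eps : R) (F : seq item -> \bar R) :
    \bar R :=
  ereal_inf [set c%:E | c in [set c : R |
    forall D, diffuse eps D -> exists b : R, forall n,
      (expect D n [::] F <= c%:E * expect D n [::] (Opt R k) + b%:E)%E]].

Definition det_ratio (R : realType) (k : nat) (eps : R) (A : alg) : \bar R :=
  ratio k eps (fun s => (cost A s)%:R%:E).

Definition rand_ratio (R : realType) (k : nat) (eps : R) (Q : randalg R) :
    \bar R :=
  ratio k eps (ecost Q).

Definition opt_det_ratio (R : realType) (k : nat) (eps : R) : \bar R :=
  ereal_inf [set det_ratio k eps A | A in [set A | online k A]].

Definition opt_rand_ratio (R : realType) (k : nat) (eps : R) : \bar R :=
  ereal_inf [set rand_ratio k eps Q | Q in [set Q | rand_online k Q]].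

Definition Phi (R : realType) (eps : R) (k : nat) : R :=
  1 + \sum_(1 <= i < k) (Num.max (eps^-1 - i%:R) 1)^-1.

Definition harm (R : realType) (k : nat) : R := \sum_(1 <= i < k.+1) (i%:R)^-1.

(* The marks in force when [x] is served from cache [C] with marks [M]: an
   eviction is needed when [x] is missing from a full cache. *)
Definition erase (k : nat) (C M : cache) (x : item) : cache :=
  if [&& x \notin C, #|` C| == k & C `<=` M] then fset0 else M.

Fixpoint marks_rev (k : nat) (A : alg) (r : seq item) : cache :=
  if r is x :: r' then x |` erase k (A (rev r')) (marks_rev k A r') x
  else fset0.

Definition marks (k : nat) (A : alg) (s : seq item) : cache :=
  marks_rev k A (rev s).

Definition marking (k : nat) (A : alg) : Prop :=
  online k A /\
  forall s x y, y \in A s `\` A (rcons s x) ->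
    y \notin erase k (A s) (marks k A s) x.

Definition lazy (k : nat) (A : alg) : Prop :=
  forall s x,
    (A s `\` A (rcons s x) != fset0 -> x \notin A s /\ #|` A s| = k) /\
    (x \notin A s -> #|` A s| = k -> #|` A s `\` A (rcons s x)| = 1%N).

Definition lazy_marking (k : nat) (A : alg) : Prop := marking k A /\ lazy k A.

(* [r] is the reversed prefix, so [index z r] is the age of the most recent
   request to [z]; the items kept are those which are not of maximal age. *)
Fixpoint lru_rev (k : nat) (r : seq item) : cache :=
  if r is x :: r' then
    let C := lru_rev k r' in
    if x \in C then C
    else if (#|` C| < k)%N then x |` C
    else x |` [fset z in C | has (fun y => (index z r' < index y r')%N) C]
  else fset0.

Definition lru (k : nat) : alg := fun s => lru_rev k (rev s).

Definition unif (R : realType) (T : Type) (s : seq T) (f : T -> R) : R :=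
  (\sum_(x <- s) f x) / (size s)%:R.

(* Probability that RMark moves from cache [C] to [C'] when serving [x], where
   [M] is the set of marks after the possible erasure. *)
Definition rmark_step (R : realType) (k : nat) (C M : cache) (x : item)
    (C' : cache) : R :=
  if x \in C then (C' == C)%:R
  else if (#|` C| < k)%N then (C' == x |` C)%:R
  else unif (enum_fset (C `\` M)) (fun y => (C' == x |` (C `\ y))%:R).

Definition agree (A0 : alg) (s : seq item) : set alg :=
  [set A | forall i, (i <= size s)%N -> A (take i s) = A0 (take i s)].

(* Given the caches [A0 (take i s)] held so far, the next cache is distributed
   according to [rmark_step]. *)
Definition is_rmark (R : realType) (k : nat) (Q : randalg R) : Prop :=
  rand_online k Q /\
  forall (A0 : alg) (s : seq item) (x : item) (C : cache),
    Q (agree A0 s `&` [set A : alg | A (rcons s x) = C])%classic =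
    (Q (agree A0 s) *
     (rmark_step R k (A0 s) (erase k (A0 s) (marks k A0 s) x) x C)%:E)%E.

(* A lazy randomized algorithm whose cache after [s] has law [law s]. As the
   algorithm is lazy these laws determine its expected cost, whatever the joint
   law of the caches held at different times. *)
Definition lazy_with_law (R : realType) (k : nat)
    (law : seq item -> cache -> R) (Q : randalg R) : Prop :=
  [/\ rand_online k Q,
      Q [set A : alg | lazy k A] = 1%:E &
      forall s C, Q [set A : alg | A s = C] = (law s C)%:E].

(* The Partition algorithm of McGeoch and Sleator.
   The items are partitioned into S_alpha, ..., S_beta, with labels k_i for
   alpha <= i < beta and k_alpha = 0. A state consists of S_beta and of the list
   of the (S_i, k_i) from i = beta - 1 down to i = alpha + 1; S_alpha is the set
   of all the other items. *)
Definition pstate := (cache * seq (cache * nat))%type.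

(* If j is the largest index with k_j = 0, the sets S_alpha, ..., S_j are merged
   into a new S_alpha. *)
Fixpoint collapse (L : seq (cache * nat)) : seq (cache * nat) :=
  if L is (B, l) :: L' then
    if l == 0%N then [::] else (B, l) :: collapse L'
  else [::].

(* A request to an item [x] of some S_i, alpha < i < beta, removes it from S_i
   and decrements k_j for i <= j < beta. *)
Fixpoint extract (x : item) (L : seq (cache * nat)) : seq (cache * nat) :=
  if L is (B, l) :: L' then
    if x \in B then (B `\ x, l.-1) :: L' else (B, l.-1) :: extract x L'
  else [::].

(* The third case only occurs while fewer than [k] distinct items have been
   requested; from the [k]-th one on, S_beta is first the set of these [k] items
   and S_alpha its complement. *)
Definition partition_step (k : nat) (st : pstate) (x : item) : pstate :=
  let: (top, L) := st in
  if x \in top then st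
  else if has (fun Bl : cache * nat => x \in Bl.1) L
    then (x |` top, collapse (extract x L))
  else if (L == [::]) && (#|` top| < k)%N then (x |` top, [::])
  else ([fset x], collapse ((top, k.-1) :: L)).

Definition partition_state (k : nat) (s : seq item) : pstate :=
  foldl (partition_step k) (fset0, [::]) s.

(* Expectation of [f M_(beta - 1)], where M_alpha is empty and M_i is a uniformly
   random subset of S_i U M_(i - 1) with k_i elements. *)
Fixpoint partition_marked (R : realType) (L : seq (cache * nat))
    (f : cache -> R) : R :=
  if L is (B, l) :: L' then
    partition_marked L' (fun M =>
      unif [seq X <- enum_fset (fpowerset (B `|` M)) | #|` X| == l] f)
  else f fset0.

(* The cache consists of S_beta and of the marked items M_(beta - 1). *)
Definition partition_law (R : realType) (k : nat) (s : seq item) (C : cache) :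
    R :=
  let: (top, L) := partition_state k s in
  partition_marked L (fun M => (C == top `|` M)%:R).

Definition is_partition (R : realType) (k : nat) (Q : randalg R) : Prop :=
  lazy_with_law k (partition_law R k) Q.

(* The Equitable algorithm of Achlioptas, Chrobak and Noga.
   The work function after the requests [s] is described by its layers
   (L_1 | ... | L_k): an optimal schedule for [s] may end with the cache [X],
   #|X| = k, if and only if X is contained in L_1 U ... U L_k and
   #|X & (L_1 U ... U L_i)| >= i for all i. Fewer than [k] layers, then all of
   them singletons, means that fewer than [k] distinct items were requested. *)
Definition merge_next (B : cache) (L : seq cache) : seq cache :=
  if L is B' :: L' then (B `|` B') :: L' else [::].

Definition layers_step (k : nat) (L : seq cache) (x : item) : seq cache :=
  let j := find (fun B : cache => x \in B) L in
  if (j < size L)%N then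
    [fset x] :: take j L ++ merge_next (nth fset0 L j `\ x) (drop j.+1 L)
  else if (size L < k)%N then [fset x] :: L
  else [fset x] :: merge_next (head fset0 L) (behead L).

Definition layers (k : nat) (s : seq item) : seq cache :=
  foldl (layers_step k) [::] s.

Definition layers_cover (L : seq cache) : cache := \bigcup_(B <- L) B.

(* The items outside the longest prefix of singleton layers: these are the
   items of the support which are not in every optimal cache. *)
Fixpoint unrevealed (L : seq cache) : cache :=
  if L is B :: L' then
    if #|` B| == 1%N then unrevealed L' else layers_cover L
  else fset0.

(* Expectation of [f X], where [X] is generated by repeatedly updating the
   layers as if a uniformly random unrevealed item were requested, until the
   layers leave only one possible cache. Each update reveals at least one more
   item, so that [k] of them ([n] = [k] below) suffice. *)
Fixpoint equitable_sample (R : realType) (k n : nat) (L : seq cache)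
    (f : cache -> R) : R :=
  if n is m.+1 then
    if unrevealed L == fset0 then f (layers_cover L)
    else unif (enum_fset (unrevealed L))
           (fun x => equitable_sample k m (layers_step k L x) f)
  else f (layers_cover L).

Definition equitable_law (R : realType) (k : nat) (s : seq item) (C : cache) :
    R :=
  equitable_sample k k (layers k s) (fun X => (C == X)%:R).

Definition is_equitable (R : realType) (k : nat) (Q : randalg R) : Prop :=
  lazy_with_law k (equitable_law R k) Q.

(* Main.v *)
Require Import Defs.
From HB Require Import structures.
From mathcomp Require Import all_boot all_order all_algebra finmap.
From mathcomp Require Import all_classical all_reals all_analysis.
From mathcomp Require Import ring lra zify.
From mathcomp Require Import measurable_realfun.

(* Cut the requests into phases of [k] distinct items and call new the first
   request of a phase to an item that was not requested in the previous phase: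
   the optimal cost lies between half the number of new requests and this number
   plus [k].

   In a phase with [m] new items, a marking algorithm misses at most [m] of the
   items of the previous phase, and with [i] marked items an adversary of
   [Delta_eps] requests a given one of them with probability at most
   [1 / max (eps^-1 - i, 1)] among the unmarked ones; amortizing faults against
   new requests gives [2 Phi]. For the lower bounds the adversary spreads its mass
   as evenly as [eps] allows, favouring an item missing from the cache, and the
   number of faults minus the ratio times the number of phases (or of new
   requests) is a submartingale up to a bounded term; a uniform distribution over
   [N > k] items handles randomized algorithms, which miss [N - k] of them at any
   time.

   A probability distribution over algorithms with prescribed transition
   probabilities is the image of Lebesgue measure on [0, 1) under nested
   partitions into intervals. When the algorithm is lazy, its cost only depends on
   the laws of the cache after each prefix, and such laws are realized as soon as
   consecutive ones have a coupling whose moves are lazy.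

   For Partition and Equitable, every configuration reached by the offline optimum
   satisfies constraints "at least [r] items of [U] are in the cache", and a
   request outside of all these sets costs the optimum one eviction. A potential
   pays for all the faults with [H(k)] per such request. The caches allowed by
   Equitable's layers are the bases of a matroid, its cache is the greedy basis for
   a uniformly random order of the items, a request contracts this matroid, and a
   request outside of the layers truncates it; the exchange of two contractions
   preserves the total fault probability, which provides the potential.

   For RMark, the unmarked items of the previous phase are exchangeable, so that
   each of them is missing with probability [m / o] when [o] of them are left, and
   a phase costs [m (1 + H(k) - H(m))]. The optimum is followed through the number
   of items of the last phase that it misses at the end of this phase. *)

Set Implicit Arguments.
Unset Strict Implicit.
Unset Printing Implicit Defensive.

Import Order.TTheory GRing.Theory Num.Theory.
Local Open Scope ring_scope.

(** * Optimal schedules and phases *)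

(* [#|` A|] elaborates to [size] at the type [nat] or at its canonical
   [choiceType], which [lia] does not identify. *)
Ltac clia := unfold item in *;
  change (Choice.sort Datatypes_nat__canonical__choice_Choice) with nat in *; lia.

(** The cost counts evictions, whereas all the estimates count faults. Faults exceed evictions by at
    most [k], the size of the cache, and a lazy algorithm never evicts without a fault, so the two
    are interchangeable up to the additive constant of the ratio.

    That constant shapes the lower bounds: an inequality between expected faults and expected phases
    says nothing if both stay bounded, so each adversary must also be shown to cause faults at a
    linear rate.

    The missing 1 in the lower bounds for small [eps] comes from the first request of a phase. It
    yields about one fault, but the adversary works with [N > k] items and a phase may contain up to
    [N - k] new requests, which the optimum pays for. With [N = k + 1] a phase has exactly one new
    request and nothing is lost. Rounding [eps] to [eps'] is forced by the uniform distribution on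
    [N] items, which needs [1 / N <= eps].

    The upper bounds for randomized algorithms are proved for each request sequence separately and
    then averaged; only the bound for deterministic marking algorithms uses the limit [eps] on the
    probabilities. *)

Section Schedules.
Local Open Scope fset_scope.
Local Open Scope nat_scope.
Implicit Types (A B C X Z M : cache) (s : seq item) (S : seq cache).

(** A triangle inequality: when a cache changes, the number of missing items of any set grows by at
    most the number of evictions. *)
Lemma leq_card_fsetD A B C : #|` A `\` C| <= #|` A `\` B| + #|` B `\` C|.
Proof.
have sub : A `\` C `<=` (A `\` B) `|` (B `\` C).
  apply/fsubsetP => z; rewrite !inE.
  by case: (z \in A); case: (z \in B); case: (z \in C).
by apply: leq_trans (fsubset_leq_card sub) _; rewrite cardfsU leq_subr.
Qed.

Lemma evictions_rcons C S C' :
  evictions C (rcons S C') = evictions C S + #|` last C S `\` C'|.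
Proof.
by elim: S C => [|B S IH] C /=; rewrite ?addn0 ?add0n ?IH ?addnA.
Qed.

Lemma cost_nil (A : alg) : cost A [::] = 0.
Proof. by []. Qed.

Lemma cost_rcons (A : alg) s x : A [::] = fset0 ->
  cost A (rcons s x) = cost A s + #|` A s `\` A (rcons s x)|.
Proof.
move=> A0; have sched t z : alg_schedule A (rcons t z) =
    rcons (alg_schedule A t) (A (rcons t z)).
  rewrite /alg_schedule size_rcons -[(size t).+1]addn1 iotaD map_cat /= add1n.
  rewrite cats1.
  rewrite -(size_rcons t z) take_size; congr (rcons _ _).
  apply/eq_in_map => i; rewrite mem_iota => /andP [_ lei].
  by rewrite -cats1 takel_cat // -ltnS -add1n.
rewrite /cost sched /sched_cost evictions_rcons; congr (_ + #|` _ `\` _|).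
case: (lastP s) => [|t y]; first by rewrite A0.
by rewrite sched last_rcons.
Qed.

(** A schedule is remembered only through its last cache and its cost, which is all that an
    extension by one request depends on. *)
Definition reach k s X c :=
  exists S, [/\ schedule k s S, last fset0 S = X & sched_cost S = c].

Lemma schedule_rcons k s x S C :
  schedule k (rcons s x) (rcons S C) = schedule k s S && (x \in C) && (#|` C| <= k).
Proof.
elim: s S => [|y s IH] [|B S] //=; rewrite ?andbT //.
- by case: S => [|? ?] /=; rewrite andbF.
- by case: s {IH} => [|? ?] /=; rewrite andbF.
- by rewrite IH !andbA.
Qed.

Lemma reach_nil k : reach k [::] fset0 0.
Proof. by exists [::]. Qed.

Lemma reach_rcons k s x X X' c : reach k s X c -> x \in X' -> #|` X'| <= k ->
  reach k (rcons s x) X' (c + #|` X `\` X'|).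
Proof.
move=> [S [sS <- <-]] xX' lX'; exists (rcons S X').
by rewrite schedule_rcons sS xX' lX' last_rcons /sched_cost evictions_rcons.
Qed.

Lemma reach_ind k (P : seq item -> cache -> nat -> Prop) :
  P [::] fset0 0 ->
  (forall s (x : item) X X' c, #|` X| <= k -> P s X c -> x \in X' -> #|` X'| <= k ->
     P (rcons s x) X' (c + #|` X `\` X'|)) ->
  forall s X c, reach k s X c -> #|` X| <= k /\ P s X c.
Proof.
move=> P0 PS s X c [S [sS <- <-]]; elim/last_ind: s S sS => [|s x IH] S.
  by case: S => // _; rewrite cardfs0.
case/lastP: S => [|S C]; first by case: s {IH}.
rewrite schedule_rcons => /andP [] /andP [sS xC] lC.
have [lS PS'] := IH _ sS.
rewrite last_rcons /sched_cost evictions_rcons; split=> //.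
exact: PS.
Qed.

Lemma reach_full k s : 0 < k -> exists X c, reach k s X c.
Proof.
move=> hk; elim/last_ind: s => [|s x [X [c Xc]]].
  by exists fset0, 0; apply: reach_nil.
exists [fset x], (c + #|` X `\` [fset x]|).
by apply: reach_rcons; rewrite // ?inE // cardfs1.
Qed.

(** The optimum as a natural number. The default [0] of [xget] is harmless: for [0 < k] some
    schedule exists and the least cost is attained. *)
Definition optn k s : nat :=
  xget 0 [set c | (exists X, reach k s X c) /\
                  forall X c', reach k s X c' -> c <= c']%classic.

Lemma optnP k s : 0 < k ->
  (exists X, reach k s X (optn k s)) /\ forall X c, reach k s X c -> optn k s <= c.
Proof.
move=> hk; rewrite /optn; case: xgetP => [c _ //|noc].
have [X [c Xc]] := reach_full s hk.
have ex : exists n, `[< exists X, reach k s X n >].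
  by exists c; apply/asboolP; exists X.
case: (ex_minnP ex) => m /asboolP [Y Ym] mmin; case: (noc m); split.
  by exists Y.
by move=> Z d Zd; apply: mmin; apply/asboolP; exists Z.
Qed.

Lemma OptE (R : realType) k s : 0 < k -> Opt R k s = (optn k s)%:R%:E.
Proof.
move=> hk; have [[X [S [sS _ cS]]] omin] := optnP s hk.
apply/eqP; rewrite eq_le; apply/andP; split.
  by apply: ereal_inf_lbound; exists S => //; rewrite cS.
apply: le_ereal_inf_tmp => _ [T sT <-]; rewrite lee_fin ler_nat.
by apply: omin; exists T; split.
Qed.

(** Removing the last cache of a schedule cannot raise its cost; conversely the cache can be
    replaced by [[fset x]] with at most [k] evictions. *)
Lemma optn_rcons_le k s x : 0 < k ->
  optn k s <= optn k (rcons s x) <= optn k s + k.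
Proof.
move=> hk; have [[X Xo] omin] := optnP s hk.
have [[Y Yo] omin'] := optnP (rcons s x) hk; apply/andP; split.
  case: Yo => S [sS _ cS]; case/lastP: S sS cS => [|S C].
    by case: s {omin omin' Xo}.
  rewrite schedule_rcons => /andP [] /andP [sS _] _.
  rewrite /sched_cost evictions_rcons => <-.
  apply: leq_trans (leq_addr _ _); apply: (omin (last fset0 S)).
  by exists S.
have [lX _] := reach_ind (P := fun _ _ _ => True) I (fun _ _ _ _ _ _ _ _ _ => I) Xo.
have xx : x \in [fset x] by rewrite inE.
have l1 : #|` [fset x]| <= k by rewrite cardfs1.
apply: leq_trans (omin' _ _ (reach_rcons Xo xx l1)) _.
by rewrite leq_add2l (leq_trans _ lX) // fsubset_leq_card // fsubsetDl.
Qed.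

End Schedules.

(** * Phases of [k] distinct items and the optimal cost *)

Section Phases.
Local Open Scope fset_scope.
Local Open Scope nat_scope.
Implicit Types (X Z : cache) (s : seq item).

(* The partition of a request sequence into phases of [k] distinct items:
   [ph_old] and [ph_cur] are the sets of items requested in the previous and in
   the current phase, [ph_num] is the number of complete phases, and [ph_new]
   counts the requests that were the first ones of their phase to items not
   requested in the previous phase (the first phase is not counted). *)
Record phase := Phase {
  ph_old : cache; ph_cur : cache; ph_num : nat; ph_new : nat }.

Definition phase_step k (p : phase) (x : item) : phase :=
  if x \in ph_cur p then p
  else if #|` ph_cur p| < k then
    Phase (ph_old p) (x |` ph_cur p) (ph_num p)
      (ph_new p + ((0 < ph_num p) && (x \notin ph_old p)))
  else Phase (ph_cur p) [fset x] (ph_num p).+1 (ph_new p).+1.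

Definition phases k s : phase :=
  foldl (phase_step k) (Phase fset0 fset0 0 0) s.

Lemma phases_rcons k s x : phases k (rcons s x) = phase_step k (phases k s) x.
Proof. by rewrite /phases -cats1 foldl_cat. Qed.

(** The contribution of the unfinished phase to [ph_new]. *)
Definition ph_fresh (p : phase) : nat :=
  if 0 < ph_num p then #|` ph_cur p `\` ph_old p| else 0.

Lemma phases_inv k s : 0 < k -> let p := phases k s in
  [/\ #|` ph_cur p| <= k,
      0 < ph_num p -> #|` ph_old p| = k /\ 0 < ph_fresh p,
      ph_num p = 0 -> ph_old p = fset0 /\ ph_new p = 0 &
      ph_num p <= ph_new p].
Proof.
move=> hk; elim/last_ind: s => [|s x IH] /=; first by split=> //=; rewrite cardfs0.
rewrite phases_rcons; move: IH; case: (phases k s) => O M F N /= [lM hO hF hN].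
rewrite /phase_step /=; case: ifP => xM //=; case: ltnP => [ltM|leM] /=.
- rewrite cardfsU1 xM add1n; split=> //.
  + move=> F0; have [-> Fr] := hO F0; split=> //; move: Fr.
    rewrite /ph_fresh /= F0 => Fr; apply: leq_trans Fr _.
    by apply: fsubset_leq_card; apply: fsetSD; apply: fsubsetUr.
  + by move=> F0; have [-> ->] := hF F0; rewrite F0.
  + by apply: leq_trans hN _; rewrite leq_addr.
- rewrite cardfs1; split=> // _; split; first by apply/eqP; rewrite eqn_leq lM.
  rewrite /ph_fresh /= cardfs_gt0; apply/fset0Pn; exists x.
  by rewrite !inE xM eqxx.
Qed.

(** [N] counts the new requests of the completed phases; [E], [e] and [e'] count the evictions
    before the previous phase, during it and during the current one. Two consecutive phases request
    [k + m] items when the second has [m] new ones, so at least [m] of these items are missing at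
    its end and were evicted during the two phases. Each eviction is thus charged at most twice,
    once for its own phase and once for the next. *)
Lemma reach_fresh k s X c : 0 < k -> reach k s X c ->
  let p := phases k s in exists N E e e',
  [/\ N + ph_fresh p = ph_new p, E + e + e' = c, N <= E.*2 + e,
      #|` ph_cur p `\` X| <= e' &
      0 < ph_num p -> #|` (ph_old p `|` ph_cur p) `\` X| <= e + e'].
Proof.
move=> hk rX; apply: (proj2 (reach_ind (P := fun s X c => let p := phases k s in
  exists N E e e',
  [/\ N + ph_fresh p = ph_new p, E + e + e' = c, N <= E.*2 + e,
      #|` ph_cur p `\` X| <= e' &
      0 < ph_num p -> #|` (ph_old p `|` ph_cur p) `\` X| <= e + e']) _ _ rX)).
  by exists 0, 0, 0, 0; split; rewrite //= fset0D cardfs0.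
move=> {rX s X c}s x X X' c lX /= [N [E [e [e' [eN eE leN lee' lee]]]]] xX' lX'.
rewrite phases_rcons /phase_step.
have [lM hO hF hN] := phases_inv s hk.
move: eN lee' lee lM hO hF hN; case: (phases k s) => O M F P /=.
move=> eN lee' lee lM hO hF hN.
have tM := leq_card_fsetD M X X'; have tO := leq_card_fsetD (O `|` M) X X'.
case: ifP => xM /=.
  exists N, E, e, (e' + #|` X `\` X'|); split=> //; try clia.
have xD B : (x |` B) `\` X' = B `\` X'.
  apply/fsetP => z; rewrite !inE; case: eqP => [->|_] /=; last by [].
  by rewrite xX'.
case: ltnP => [ltM|leM] /=.
  exists N, E, e, (e' + #|` X `\` X'|); split; rewrite ?xD //; try clia.
  - rewrite /ph_fresh /= -eN /ph_fresh /=; case: (0 < F) => //=; last by rewrite !addn0.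
    rewrite -addnA; congr (N + _); case: (boolP (x \in O)) => xO /=.
      rewrite addn0; congr (#|` _|); apply/fsetP => z; rewrite !inE.
      by case: eqP => [->|_] //; rewrite xO.
    by rewrite fsetDUl (_ : [fset x] `\` O = [fset x]) ?cardfsU1 ?inE ?xM ?andbF
      ?add1n ?addn1 //; apply/fsetP => z; rewrite !inE; case: eqP => [->|]; rewrite ?xO ?andbF.
  - move=> F0; rewrite fsetUCA xD; move: (lee F0); clia.
(* A phase ends and the windows shift by one. The factor [0 < F] leaves out the first phase, whose
   requests do not count as new. *)
exists (N + #|` M `\` O| * (0 < F)), (E + e), e', #|` X `\` X'|.
have {leM} cM : #|` M| = k by apply/eqP; rewrite eqn_leq lM.
split.
- rewrite /ph_fresh /= (_ : [fset x] `\` M = [fset x]); last first.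
    by apply/fsetP => z; rewrite !inE; case: eqP => [->|]; rewrite ?xM ?andbF.
  rewrite cardfs1 -eN /ph_fresh /= addn1; case: (0 < F); clia.
- clia.
- case: (posnP F) => F0; first by rewrite muln0; clia.
  rewrite muln1; have [cO _] := hO F0; have := lee F0.
  have := cardfsID X (O `|` M); have := cardfsUI O M; have := cardfsID O M.
  have : #|` (O `|` M) `&` X| <= #|` X|.
    by apply: fsubset_leq_card; apply: fsubsetIr.
  rewrite (fsetIC O M); clia.
- by rewrite (_ : _ `\` _ = fset0) ?cardfs0 //; apply/fsetP => z; rewrite !inE;
    case: eqP => [->|]; rewrite ?xX' ?andbF.
- by move=> _; rewrite fsetUC xD; clia.
Qed.

Lemma ph_new_le_optn k s : 0 < k -> ph_new (phases k s) <= (optn k s).*2.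
Proof.
move=> hk; have [[X Xo] _] := optnP s hk.
have [N [E [e [e' [eN eE leN le1 le2]]]]] := reach_fresh hk Xo.
have [lX _] := reach_ind (P := fun _ _ _ => True) I (fun _ _ _ _ _ _ _ _ _ => I) Xo.
have [lM hO hF _] := phases_inv s hk.
rewrite -eN -eE; case: (posnP (ph_num (phases k s))) => F0.
  by rewrite /ph_fresh F0 /=; clia.
rewrite /ph_fresh F0; have [cO _] := hO F0; have := le2 F0.
move: (ph_old _) (ph_cur _) cO => O M cO.
have := cardfsID X (O `|` M); have := cardfsUI O M; have := cardfsID O M.
have : #|` (O `|` M) `&` X| <= #|` X|.
  by apply: fsubset_leq_card; apply: fsubsetIr.
rewrite (fsetIC O M); clia.
Qed.

(* [Z] stands for the set of the items requested in the current phase: an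
   optimal schedule knows it from the start. *)
Lemma reach_phase k s Z : 0 < k -> s != [::] ->
  let p := phases k s in ph_cur p `<=` Z -> #|` Z| <= k ->
  exists2 c, reach k s Z c & c + ph_fresh p <= ph_new p + #|` ph_old p `\` Z|.
Proof.
move=> hk; elim/last_ind: s Z => [//|s x IH] Z _.
rewrite phases_rcons /phase_step.
have [lM hO hF hN] := phases_inv s hk.
case: (eqVneq s [::]) => [->|s0].
  rewrite /= hk => xZ lZ; exists (0 + #|` fset0 `\` Z|).
    apply: (reach_rcons (s := [::])) lZ; first exact: reach_nil.
    by rewrite (fsubsetP xZ) //= !inE eqxx.
  by rewrite /= !fset0D cardfs0.
move: IH => /(_ _ s0); move: lM hO hF hN; case: (phases k s) => O M F P /=.
move=> lM hO hF hN IH; case: ifP => xM /=.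
  move=> MZ lZ; have [c rc lc] := IH Z MZ lZ.
  exists c => //; rewrite -(addn0 c) -(cardfs0 item) -(fsetDv Z).
  by apply: reach_rcons => //; apply: (fsubsetP MZ).
case: ltnP => [ltM|leM] /=.
  move=> xMZ lZ; have MZ : M `<=` Z by apply: fsubset_trans xMZ; apply: fsubsetUr.
  have [c rc lc] := IH Z MZ lZ; exists c.
    rewrite -(addn0 c) -(cardfs0 item) -(fsetDv Z).
    by apply: reach_rcons => //; rewrite -fsub1set (fsubset_trans _ xMZ) ?fsubsetUl.
  move: lc; rewrite /ph_fresh /=; case: (0 < F) => /=; last by rewrite !addn0.
  case: (boolP (x \in O)) => xO /=.
    rewrite addn0 (_ : (x |` M) `\` O = M `\` O) //.
    by apply/fsetP => z; rewrite !inE; case: eqP => [->|]; rewrite ?xO.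
  rewrite fsetDUl; have -> : [fset x] `\` O = [fset x].
    by apply/fsetP => z; rewrite !inE; case: eqP => [->|]; rewrite ?xO ?andbF.
  rewrite cardfsU1 !inE xM andbF /=; clia.
move=> xZ lZ; have {}xZ : x \in Z by rewrite -fsub1set.
have {leM} cM : #|` M| = k by apply/eqP; rewrite eqn_leq lM.
have [c rc lc] := IH M (fsubset_refl M) lM.
exists (c + #|` M `\` Z|); first exact: reach_rcons.
rewrite /ph_fresh /= (_ : [fset x] `\` M = [fset x]); last first.
  by apply/fsetP => z; rewrite !inE; case: eqP => [->|]; rewrite ?xM ?andbF.
rewrite cardfs1; suff : c <= P by clia.
move: lc; rewrite /ph_fresh /=; case: (posnP F) => F0.
  by have [-> ->] := hF F0; rewrite fset0D cardfs0 !addn0.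
have [cO _] := hO F0; have := cardfsID M O; have := cardfsID O M.
rewrite (fsetIC O M); clia.
Qed.

Lemma optn_le_ph_new k s : 0 < k -> optn k s <= ph_new (phases k s) + k.
Proof.
move=> hk; case: (eqVneq s [::]) => [->|s0].
  have [_ omin] := optnP [::] hk.
  by rewrite (leq_trans (omin _ _ (reach_nil k))).
have [lM hO hF hN] := phases_inv s hk.
have [c rc lc] := reach_phase hk s0 (fsubset_refl _) lM.
have [_ omin] := optnP s hk; apply: leq_trans (omin _ _ rc) _.
apply: leq_trans (leq_addr _ _) (leq_trans lc _); rewrite leq_add2l.
case: (posnP (ph_num (phases k s))) => F0.
  by have [-> _] := hF F0; rewrite fset0D cardfs0.
have [cO _] := hO F0; rewrite -[X in _ <= X]cO.
by apply: fsubset_leq_card; apply: fsubsetDl.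
Qed.

End Phases.

(** * Expectations against a diffuse adversary *)

Section Expectation.
Context {R : realType}.
Implicit Types (p : item -> R) (D : seq item -> item -> R).
Implicit Types (F G : seq item -> R).

Definition dist p := (forall x, 0 <= p x) /\
  (\sum_(0 <= x <oo) (p x)%:E = 1%:E)%E.

Definition mean p (f : item -> \bar R) : \bar R :=
  (\sum_(0 <= x <oo) (p x)%:E * f x)%E.

Lemma diffuse_dist (eps : R) D s : diffuse eps D -> dist (D s).
Proof. by move=> dD; have [h1 h2] := dD s; split=> // x; case/andP: (h1 x). Qed.

Section Mean.
Variable p : item -> R.
Hypothesis dp : dist p.

Let term_ge0 (f : item -> \bar R) x : (0 <= f x)%E -> (0 <= (p x)%:E * f x)%E.
Proof. by move=> f0; rewrite mule_ge0 // lee_fin; case: dp. Qed.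

Lemma mean_ge0 f : (forall x, 0 <= f x)%E -> (0 <= mean p f)%E.
Proof. by move=> f0; apply: nneseries_ge0 => x _ _; exact: term_ge0. Qed.

Lemma le_mean (f g : item -> \bar R) : (forall x, 0 <= f x)%E ->
  (forall x, 0 < p x -> (f x <= g x)%E) -> (mean p f <= mean p g)%E.
Proof.
move=> f0 fg; apply: lee_nneseries => x _; first by move=> _; exact: term_ge0.
have := (proj1 dp) x; rewrite le_eqVlt => /orP [/eqP <-|px].
  by rewrite !mul0e.
by rewrite lee_pmul2l // fg.
Qed.

Lemma eq_mean (f g : item -> \bar R) : (forall x, 0 < p x -> f x = g x) -> mean p f = mean p g.
Proof.
move=> fg; apply: eq_eseriesr => x _.
have := (proj1 dp) x; rewrite le_eqVlt => /orP [/eqP <-|px]; last by rewrite fg.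
by rewrite !mul0e.
Qed.

Lemma meanD f g : (forall x, 0 <= f x)%E -> (forall x, 0 <= g x)%E ->
  mean p (fun x => f x + g x)%E = (mean p f + mean p g)%E.
Proof.
move=> f0 g0; rewrite -nneseriesD //.
- by apply: eq_eseriesr => x _; rewrite ge0_muleDr.
- by move=> x _ _; apply: term_ge0.
- by move=> x _ _; apply: term_ge0.
Qed.

Lemma meanZ c f : (0 <= c)%R -> (forall x, 0 <= f x)%E ->
  mean p (fun x => c%:E * f x)%E = (c%:E * mean p f)%E.
Proof.
move=> c0 f0; rewrite -nneseriesZl; last by move=> x _; exact: term_ge0.
by apply: eq_eseriesr => x _; rewrite muleCA.
Qed.

Lemma mean_scale c (f : item -> R) : 0 <= c -> (forall x, 0 <= f x) ->
  mean p (fun x => (c * f x)%:E) = (c%:E * mean p (fun x => (f x)%:E))%E.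
Proof. by move=> c0 f0; rewrite -meanZ // => x; rewrite lee_fin. Qed.

Lemma mean_cst c : 0 <= c -> mean p (fun=> c%:E) = c%:E.
Proof.
move=> c0; rewrite -[RHS]mule1 -(proj2 dp) -nneseriesZl; last first.
  by move=> x _; rewrite lee_fin; case: dp.
by apply: eq_eseriesr => x _; rewrite muleC.
Qed.

Lemma mean_fin (f : item -> R) (B : R) :
  (forall x, 0 <= f x) -> (forall x, 0 < p x -> f x <= B) ->
  mean p (fun x => (f x)%:E) \is a fin_num.
Proof.
move=> f0 fB; have B0 : 0 <= Num.max B 0 by rewrite le_max lexx orbT.
rewrite ge0_fin_numE; last by apply: mean_ge0 => x; rewrite lee_fin.
apply: (@le_lt_trans _ _ (mean p (fun=> (Num.max B 0)%:E))); last first.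
  by rewrite mean_cst // ltry.
by apply: le_mean => x *; rewrite lee_fin // le_max fB.
Qed.

Lemma mean_pred1 y : mean p (fun x => (x == y)%:R%:E) = (p y)%:E.
Proof.
rewrite /mean (@nneseriesD1 _ _ y) //; last first.
  by move=> x _; apply: (term_ge0 (f := fun x => (x == y)%:R%:E)); rewrite lee_fin.
rewrite eqxx mule1 eseries0 ?adde0 // => x _ /= /negPf ->.
by rewrite mule0.
Qed.

Lemma mean_mem (M : cache) :
  mean p (fun x => (x \in M)%:R%:E) = (\sum_(x <- M) p x)%:E.
Proof.
rewrite /mean (eq_eseriesr (g := fun x =>
    \sum_(y <- enum_fset M) ((p x)%:E * (x == y)%:R%:E))%E); last first.
  move=> x _; rewrite -ge0_sume_distrr; last by move=> *; rewrite lee_fin.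
  rewrite sumEFin; congr (_ * _%:E)%E; case: (boolP (x \in M)) => xM.
    rewrite (big_rem x) //= eqxx big_seq big1 ?addr0 // => y.
    rewrite mem_rem_uniq ?fset_uniq // inE => /andP [/negPf yx _].
    by rewrite eq_sym yx.
  rewrite big_seq big1 // => y yM; case: eqP => // xy.
  by rewrite xy yM in xM.
rewrite nneseries_sum; last first.
  move=> y x _; apply: (term_ge0 (f := fun x => (x == y)%:R%:E)).
  by rewrite lee_fin.
rewrite -sumEFin; apply: eq_bigr => y _; exact: mean_pred1.
Qed.

Lemma mean_notin (M : cache) :
  mean p (fun x => (x \notin M)%:R%:E) = (1 - \sum_(x <- M) p x)%:E.
Proof.
have : mean p (fun x => (x \notin M)%:R%:E + (x \in M)%:R%:E)%E = 1%:E.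
  rewrite -(mean_cst ler01); apply: eq_mean => x _.
  by case: (x \in M); rewrite /= ?add0e ?adde0.
rewrite meanD; try by move=> x; rewrite lee_fin.
rewrite mean_mem; have /fineK <- : mean p (fun x => (x \notin M)%:R%:E) \is a fin_num.
  by apply: (mean_fin (B := 1)) => x //; case: (x \in M).
by move: (fine _) => a /(congr1 fine) /= <-; rewrite addrK.
Qed.

(** The form in which a probabilistic estimate enters an amortized analysis: the inequality between
    [a] and [b] is checked for each request up to correction terms [g] and [h], whose means are
    compared separately. The bound on [g] makes its mean finite, so that it can be cancelled. *)
Lemma le_mean_cancel (a b g h : item -> R) (B : R) :
  (forall x, 0 <= a x) -> (forall x, 0 <= b x) -> (forall x, 0 <= g x <= B) ->
  (forall x, 0 <= h x) ->
  (forall x, 0 < p x -> a x + g x <= b x + h x) ->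
  (mean p (fun x => (h x)%:E) <= mean p (fun x => (g x)%:E))%E ->
  (mean p (fun x => (a x)%:E) <= mean p (fun x => (b x)%:E))%E.
Proof.
move=> a0 b0 gB h0 agbh hg.
have g0 x : 0 <= g x by case/andP: (gB x).
have gfin : mean p (fun x => (g x)%:E) \is a fin_num.
  by apply: (mean_fin (B := B)) => // x; case/andP: (gB x).
rewrite -(leeD2rE _ _ gfin) -meanD; try by move=> x; rewrite lee_fin.
apply: (@le_trans _ _ (mean p (fun x => ((b x)%:E + (h x)%:E)%E))).
  apply: le_mean => x; first by rewrite adde_ge0 // lee_fin.
  by move=> px; rewrite -!EFinD lee_fin agbh.
rewrite meanD; try by move=> x; rewrite lee_fin.
by rewrite leeD2l.
Qed.

End Mean.

Lemma expectS D n s (F : seq item -> \bar R) :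
  expect D n.+1 s F = mean (D s) (fun x => expect D n (rcons s x) F).
Proof. by []. Qed.

Section Process.
Variables (eps : R) (D : seq item -> item -> R).
Hypothesis dD : diffuse eps D.
Let dist_D s : dist (D s) := diffuse_dist s dD.

Lemma expect_ge0 n s F : (forall s, 0 <= F s) ->
  (0 <= expect D n s (fun s => (F s)%:E))%E.
Proof.
move=> F0; elim: n s => [|n IH] s; first by rewrite lee_fin.
by apply: mean_ge0 => // x; exact: IH.
Qed.

Lemma le_expect n s F G : (forall s, 0 <= F s) -> (forall s, F s <= G s) ->
  (expect D n s (fun s => (F s)%:E) <= expect D n s (fun s => (G s)%:E))%E.
Proof.
move=> F0 FG; elim: n s => [|n IH] s; first by rewrite lee_fin.
by apply: le_mean => // x; exact: expect_ge0.
Qed.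

Lemma expectD n s F G : (forall s, 0 <= F s) -> (forall s, 0 <= G s) ->
  (expect D n s (fun s => (F s + G s)%:E) =
   expect D n s (fun s => (F s)%:E) + expect D n s (fun s => (G s)%:E))%E.
Proof.
move=> F0 G0; elim: n s => [|n IH] s; first by rewrite /= EFinD.
rewrite !expectS -meanD //; try by move=> x; exact: expect_ge0.
by apply: eq_mean => // x _; exact: IH.
Qed.

Lemma expectZ n s c F : 0 <= c -> (forall s, 0 <= F s) ->
  (expect D n s (fun s => (c * F s)%:E) =
   c%:E * expect D n s (fun s => (F s)%:E))%E.
Proof.
move=> c0 F0; elim: n s => [|n IH] s; first by rewrite /= EFinM.
rewrite !expectS -meanZ //; try by move=> x; exact: expect_ge0.
by apply: eq_mean => // x _; exact: IH.
Qed.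

Lemma expect_cst n s c : 0 <= c -> expect D n s (fun=> c%:E) = c%:E.
Proof.
move=> c0; elim: n s => [//|n IH] s; rewrite expectS -[RHS](mean_cst (dist_D s)) //.
by apply: eq_mean => // x _; exact: IH.
Qed.

(** Bounded growth makes the expectation after any number of requests finite, so that [emean] can be
    a real number and inequalities can be rearranged freely. *)
Definition tame F := (forall s, 0 <= F s) /\
  exists2 B, 0 <= B & forall s x, F (rcons s x) <= F s + B.

Lemma tame_cst c : 0 <= c -> tame (fun=> c).
Proof. by move=> c0; split=> //; exists 0 => // s x; rewrite addr0. Qed.

Lemma tameD F G : tame F -> tame G -> tame (fun s => F s + G s).
Proof.
move=> [F0 [B B0 FB]] [G0 [C C0 GC]]; split=> [s|]; first by rewrite addr_ge0.
by exists (B + C); rewrite ?addr_ge0 // => s x; rewrite addrACA lerD.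
Qed.

Lemma tameZ c F : 0 <= c -> tame F -> tame (fun s => c * F s).
Proof.
move=> c0 [F0 [B B0 FB]]; split=> [s|]; first by rewrite mulr_ge0.
by exists (c * B); rewrite ?mulr_ge0 // => s x; rewrite -mulrDr ler_wpM2l.
Qed.

Lemma expect_tame_le n s F B : 0 <= B -> (forall s, 0 <= F s) ->
  (forall s x, F (rcons s x) <= F s + B) ->
  (expect D n s (fun s => (F s)%:E) <= (F s + n%:R * B)%:E)%E.
Proof.
move=> B0 F0 FB; elim: n s => [|n IH] s; first by rewrite mul0r addr0.
rewrite expectS; have c0 : 0 <= F s + n.+1%:R * B by rewrite addr_ge0 ?mulr_ge0.
rewrite -(mean_cst (dist_D s) c0); apply: le_mean => // x; first exact: expect_ge0.
move=> _; apply: le_trans (IH _) _; rewrite lee_fin -natr1 mulrDl mul1r addrA.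
by rewrite addrAC lerD2r.
Qed.

Lemma expect_fin n s F : tame F -> expect D n s (fun s => (F s)%:E) \is a fin_num.
Proof.
move=> [F0 [B B0 FB]]; rewrite ge0_fin_numE ?expect_ge0 //.
exact: le_lt_trans (expect_tame_le n s B0 F0 FB) (ltry _).
Qed.

Definition emean n F : R := fine (expect D n [::] (fun s => (F s)%:E)).

Lemma emeanE n F : tame F ->
  expect D n [::] (fun s => (F s)%:E) = (emean n F)%:E.
Proof. by move=> tF; rewrite /emean fineK ?expect_fin. Qed.

Lemma emeanD n F G : tame F -> tame G ->
  emean n (fun s => F s + G s) = emean n F + emean n G.
Proof.
move=> tF tG; rewrite {1}/emean expectD ?fineD ?expect_fin //.
- by case: tF.
- by case: tG.
Qed.

Lemma emeanZ n c F : 0 <= c -> tame F -> emean n (fun s => c * F s) = c * emean n F.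
Proof.
move=> c0 tF; rewrite {1}/emean expectZ ?fineM ?expect_fin //.
by case: tF.
Qed.

Lemma emean_cst n c : 0 <= c -> emean n (fun=> c) = c.
Proof. by move=> c0; rewrite /emean expect_cst. Qed.

Lemma le_emean n F G : tame F -> tame G -> (forall s, F s <= G s) ->
  emean n F <= emean n G.
Proof.
move=> tF tG FG; rewrite -lee_fin -!emeanE //; apply: le_expect => //.
by case: tF.
Qed.

Lemma emean_ge0 n F : tame F -> 0 <= emean n F.
Proof. by move=> tF; rewrite -lee_fin -emeanE // expect_ge0 //; case: tF. Qed.

(* [F1 - F2] is a supermartingale; the hypothesis is written without
   subtraction because [mean] is meant for nonnegative functions. *)
Lemma emean_drift (P : seq item -> Prop) F1 F2 : tame F1 -> tame F2 ->
  P [::] -> (forall s x, P s -> 0 < D s x -> P (rcons s x)) ->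
  (forall s, P s -> (mean (D s) (fun x => (F1 (rcons s x) + F2 s)%:E) <=
                     mean (D s) (fun x => (F2 (rcons s x) + F1 s)%:E))%E) ->
  forall n, emean n F1 + F2 [::] <= emean n F2 + F1 [::].
Proof.
move=> t1 t2 P0 PS drift n.
have F10 := proj1 t1; have F20 := proj1 t2.
suff H s : P s -> (expect D n s (fun s => (F1 s)%:E) + (F2 s)%:E <=
    expect D n s (fun s => (F2 s)%:E) + (F1 s)%:E)%E.
  by have := H _ P0; rewrite !emeanE.
elim: n s => [|n IH] s Ps; first by rewrite /= addeC.
rewrite !expectS; set X1 := mean _ _; set X2 := mean _ _.
pose Y1 := mean (D s) (fun x => (F1 (rcons s x))%:E).
pose Y2 := mean (D s) (fun x => (F2 (rcons s x))%:E).
have fY1 : Y1 \is a fin_num.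
  by case: t1 => _ [B _ FB]; apply: (mean_fin (dist_D s) (B := F1 s + B)).
have fY2 : Y2 \is a fin_num.
  by case: t2 => _ [B _ FB]; apply: (mean_fin (dist_D s) (B := F2 s + B)).
have h1 : (X1 + Y2 <= X2 + Y1)%E.
  rewrite -!meanD //; try by move=> x; rewrite ?lee_fin //; exact: expect_ge0.
  apply: le_mean => // x.
    by rewrite adde_ge0 ?lee_fin // expect_ge0.
  by move=> Dx; apply: IH; apply: PS.
have h2 : (Y1 + (F2 s)%:E <= Y2 + (F1 s)%:E)%E.
  rewrite -(mean_cst (dist_D s) (F20 s)) -(mean_cst (dist_D s) (F10 s)).
  rewrite -!meanD //; try by move=> x; rewrite lee_fin.
  exact: drift.
have fX1 : X1 \is a fin_num by exact: (expect_fin n.+1 s t1).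
have fX2 : X2 \is a fin_num by exact: (expect_fin n.+1 s t2).
move: h1 h2; rewrite -(fineK fX1) -(fineK fX2) -(fineK fY1) -(fineK fY2).
rewrite -!EFinD !lee_fin; lra.
Qed.

End Process.

Lemma optn_tame k : (0 < k)%N -> tame (fun s => (optn k s)%:R : R).
Proof.
move=> hk; split=> [s|]; first exact: ler0n.
exists k%:R => // s x; rewrite -natrD ler_nat.
by case/andP: (optn_rcons_le s x hk).
Qed.

Lemma ratio_le k (eps : R) (f : seq item -> \bar R) F (c : R) :
  (0 < k)%N -> (forall s, f s = (F s)%:E) -> tame F ->
  (forall D, diffuse eps D -> exists b, forall n,
     emean D n F <= c * emean D n (fun s => (optn k s)%:R) + b) ->
  (Defs.ratio k eps f <= c%:E)%E.
Proof.
move=> hk fF tF H; apply: ereal_inf_lbound; exists c => // D dD.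
have [b Hb] := H D dD; exists b => n.
have -> : f = (fun s => (F s)%:E) by apply: funext.
have -> : Opt R k = (fun s => (optn k s)%:R%:E).
  by apply: funext => s; rewrite OptE.
by rewrite !(emeanE dD) //; [rewrite -EFinM -EFinD lee_fin | apply: optn_tame].
Qed.

(** The ratio is an infimum over [c], so it is enough to defeat every smaller [c'], by an adversary
    chosen before the additive constant [b]. *)
Lemma ratio_ge k (eps : R) (f : seq item -> \bar R) F (c : R) :
  (0 < k)%N -> (forall s, f s = (F s)%:E) -> tame F ->
  (forall c', c' < c -> exists2 D, diffuse eps D & forall b, exists n,
     c' * emean D n (fun s => (optn k s)%:R) + b < emean D n F) ->
  (c%:E <= Defs.ratio k eps f)%E.
Proof.
move=> hk fF tF H; apply: le_ereal_inf_tmp => _ [c' Hc' <-].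
rewrite lee_fin leNgt; apply/negP => c'c.
have [D dD Hb] := H c' c'c; have [b Hn] := Hc' D dD.
have [n] := Hb b; rewrite ltNge => /negP; apply.
have := Hn n.
have -> : f = (fun s => (F s)%:E) by apply: funext.
have -> : Opt R k = (fun s => (optn k s)%:R%:E).
  by apply: funext => s; rewrite OptE.
by rewrite !(emeanE dD) //; exact: optn_tame.
Qed.

End Expectation.

(** * Lazy marking algorithms *)

Section Marking.
Local Open Scope fset_scope.
Local Open Scope nat_scope.
Implicit Types (A : alg) (s : seq item).

Lemma online_card k A s : online k A -> #|` A s| <= k.
Proof.
case=> A0 AS; case: (lastP s) => [|t x]; first by rewrite A0 cardfs0.
by case: (AS t x).
Qed.

Lemma online_evict_le k A s x : online k A -> #|` A s `\` A (rcons s x)| <= k.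
Proof.
move=> oA; apply: leq_trans (online_card s oA).
by apply: fsubset_leq_card; apply: fsubsetDl.
Qed.

Lemma lazy_evict k A s x : lazy k A ->
  #|` A s `\` A (rcons s x)| <= (x \notin A s).
Proof.
move=> lA; have [l1 l2] := lA s x.
have [->|/l1 [xA cA]] := eqVneq (A s `\` A (rcons s x)) fset0.
  by rewrite cardfs0.
by rewrite xA l2.
Qed.

Lemma lazy_full k A s x : online k A -> lazy k A -> #|` A s| = k ->
  if x \in A s then A (rcons s x) = A s
  else exists2 y, y \in A s & A (rcons s x) = x |` (A s `\ y).
Proof.
move=> oA lA cA; have [l1 l2] := lA s x; have [xA' cA'] := (proj2 oA) s x.
have cI := cardfsID (A (rcons s x)) (A s).
case: ifPn => xA.
  have D0 : A s `\` A (rcons s x) = fset0.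
    by apply/eqP; apply: contraT => /l1 []; rewrite xA.
  apply/esym/eqP; rewrite eqEfcard.
  apply/andP; split; last by rewrite cA.
  by rewrite -fsetD_eq0 D0.
have D1 := l2 xA cA; move/eqP: D1 (D1) => /cardfs1P [y yE] D1.
have yA : y \in A s `\` A (rcons s x) by rewrite yE inE.
move: yA; rewrite inE => /andP [yA' yA].
exists y => //; apply/esym/eqP; rewrite eqEfcard; apply/andP; split.
  apply/fsubsetP => z; rewrite !inE => /orP [/eqP ->|/andP [zy zA]] //.
  apply: contraT => zA'; have : z \in A s `\` A (rcons s x) by rewrite inE zA' zA.
  by rewrite yE inE (negPf zy).
rewrite cardfsU1 !inE (negPf xA) andbF /= add1n.
by have := cardfsD1 y (A s); rewrite yA cA add1n => <-.
Qed.

Lemma marks_rcons k A s x :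
  marks k A (rcons s x) = x |` erase k (A s) (marks k A s) x.
Proof. by rewrite /marks rev_rcons /= revK. Qed.

(** Marked items stay in the cache, so a full cache that is entirely marked consists of the [k]
    items of the current phase. The marks are therefore erased exactly when a phase begins. *)
Lemma marking_phases k A s : 0 < k -> marking k A ->
  marks k A s = ph_cur (phases k s) /\ ph_cur (phases k s) `<=` A s.
Proof.
move=> hk [oA mA]; elim/last_ind: s => [|s x [IHm IHs]].
  by split; rewrite //= fsub0set.
have lA := online_card s oA; have [xA' _] := (proj2 oA) s x.
have [lM _ _ _] := phases_inv s hk.
have sub : erase k (A s) (marks k A s) x `<=` A s ->
    x |` erase k (A s) (marks k A s) x `<=` A (rcons s x).
  move=> eA; apply/fsubsetP => z; rewrite !inE => /orP [/eqP -> //|ze].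
  apply: contraT => zA'; have := mA s x z.
  by rewrite inE zA' (fsubsetP eA) //= ze => /(_ isT).
rewrite marks_rcons phases_rcons /phase_step; move: IHm IHs lM sub.
case: (phases k s) => O M F N /= -> MA lM sub.
have eM : A s `<=` M -> A s = M.
  by move=> AM; apply/eqP; rewrite eqEfsubset AM.
case: (boolP (x \in M)) => xM /=.
  have ee : erase k (A s) M x = M by rewrite /erase (fsubsetP MA).
  have xMM : x |` M = M.
    by apply/fsetP => z; rewrite !inE; case: eqP => [->|].
  by move: sub; rewrite ee xMM; split=> //; apply: sub.
case: ltnP => ltM /=.
  have ee : erase k (A s) M x = M.
    rewrite /erase; case: and3P => // -[_ /eqP cA /eM AM].
    by move: ltM; rewrite -AM cA ltnn.
  by move: sub; rewrite ee; split=> //; apply: sub.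
have AM : A s = M.
  apply/esym/eqP; rewrite eqEfcard MA /=; exact: leq_trans ltM.
have ee : erase k (A s) M x = fset0.
  rewrite /erase AM xM fsubset_refl /= andbT.
  by have -> : #|` M| == k by rewrite eqn_leq lM.
move: sub; rewrite ee => sub; rewrite fsetU0; split=> //.
by have := sub (fsub0set _); rewrite fsetU0.
Qed.

(** When a phase begins the cache is the set of the phase just finished. From then on a lazy
    algorithm only brings in requested items, by swaps that keep the cache full. *)
Lemma lazy_marking_phases k A s : 0 < k -> lazy_marking k A ->
  let p := phases k s in 0 < ph_num p ->
  #|` A s| = k /\ A s `<=` ph_old p `|` ph_cur p.
Proof.
move=> hk [mA lA]; elim/last_ind: s => [//|s x IH] /=.
have oA := proj1 mA; have lAs := online_card s oA.
have [_ MA] := marking_phases s hk mA; have [lM _ _ _] := phases_inv s hk.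
have full := @lazy_full k A s x oA lA.
have cx y : x \notin A s -> y \in A s -> #|` x |` (A s `\ y)| = #|` A s|.
  move=> xA yA; rewrite cardfsU1 !inE (negPf xA) andbF /=.
  by have := cardfsD1 y (A s); rewrite yA => ->.
rewrite phases_rcons /phase_step; move: IH MA lM.
case: (phases k s) => O M F N /= IH MA lM.
case: (boolP (x \in M)) => xM /=.
  move=> /IH [cA sA]; move: (full cA).
  by rewrite (fsubsetP MA _ xM) => ->.
case: (ltnP #|` M| k) => ltM /=.
  move=> /IH [cA sA]; move: (full cA); case: ifPn => xA.
    by move=> ->; rewrite fsetUCA (fsubset_trans sA) // fsubsetUr.
  case=> y yA ->; rewrite cx //; split=> //.
  rewrite fsetUCA; apply: fsetUS; apply: fsubset_trans sA.
  exact: fsubsetDl.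
move=> _; have AM : A s = M.
  apply/esym/eqP; rewrite eqEfcard MA /=; exact: leq_trans ltM.
have cA : #|` A s| = k by apply/eqP; rewrite eqn_leq lAs AM.
move: (full cA); rewrite AM (negPf xM) => -[y yM ->].
rewrite -{1 2}AM cx ?AM // -?AM ?cA //; split=> //.
by rewrite AM fsetUC fsetSU // fsubsetDl.
Qed.

(** The filter of [lru_rev] keeps the items younger than some cached item. Distinct requested items
    have distinct times of last request, so exactly one item is removed, the oldest. *)
Lemma lru_rev_inv k r : 0 < k ->
  {subset lru_rev k r <= r} /\ #|` lru_rev k r| <= k /\
  forall x r', r = x :: r' -> let C := lru_rev k r' in
    x \notin C -> #|` C| = k ->
    exists2 y, y \in C & lru_rev k r = x |` (C `\ y) /\
      forall z, z \in C -> index z r' <= index y r'.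
Proof.
move=> hk; elim: r => [|x r [IHs [IHk _]]] /=; first by split=> //; split=> //; rewrite cardfs0.
set C := lru_rev k r in IHs IHk *.
have full : x \notin C -> #|` C| = k ->
    exists2 y, y \in C & [fset z in C | has (fun y => index z r < index y r) C] =
      C `\ y /\ forall z, z \in C -> index z r <= index y r.
  move=> xC cC; have C0 : C != fset0 by rewrite -cardfs_gt0 cC.
  have [z0 z0C] := fset0Pn _ C0.
  have ex : exists n, has (fun z => index z r == n) C.
    by exists (index z0 r); apply/hasP; exists z0.
  have bd n : has (fun z => index z r == n) C -> n <= size r.
    by move=> /hasP [z _ /eqP <-]; exact: index_size.
  case: (ex_maxnP ex bd) => n /hasP [y yC /eqP iy] nmax.
  have ymax z : z \in C -> index z r <= index y r.
    by move=> zC; rewrite iy; apply: nmax; apply/hasP; exists z.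
  exists y => //; split=> //; apply/fsetP => z; rewrite !inE /=.
  case: (boolP (z \in C)) => zC; rewrite ?andbF ?andbT //=.
  apply/hasP/idP => [[w wC lt]|zy].
    by apply: contraTneq lt => ->; rewrite -leqNgt ymax.
  exists y => //; rewrite ltn_neqAle ymax // andbT.
  apply: contra zy => /eqP e; apply/eqP.
  by rewrite -(nth_index 0 (IHs z zC)) e nth_index // IHs.
split; last split.
- move=> z; rewrite inE; case: ifPn => xC; first by move=> /IHs ->; rewrite orbT.
  case: ltnP => _; rewrite !inE => /orP [->//|]; first by move=> /IHs ->; rewrite orbT.
  by move=> /andP [/IHs -> _]; rewrite orbT.
- case: ifPn => // xC; case: ltnP => ltC; first by rewrite cardfsU1 xC.
  have cC : #|` C| = k by apply/eqP; rewrite eqn_leq IHk.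
  have [y yC [-> _]] := full xC cC.
  rewrite cardfsU1 !inE (negPf xC) andbF /=.
  by have := cardfsD1 y C; rewrite yC cC => <-.
- move=> _ _ [<- <-] xC cC; have [y yC [e ymax]] := full xC cC.
  by exists y => //; rewrite (negPf xC) cC ltnn e.
Qed.

(** The marked items are those of an initial segment of the reversed sequence ([marksE]), that is,
    the most recently requested ones. If the oldest cached item is marked, so is the whole cache,
    and the marks are erased before the eviction. *)
Lemma lru_lazy_marking k : 0 < k -> lazy_marking k (lru k).
Proof.
move=> hk; have lruS s x : lru k (rcons s x) = lru_rev k (x :: rev s).
  by rewrite /lru rev_rcons.
have oA : online k (lru k).
  split=> // s x; rewrite lruS; have [_ [lk _]] := lru_rev_inv (x :: rev s) hk.
  split=> //=; case: ifP => // _; case: ltnP => _; exact: fset1U1.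
have step s x : [\/ lru k s `<=` lru k (rcons s x) /\
      (x \in lru k s \/ #|` lru k s| < k) |
    [/\ x \notin lru k s, #|` lru k s| = k & exists y, [/\ y \in lru k s,
     lru k s `\` lru k (rcons s x) = [fset y] &
     forall z, z \in lru k s -> index z (rev s) <= index y (rev s)]]].
  rewrite lruS; have [_ [_ full]] := lru_rev_inv (x :: rev s) hk.
  case: (boolP (x \in lru k s)) => xC.
    by left; rewrite /= (_ : x \in lru_rev _ _) //; split=> //; left.
  case: (ltnP #|` lru k s| k) => [ltC|leC].
    left; split; last by right.
    by rewrite /= (negPf xC) ltC fsubsetUr.
  have cC : #|` lru k s| = k.
    by apply/eqP; rewrite eqn_leq leC (online_card s oA).
  right; split=> //; have [y yC [-> ymax]] := full _ _ (erefl _) xC cC.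
  exists y; split=> //; apply/fsetP => z; rewrite !inE.
  case: (eqVneq z y) => [->|zy] /=; last first.
    by rewrite negb_or -andbA; case: (z \in lru_rev _ _); rewrite ?andbF.
  by rewrite orbF yC andbT; apply: contraNneq xC => <-.
have marksE s : exists n, marks k (lru k) s =i take n (rev s).
  elim/last_ind: s => [|s x [n IH]]; first by exists 0 => z; rewrite inE.
  rewrite marks_rcons rev_rcons /erase; case: ifP => _.
    by exists 1 => z; rewrite /= take0 !inE orbF.
  by exists n.+1 => z; rewrite /= !inE IH.
split; last first.
  move=> s x; case: (step s x) => [[sub xC]|[xC cC [y [yC yE _]]]].
    move: sub; rewrite -fsetD_eq0 => /eqP ->; rewrite eqxx; split=> //.
    case: xC => [->//|lt] _ e; by rewrite e ltnn in lt.
  by rewrite yE cardfs1.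
split=> // s x y; case: (step s x) => [[sub _]|[xC cC [z [zC zE zmax]]]].
  by move: sub; rewrite -fsetD_eq0 => /eqP ->.
rewrite zE inE => /eqP ->; rewrite /erase xC cC eqxx /=.
case: ifPn => // nsub; apply: contra nsub => zM.
have [n Mn] := marksE s; apply/fsubsetP => w wC; rewrite Mn.
have szM : z \in rev s by apply: (proj1 (lru_rev_inv (rev s) hk)).
have swM : w \in rev s by apply: (proj1 (lru_rev_inv (rev s) hk)).
move: zM; rewrite Mn !in_take // => lt.
exact: leq_ltn_trans (zmax w wC) lt.
Qed.

End Marking.

(** * The bound [2 Phi] by amortization against new requests *)

Section DetUpper.
Context {R : realType}.
Implicit Types (A : alg) (s : seq item) (eps : R).
Local Open Scope fset_scope.
Local Open Scope ring_scope.

Lemma tame_bounded (F : seq item -> R) B : (forall s, 0 <= F s <= B) -> tame F.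
Proof.
move=> FB; split=> [s|]; first by case/andP: (FB s).
exists B => [|s x]; first by case/andP: (FB [::]) => h1 h2; apply: le_trans h2.
have /andP [_ h1] := FB (rcons s x); have /andP [h2 _] := FB s.
by rewrite (le_trans h1) // ler_wpDl.
Qed.

Lemma tame_cost k A : online k A -> tame (fun s => (cost A s)%:R : R).
Proof.
move=> oA; split=> [s|]; first exact: ler0n.
exists k%:R => // s x; rewrite (cost_rcons _ _ (proj1 oA)) -natrD ler_nat.
by rewrite leq_add2l online_evict_le.
Qed.

Lemma tame_nat (f : seq item -> nat) (B : nat) :
  (forall s x, f (rcons s x) <= f s + B)%N -> tame (fun s => (f s)%:R : R).
Proof.
move=> fB; split=> [s|]; first exact: ler0n.
by exists B%:R => // s x; rewrite -natrD ler_nat.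
Qed.

Lemma tame_ph_new k : tame (fun s => (ph_new (phases k s))%:R : R).
Proof.
apply: (@tame_nat _ 1) => s x; rewrite phases_rcons /phase_step.
case: ifP => _; first by lia.
by case: ltnP => _ /=; [case: (_ && _)|]; lia.
Qed.

(* The probability that a request to an unmarked item is a request to a given
   item, when [i] items are marked, is at most [weight eps i]. *)
Definition weight eps (i : nat) : R := (Num.max (eps^-1 - i%:R) 1)^-1.

(** The price of one hole, an item of the previous phase missing from the cache, for the rest of a
    phase with [i] marked items: a fault on a hole only moves it. *)
Definition tail_weight eps (k i : nat) : R := \sum_(i <= j < k) weight eps j.

Lemma weight_gt0 eps i : 0 < weight eps i.
Proof. by rewrite invr_gt0 lt_max ltr01 orbT. Qed.

Lemma tail_weight_ge0 eps k i : 0 <= tail_weight eps k i.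
Proof. by apply: sumr_ge0 => j _; rewrite ltW ?weight_gt0. Qed.

Lemma tail_weight_recl eps k i : (i < k)%N ->
  tail_weight eps k i = weight eps i + tail_weight eps k i.+1.
Proof. by move=> ik; rewrite /tail_weight big_ltn. Qed.

Lemma tail_weightkk eps k : tail_weight eps k k = 0.
Proof. by rewrite /tail_weight big_geq. Qed.

Lemma le_tail_weight eps k i j : (i <= j)%N ->
  tail_weight eps k j <= tail_weight eps k i.
Proof.
move=> ij; case: (leqP j k) => jk; last first.
  by rewrite {1}/tail_weight big_geq ?tail_weight_ge0 // ltnW.
rewrite /tail_weight (big_cat_nat (n := j) ij jk) /= lerDr sumr_ge0 // => l _.
by rewrite ltW ?weight_gt0.
Qed.

Lemma PhiE eps k : Phi eps k = 1 + tail_weight eps k 1.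
Proof. by []. Qed.

Lemma sum_le_eps eps (p : item -> R) (C : cache) :
  (forall x, 0 <= p x <= eps) -> \sum_(x <- C) p x <= #|` C|%:R * eps.
Proof.
move=> pe; rewrite mulr_natl -iter_addr_0 -count_predT -big_const_seq.
by apply: ler_sum => x _; case/andP: (pe x).
Qed.

(** If [eps^-1 - #|M| > 1], the items of [H] receive at most [m eps] while the unmarked items
    receive at least [1 - #|M| eps]. Otherwise the weight is 1 and it is enough that [H] is
    unmarked, which needs [1 <= m]; hence the separate case [m = 0]. *)
Lemma hole_prob eps (p : item -> R) (M H : cache) (m : nat) :
  0 < eps -> (forall x, 0 <= p x <= eps) -> dist p ->
  (#|` H| <= m)%N -> [disjoint H & M]%fset ->
  \sum_(x <- H) p x <= m%:R * weight eps #|` M| * (1 - \sum_(x <- M) p x).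
Proof.
move=> e0 pe dp Hm HM; case: m Hm => [|m] Hm.
  move: Hm; rewrite leqn0 cardfs_eq0 => /eqP ->.
  by rewrite !mul0r big_seq_fset0.
have sM := sum_le_eps M pe; have sH := sum_le_eps H pe.
have sHM : \sum_(x <- H) p x <= 1 - \sum_(x <- M) p x.
  rewrite lerBrDr -lee_fin EFinD -!mean_mem // -(mean_cst dp ler01) -meanD //.
  apply: le_mean => // x; first by rewrite adde_ge0 // lee_fin.
  move=> _; rewrite -EFinD lee_fin -natrD lern1.
  by have := fdisjointP HM x; case: (x \in H) => [/(_ isT) /negPf ->|_] //; case: (x \in M).
have h0 : 0 <= \sum_(x <- H) p x by apply: sumr_ge0 => x _; case/andP: (pe x).
have mH : \sum_(x <- H) p x <= m.+1%:R * eps.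
  by apply: le_trans sH _; rewrite ler_pM2r // ler_nat.
have m1 : 1 <= m.+1%:R :> R by rewrite ler1n.
rewrite /weight; case: (lerP (eps^-1 - (#|` M|)%:R) 1) => w1.
  rewrite invr1 mulr1; move: sHM h0; set X := \sum_(x <- H) p x.
  set Y := 1 - _ => XY X0; apply: (le_trans XY).
  by rewrite -[X in X <= _]mul1r ler_wpM2r // (le_trans X0 XY).
apply: le_trans mH _; rewrite -mulrA ler_pM2l ?ltr0n //.
have q0 : 0 < eps^-1 - (#|` M|)%:R by apply: lt_trans w1.
rewrite ler_pdivlMl // mulrBl mulVf ?gt_eqF //; lra.
Qed.

(** For each new request, [Phi] pays 1 for its own fault and [tail_weight eps k 1] for the hole that
    it opens. The factor 2 is the loss in [ph_new_le_optn]. *)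
Lemma lazy_marking_upper k eps A : (0 < k)%N -> 0 < eps ->
  lazy_marking k A -> (det_ratio k eps A <= (2 * Phi eps k)%:E)%E.
Proof.
move=> hk e0 lmA; have [mA lA] := lmA; have oA := proj1 mA.
have tc := @tame_cost k A oA; have tn := tame_ph_new k.
have Phi0 : 0 <= Phi eps k by rewrite PhiE addr_ge0 ?tail_weight_ge0.
apply: (ratio_le hk (F := fun s => (cost A s)%:R)) => // D dD.
(* Each new item of the phase has opened one hole. The first phase has no predecessor; there the
   potential holds 1 for each of the items still to come. *)
pose pot s := let p := phases k s in
  if (0 < ph_num p)%N
  then (ph_fresh p)%:R * tail_weight eps k #|` ph_cur p|
  else (k - #|` ph_cur p|)%:R.
have pot0 s : 0 <= pot s.
  rewrite /pot; case: ifP => // _; by rewrite mulr_ge0 ?tail_weight_ge0.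
have tpot : tame pot.
  apply: (tame_bounded (B := k%:R * tail_weight eps k 0 + k%:R)) => s.
  rewrite pot0 /= /pot; have [lM _ _ _] := phases_inv s hk; case: ifP => _.
    rewrite ler_wpDr // ler_pM ?tail_weight_ge0 ?le_tail_weight // ler_nat.
    rewrite /ph_fresh; case: ifP => // _; apply: leq_trans lM.
    by apply: fsubset_leq_card; apply: fsubsetDl.
  by rewrite ler_wpDl ?mulr_ge0 ?tail_weight_ge0 // ler_nat leq_subr.
have potn : pot [::] = k%:R by rewrite /pot /= -[RHS](congr1 _ (subn0 k)) -(cardfs0 item).
exists k%:R => n.
have : emean D n (fun s => (cost A s)%:R + pot s) + Phi eps k * 0 <=
       emean D n (fun s => Phi eps k * (ph_new (phases k s))%:R) +
       (0%:R + k%:R).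
  have := @emean_drift _ _ _ dD (fun=> True)
    (fun s => (cost A s)%:R + pot s)
    (fun s => Phi eps k * (ph_new (phases k s))%:R).
  rewrite potn /=; apply=> //; try exact: tameD; try exact: tameZ.
  move=> s _; have dp := diffuse_dist s dD.
  have [_ MA] := marking_phases s hk mA; have inv := @lazy_marking_phases k A s hk lmA.
  have [lM hO hF _] := phases_inv s hk.
  have nn s' : 0 <= Phi eps k * (ph_new (phases k s'))%:R by rewrite mulr_ge0.
  have nn' s' : 0 <= (cost A s')%:R + pot s' by rewrite addr_ge0.
  have cS x : (cost A (rcons s x))%:R <= (cost A s)%:R + (x \notin A s)%:R :> R.
    by rewrite (cost_rcons _ _ (proj1 oA)) -natrD ler_nat leq_add2l (lazy_evict _ _ lA).
  set M := ph_cur (phases k s) in MA lM *.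
  case: (boolP ((0 < ph_num (phases k s))%N && (#|` M| < k)%N)) => cas; last first.
    apply: le_mean => // x; first by rewrite lee_fin addr_ge0.
    move=> _; rewrite lee_fin; have := cS x.
    rewrite /pot phases_rcons /phase_step -/M.
    case: (boolP (x \in M)) => xM /=.
      rewrite (fsubsetP MA _ xM) addr0 -/M; lra.
    have x1 : (x \notin A s)%:R <= 1 :> R by case: (x \in A s).
    case: (ltnP #|` M| k) => ltM /=.
      move: cas; rewrite ltM andbT -/M => /negPf ->.
      rewrite addn0 cardfsU1 xM natrB; last by rewrite add1n.
      rewrite natrB; last exact: ltnW.
      rewrite add1n -natr1; lra.
    have -> : #|` M| = k by apply/eqP; rewrite eqn_leq lM.
    rewrite /ph_fresh /= tail_weightkk mulr0 subnn if_same cardfs1.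
    rewrite (_ : [fset x] `\` M = [fset x]) ?cardfs1; last first.
      by apply/fsetP => z; rewrite !inE; case: eqP => [->|]; rewrite ?xM ?andbF.
    rewrite mul1r PhiE -natr1; lra.
  case/andP: cas => F0 ltM; have [cA sA] := inv F0; have [cO Fr] := hO F0.
  set O := ph_old (phases k s) in cO sA *.
  set m := ph_fresh (phases k s) in Fr *.
  (* The cache has [k] items, and those outside the previous phase are among the [m] new ones; so at
     most [m] of the [k] items of the previous phase are missing. *)
  have holes : (#|` O `\` A s| <= m)%N.
    rewrite /m /ph_fresh F0 -/O -/M.
    have := cardfsID (A s) O; have := cardfsID O (A s).
    have : (#|` A s `\` O| <= #|` M `\` O|)%N.
      apply: fsubset_leq_card; apply/fsubsetP => z; rewrite !inE => /andP [zO zA].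
      by have := fsubsetP sA _ zA; rewrite inE (negPf zO) => /= ->.
    rewrite (fsetIC O); clia.
  have w0 := weight_gt0 eps #|` M|.
  (* [h] is the indicator of a request to a hole, the only faults besides those on new items; [g]
     dominates it in the mean by [hole_prob], and is what the potential loses when an unmarked item
     gets marked. *)
  apply: (le_mean_cancel dp
    (g := fun x => m%:R * weight eps #|` M| * (x \notin M)%:R)
    (h := fun x => (x \in O `\` A s)%:R)
    (B := m%:R * weight eps #|` M|)).
  - by move=> x; rewrite addr_ge0.
  - by move=> x; rewrite addr_ge0.
  - move=> x; have mw0 : 0 <= m%:R * weight eps #|` M| by rewrite mulr_ge0 // ltW.
    by case: (x \notin M); rewrite ?mulr1 ?mulr0 !lexx ?mw0.
  - by [].
  - move=> x _; have := cS x; rewrite /pot phases_rcons /phase_step -/M -/O F0.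
    case: (boolP (x \in M)) => xM /=.
      rewrite (fsubsetP MA _ xM) F0 -/M -/m inE (fsubsetP MA _ xM) /=; lra.
    rewrite ltM /= F0 -/m cardfsU1 xM add1n mulr1 (tail_weight_recl _ ltM).
    have T0 := tail_weight_ge0 eps k #|` M|.+1.
    have T1 : tail_weight eps k #|` M|.+1 <= tail_weight eps k 1.
      exact: le_tail_weight.
    rewrite /ph_fresh /= F0 inE; case: (boolP (x \in O)) => xO /=.
      have -> : (x |` M) `\` O = M `\` O.
        by apply/fsetP => z; rewrite !inE; case: eqP => [->|]; rewrite ?xO.
      have -> : #|` M `\` O| = m by rewrite /m /ph_fresh F0.
      rewrite addn0 andbT mulrDr; lra.
    have -> : #|` (x |` M) `\` O| = m.+1.
      rewrite fsetDUl (_ : [fset x] `\` O = [fset x]); last first.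
        by apply/fsetP => z; rewrite !inE; case: eqP => [->|]; rewrite ?xO ?andbF.
      by rewrite cardfsU1 !inE (negPf xM) andbF /= add1n /m /ph_fresh F0.
    have x1 : (x \notin A s)%:R <= 1 :> R by case: (x \in A s).
    rewrite andbF addr0 addn1 -[m.+1%:R]natr1 -[(ph_new _).+1%:R]natr1 PhiE.
    rewrite !mulrDr !mulrDl !mulr1 !mul1r; lra.
  rewrite mean_scale //; last by rewrite mulr_ge0 // ltW.
  rewrite mean_mem // mean_notin // -EFinM lee_fin.
  apply: hole_prob => //; first by case: (dD s).
  apply/fdisjointP => z; rewrite inE => /andP [zA _].
  by apply: contra zA; apply: (fsubsetP MA).
rewrite mulr0 addr0 add0r (emeanD dD) ?(emeanZ dD) // => H.
have p0 := emean_ge0 dD n tpot.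
have : emean D n (fun s => (ph_new (phases k s))%:R) <=
    emean D n (fun s => 2 * (optn k s)%:R).
  apply: (le_emean dD) => // [|s]; first by apply: tameZ => //; exact: optn_tame.
  by rewrite -natrM ler_nat mul2n ph_new_le_optn.
rewrite (emeanZ dD) //; last exact: optn_tame.
move: H p0; set N := emean _ _ _; set C := emean _ _ _; set Q := emean _ _ _.
move=> H p0 NO; have := ler_wpM2l Phi0 NO; lra.
Qed.

End DetUpper.

(** * Lower bounds *)

Section LowerBound.
Context {R : realType}.
Implicit Types (s : seq item) (eps : R).
Local Open Scope fset_scope.
Local Open Scope ring_scope.

Lemma cardfsUD (A B : cache) : (#|` A `|` B| = #|` A| + #|` B `\` A|)%N.
Proof. have := cardfsUI A B; have := cardfsID A B; rewrite (fsetIC B A); clia. Qed.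

Definition universe (N : nat) : cache := [fset x in iota 0 N].

Lemma in_universe N x : (x \in universe N) = (x < N)%N.
Proof. by rewrite inE mem_iota. Qed.

Lemma card_universe N : #|` universe N| = N.
Proof. by rewrite card_fseq undup_id ?iota_uniq // size_iota. Qed.

(** * Faults and new requests compared with the number of phases *)

Section RatioLower.
Variables (k : nat) (eps : R) (D : seq item -> item -> R).
Hypotheses (hk : (0 < k)%N) (dD : diffuse eps D).

Lemma emean_size n : emean D n (fun s => (size s)%:R) = n%:R.
Proof.
rewrite /emean; suff -> m s : expect D m s (fun s => (size s)%:R%:E) =
    (size s + m)%:R%:E by [].
elim: m s => [|m IH] s; first by rewrite addn0.
rewrite expectS -[RHS](mean_cst (diffuse_dist s dD)) ?ler0n //.
apply: eq_mean; first exact: diffuse_dist dD.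
by move=> x _; rewrite IH size_rcons addnS.
Qed.

(** If some [c'] below [c] were achievable, comparing [F] with the number of phases from both sides
    would bound the expected cost by a constant, against its linear growth. *)
Lemma ratio_lower (f : seq item -> \bar R) F (c alpha beta a b delta d : R) :
  (forall s, f s = (F s)%:E) -> tame F ->
  0 < beta -> c * beta <= alpha -> 0 < delta ->
  (forall n, alpha * emean D n (fun s => (ph_num (phases k s))%:R) <=
     emean D n F + a) ->
  (forall n, emean D n (fun s => (optn k s)%:R) <=
     beta * emean D n (fun s => (ph_num (phases k s))%:R) + b) ->
  (forall n, delta * n%:R <= emean D n F + d) ->
  (c%:E <= Defs.ratio k eps f)%E.
Proof.
move=> fF tF b0 ca d0 hA hB hD; apply: (ratio_ge hk fF tF) => c' cc'.
exists D => // b'; apply: contrapT => /forallNP Hn.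
have {}Hn n : emean D n F <= c' * emean D n (fun s => (optn k s)%:R) + b'.
  by rewrite leNgt; apply/negP/Hn.
have [B HB] : exists B, forall n, emean D n F <= B.
  case: (lerP c' 0) => c'0.
    exists b' => n; apply: le_trans (Hn n) _.
    have := emean_ge0 dD n (optn_tame hk); nra.
  have g0 : 0 < alpha - c' * beta by nra.
  exists (c' * (beta * ((a + c' * b + b') / (alpha - c' * beta)) + b) + b') => n.
  apply: le_trans (Hn n) _; rewrite lerD2r ler_pM2l //.
  apply: le_trans (hB n) _; rewrite lerD2r ler_pM2l // ler_pdivlMr //.
  have := hA n; have := hB n; have := Hn n; nra.
pose n := Num.Def.truncn ((B + d) / delta).
have := hD n.+1; rewrite leNgt => /negP; apply.
apply: (@le_lt_trans _ _ (B + d)); first by rewrite lerD2r.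
rewrite -ltr_pdivrMl // mulrC; exact: truncnS_gt.
Qed.

Variables (N : nat) (w : nat -> R) (q : seq item -> item -> R) (fq : seq item -> R).
Hypothesis supp : forall s x, 0 < D s x -> (x < N)%N.
Hypotheses (q01 : forall s x, 0 <= q s x <= 1) (fq0 : fq [::] = 0).
Hypothesis fqS : forall s x, fq (rcons s x) = fq s + q s x.

Let inU s := all (fun x => x < N)%N s.

Let inU_rcons s x : inU s -> 0 < D s x -> inU (rcons s x).
Proof. by move=> sU /supp xN; rewrite /inU all_rcons xN. Qed.

Lemma tame_faults : tame fq.
Proof.
split=> [s|].
  elim/last_ind: s => [|s x IH]; first by rewrite fq0.
  by rewrite fqS addr_ge0 //; case/andP: (q01 s x).
by exists 1 => // s x; rewrite fqS lerD2l; case/andP: (q01 s x).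
Qed.

Lemma tame_ph_num : tame (fun s => (ph_num (phases k s))%:R : R).
Proof.
apply: (@tame_nat _ _ 1) => s x; rewrite phases_rcons /phase_step.
case: ifP => _; first by lia.
by case: (ltnP #|` ph_cur (phases k s)| k) => _ /=; lia.
Qed.

Lemma emean_faults_linear (delta : R) n : 0 <= delta ->
  (forall s, inU s -> (delta%:E <= mean (D s) (fun x => (q s x)%:E))%E) ->
  delta * n%:R <= emean D n fq.
Proof.
move=> d0 dq; have ts : tame (fun s : seq item => (size s)%:R : R).
  by apply: (@tame_nat _ _ 1) => s x; rewrite size_rcons addn1.
have := emean_drift dD (P := fun s => inU s) (tameZ d0 ts) tame_faults.
rewrite fq0 /= => /(_ isT inU_rcons) H.
rewrite -(emean_size n) -(emeanZ dD) // -[leLHS]addr0 -[leRHS]addr0.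
rewrite -[in leRHS](mulr0 delta); apply: H => s sU.
have dp := diffuse_dist s dD; have fqn := proj1 tame_faults.
apply: (le_mean_cancel dp (g := q s) (h := fun=> delta) (B := 1)) => //.
- by move=> x; rewrite addr_ge0 // mulr_ge0.
- by move=> x; rewrite addr_ge0 // mulr_ge0.
- by move=> x _; rewrite size_rcons fqS -natr1; lra.
- by rewrite mean_cst // dq.
Qed.

(** [q s x] is the probability of a fault when [x] follows [s], and [w i] bounds from below the
    faults per request that leaves a phase set of size [i]. A phase goes through the sizes [1] to
    [k], the last of which ends with the first request of the next phase; the potential [W] is the
    part of the sum still to be collected. *)
Lemma emean_faults_phases n : (forall i, 0 <= w i) -> w 0%N = 0 ->
  (forall s, inU s -> let M := ph_cur (phases k s) in
     ((w #|` M| * (1 - \sum_(x <- M) D s x))%:E <=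
        mean (D s) (fun x => (q s x)%:E))%E) ->
  (\sum_(1 <= i < k.+1) w i) * emean D n (fun s => (ph_num (phases k s))%:R) <=
  emean D n fq + \sum_(1 <= i < k.+1) w i.
Proof.
move=> w0 w00 wq; pose W i := \sum_(i <= j < k.+1) w j.
have Wge0 i : 0 <= W i by apply: sumr_ge0.
have W01 : W 0%N = W 1%N by rewrite /W big_ltn // w00 add0r.
rewrite -/(W 1%N).
pose pot s := W #|` ph_cur (phases k s)|.
have tpot : tame pot.
  apply: (tame_bounded (B := W 0%N)) => s; rewrite Wge0 /pot /=.
  have [lM _ _ _] := phases_inv s hk.
  rewrite {2}/W (big_cat_nat (n := #|` ph_cur (phases k s)|)) //=; last first.
    exact: leq_trans lM (leqnSn _).
  by rewrite lerDr sumr_ge0.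
have tF := tame_faults; have tN := tame_ph_num.
have : emean D n (fun s => W 1%N * (ph_num (phases k s))%:R) + (fq [::] + pot [::])
    <= emean D n (fun s => fq s + pot s) + W 1%N * 0.
  apply: (emean_drift dD (P := fun s => inU s)
    (F1 := fun s => W 1%N * (ph_num (phases k s))%:R)) => //.
  - exact: tameZ.
  - exact: tameD.
  move=> s sU; have dp := diffuse_dist s dD.
  have fqn := proj1 tF; have potn := proj1 tpot.
  have [lM _ _ _] := phases_inv s hk.
  set M := ph_cur (phases k s) in lM *.
  have wM : forall x, 0 <= w #|` M| * (x \notin M)%:R :> R.
    by move=> x; rewrite mulr_ge0.
  apply: (le_mean_cancel dp (g := q s)
    (h := fun x => w #|` M| * (x \notin M)%:R) (B := 1)) => //.
  - by move=> x; rewrite !addr_ge0 // mulr_ge0.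
  - by move=> x; rewrite !addr_ge0 // mulr_ge0.
  - move=> x _; rewrite fqS /pot phases_rcons /phase_step -/M.
    case: (boolP (x \in M)) => xM /=; first by rewrite -/M; lra.
    case: (ltnP #|` M| k) => ltM /=.
      rewrite cardfsU1 xM add1n.
      have -> : W #|` M| = w #|` M| + W #|` M|.+1.
        by rewrite /W big_ltn // ltnW.
      lra.
    have -> : #|` M| = k by apply/eqP; rewrite eqn_leq lM.
    have -> : W k = w k by rewrite /W big_nat1.
    rewrite cardfs1 -natr1; lra.
  rewrite mean_scale // mean_notin // -EFinM; exact: wq.
rewrite (emeanZ dD) // (emeanD dD) // mulr0 addr0 fq0 add0r.
have -> : pot [::] = W 1%N by rewrite -W01 /pot /= -(cardfs0 item).
have : emean D n pot <= W 1%N + W 1%N.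
  have WW : 0 <= W 1%N + W 1%N by rewrite addr_ge0.
  rewrite -[leRHS](emean_cst dD n WW).
  apply: (le_emean dD) => // [|s]; first exact: tame_cst.
  rewrite /pot; case: #|` _| => [|i]; first by rewrite W01 lerDr.
  case: (leqP i k) => ik; last first.
    by have -> : W i.+1 = 0 by rewrite /W big_geq // ltnW.
  rewrite {2}/W (big_cat_nat (n := i.+1)) //= -/(W i.+1).
  have : 0 <= \sum_(1 <= j < i.+1) w j by apply: sumr_ge0.
  by have := Wge0 1%N; lra.
lra.
Qed.

Lemma phases_universe s : inU s ->
  ph_old (phases k s) `<=` universe N /\ ph_cur (phases k s) `<=` universe N.
Proof.
elim/last_ind: s => [|s x IH]; first by rewrite !fsub0set.
rewrite /inU all_rcons => /andP [xN /IH]; rewrite phases_rcons /phase_step.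
case: (phases k s) => O M F P /= [OU MU]; case: ifP => // xM.
have xU : [fset x] `<=` universe N by rewrite fsub1set in_universe.
by case: (ltnP #|` M| k) => /= _; split=> //; apply/fsubUsetP.
Qed.

(** For uniform requests to [h] items, [1 - rho i] is the probability that a given item not yet
    requested belongs to a phase of which [i] items are known. So [u] is the expected number of new
    requests still to come in the phase, given that at most [N - k] items can be new. In [beta], the
    1 is the first request of a phase, which is always new. The parameter [h] may be smaller than
    [N] when the adversary is not uniform. *)
Lemma emean_new_phases n (h : R) : k%:R < h ->
  (forall s, inU s -> let p := phases k s in
     (0 < ph_num p)%N -> (#|` ph_cur p| < k)%N ->
     \sum_(x <- universe N `\` (ph_old p `|` ph_cur p)) D s x *
       (h - #|` ph_cur p|%:R) <=
     (N - k - ph_fresh p)%:R * (1 - \sum_(x <- ph_cur p) D s x)) ->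
  emean D n (fun s => (ph_new (phases k s))%:R) <=
  (1 + (N - k - 1)%:R * (1 - (h - k%:R) / (h - 1))) *
     emean D n (fun s => (ph_num (phases k s))%:R).
Proof.
move=> kh H; pose rho i := (h - k%:R) / (h - i%:R).
rewrite -[(h - k%:R) / (h - 1)]/(rho 1%N).
have hi i : (i <= k)%N -> 0 < h - i%:R.
  by move=> ik; rewrite subr_gt0 (le_lt_trans _ kh) // ler_nat.
have rho0 i : (i <= k)%N -> 0 <= rho i.
  by move=> ik; rewrite divr_ge0 // ltW // hi.
have rho1 i : (i <= k)%N -> 0 <= 1 - rho i.
  move=> ik; rewrite subr_ge0 ler_pdivrMr ?hi // mul1r.
  by rewrite lerD2l lerN2 ler_nat.
have rhoS i : (i < k)%N -> rho i.+1 - rho i = rho i.+1 / (h - i%:R).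
  move=> ik; have h1 := hi _ ik; have h2 := hi _ (ltnW ik).
  rewrite /rho -natr1 in h1 *; field; apply/andP; split; lra.
set beta := 1 + _; have beta0 : 0 <= beta by rewrite addr_ge0 ?mulr_ge0 ?rho1.
pose u s := let p := phases k s in
  if (0 < ph_num p)%N then (N - k - ph_fresh p)%:R * (1 - rho #|` ph_cur p|)
  else 0.
have u0 s : 0 <= u s.
  rewrite /u; have [lM _ _ _] := phases_inv s hk.
  by case: ifP => // _; rewrite mulr_ge0 ?rho1.
have tu : tame u.
  apply: (tame_bounded (B := N%:R)) => s; rewrite u0 /= /u.
  have [lM _ _ _] := phases_inv s hk; case: ifP => // _.
  rewrite -[leRHS]mulr1 ler_pM ?rho1 //; first by rewrite ler_nat; lia.
  by rewrite lerBlDr lerDl rho0.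
have tN := tame_ph_num; have tn := @tame_ph_new R k.
have : emean D n (fun s => (ph_new (phases k s))%:R + u s) + beta * 0 <=
       emean D n (fun s => beta * (ph_num (phases k s))%:R) + (0 + u [::]).
  apply: (emean_drift dD (P := fun s => inU s)
    (F1 := fun s => (ph_new (phases k s))%:R + u s)) => //.
  - exact: tameD.
  - exact: tameZ.
  move=> s sU; have dp := diffuse_dist s dD.
  have [lM hO hF _] := phases_inv s hk.
  have nn s' : 0 <= (ph_new (phases k s'))%:R + u s' by rewrite addr_ge0.
  have nn' s' : 0 <= beta * (ph_num (phases k s'))%:R by rewrite mulr_ge0.
  have [OU MU] := phases_universe sU; have Hs := H s sU.
  set M := ph_cur (phases k s) in lM MU Hs *.
  set O := ph_old (phases k s) in OU Hs hO *.
  case: (boolP ((0 < ph_num (phases k s))%N && (#|` M| < k)%N)) => cas; last first.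
    apply: le_mean => // x; first by rewrite lee_fin addr_ge0.
    move=> _; rewrite lee_fin /u phases_rcons /phase_step -/M.
    case: (boolP (x \in M)) => xM /=; first by rewrite -/M; lra.
    case: (ltnP #|` M| k) => ltM /=.
      by move: cas; rewrite ltM andbT -/M => /negPf ->; rewrite addn0; lra.
    have cM : #|` M| = k by apply/eqP; rewrite eqn_leq lM.
    rewrite cM; have -> : rho k = 1 by rewrite /rho divff // gt_eqF // hi.
    rewrite /ph_fresh /= cardfs1.
    rewrite (_ : [fset x] `\` M = [fset x]) ?cardfs1; last first.
      by apply/fsetP => z; rewrite !inE; case: eqP => [->|]; rewrite ?xM ?andbF.
    rewrite subrr mulr0 if_same -!natr1 /beta; lra.
  case/andP: cas => F0 ltM; have [cO Fr] := hO F0.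
  set j := ph_fresh (phases k s) in Fr Hs *.
  have jE : j = #|` M `\` O| by rewrite /j /ph_fresh F0.
  have r1 := rho0 _ ltM; have r2 := rhoS _ ltM; have h0 := hi _ (ltnW ltM).
  have g0 : 0 <= (N - k - j)%:R * (rho #|` M|.+1 - rho #|` M|).
    by rewrite mulr_ge0 // r2 divr_ge0 // ltW.
  (* A new request gains the next value of [rho], and every request that enlarges the phase set
     loses [g]; the hypothesis says that on average the gain is at most the loss. *)
  apply: (le_mean_cancel dp
    (g := fun x => (N - k - j)%:R * (rho #|` M|.+1 - rho #|` M|) * (x \notin M)%:R)
    (h := fun x => rho #|` M|.+1 * (x \in universe N `\` (O `|` M))%:R)
    (B := (N - k - j)%:R * (rho #|` M|.+1 - rho #|` M|))).
  - by move=> x; rewrite addr_ge0.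
  - by move=> x; rewrite addr_ge0.
  - by move=> x; case: (x \notin M); rewrite ?mulr1 ?mulr0 !lexx ?g0.
  - by move=> x; rewrite mulr_ge0.
  - move=> x /supp xN; rewrite /u phases_rcons /phase_step -/M -/O F0.
    case: (boolP (x \in M)) => xM /=.
      by rewrite F0 -/M -/j mulr0 !inE xM orbT /=; lra.
    rewrite ltM /= F0 -/j cardfsU1 xM add1n mulr1 in_fsetD in_fsetU in_universe.
    rewrite xN (negPf xM) orbF andbT /ph_fresh /= F0.
    case: (boolP (x \in O)) => xO /=.
      have -> : (x |` M) `\` O = M `\` O.
        by apply/fsetP => z; rewrite !inE; case: eqP => [->|]; rewrite ?xO.
      by rewrite -jE addn0; lra.
    have -> : #|` (x |` M) `\` O| = j.+1.
      rewrite fsetDUl (_ : [fset x] `\` O = [fset x]); last first.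
        by apply/fsetP => z; rewrite !inE; case: eqP => [->|]; rewrite ?xO ?andbF.
      by rewrite cardfsU1 !inE (negPf xM) andbF /= add1n -jE.
    have jN : (k + j < N)%N.
      rewrite -cO jE -[X in (_ < X)%N]card_universe.
      have -> : (#|` O| + #|` M `\` O|)%N = #|` O `|` M|.
        by rewrite cardfsUD.
      have : (#|` x |` (O `|` M)| <= #|` universe N|)%N.
        apply: fsubset_leq_card; apply/fsubUsetP; split; last exact/fsubUsetP.
        by rewrite fsub1set in_universe.
      by rewrite cardfsU1 !inE (negPf xM) (negPf xO) add1n.
    have -> : (N - k - j = (N - k - j.+1).+1)%N by clear -jN; lia.
    rewrite addn1 -[(ph_new _).+1%:R]natr1 -[(N - k - j.+1).+1%:R]natr1; lra.
  rewrite !mean_scale // mean_mem // mean_notin // -!EFinM lee_fin r2.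
  have := Hs F0 ltM; rewrite -mulr_suml; set S := \sum_(x <- _ `\` _) _ => HS.
  set T := 1 - _ in HS *; set e := (h - _) in HS h0 *.
  have -> : (N - k - j)%:R * (rho #|` M|.+1 / e) * T =
      rho #|` M|.+1 * ((N - k - j)%:R * T / e) by ring.
  by rewrite ler_wpM2l // ler_pdivlMr.
rewrite mulr0 addr0 (emeanD dD) // (emeanZ dD) //.
have -> : u [::] = 0 by [].
have := emean_ge0 dD n tu; lra.
Qed.

End RatioLower.

Lemma new_phase_rate (N k : nat) (h : R) : (0 < k < N)%N -> k%:R + 1 <= h ->
  h <= N%:R -> 1 + (N - k - 1)%:R * (1 - (h - k%:R) / (h - 1)) <=
  (N - k)%:R * k%:R / (h - 1).
Proof.
move=> /andP [k0 kN] kh hN; have k1 : 1 <= k%:R :> R by rewrite ler1n.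
rewrite natrB; last by lia.
rewrite natrB; last by lia.
rewrite ler_pdivlMr; last by lra.
have -> : (1 + (N%:R - k%:R - 1) * (1 - (h - k%:R) / (h - 1))) * (h - 1) =
   h - 1 + (N%:R - k%:R - 1) * (k%:R - 1).
  by field; lra.
nra.
Qed.

(* The distribution which gives as much as [eps] allows to the items of [l], in
   this order. *)
Definition fill_cdf eps (t : nat) : R := Num.min 1 (t%:R * eps).

Definition fill eps (l : seq item) (x : item) : R :=
  if x \in l then fill_cdf eps (index x l).+1 - fill_cdf eps (index x l) else 0.

Lemma fill_bound eps l x : 0 <= eps -> 0 <= fill eps l x <= eps.
Proof.
move=> e0; rewrite /fill; case: ifP => _; last by rewrite lexx.
rewrite /fill_cdf -natr1 mulrDl mul1r.
set y := _ * eps; case: (lerP 1 (y + eps)); case: (lerP 1 y); lra.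
Qed.

Lemma fill_prefix eps l1 l2 (M : cache) : uniq (l1 ++ l2) -> M =i l1 ->
  \sum_(x <- M) fill eps (l1 ++ l2) x = fill_cdf eps (size l1).
Proof.
move=> ul Ml; have ul1 : uniq l1 by move: ul; rewrite cat_uniq => /andP [].
rewrite (perm_big l1) /=; last exact: uniq_perm.
clear Ml ul1; elim/last_ind: l1 l2 ul => [|l1 x IH] l2 ul.
  by rewrite big_nil /fill_cdf mul0r; case: lerP => //; rewrite ler10.
rewrite -cats1 big_cat big_seq1 /= cats1 cat_rcons IH -?cat_rcons //.
rewrite cat_rcons /fill mem_cat inE eqxx !orbT index_cat /= eqxx addn0.
move: ul; rewrite cat_rcons cat_uniq /= => /and3P [_ /norP [/negPf -> _] _].
by rewrite size_rcons addrC subrK.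
Qed.

Lemma mean_finsupp (p : item -> R) N (f : item -> R) :
  (forall x, 0 <= p x) -> (forall x, (N <= x)%N -> p x = 0) ->
  (forall x, 0 <= f x) ->
  mean p (fun x => (f x)%:E) = (\sum_(0 <= x < N) p x * f x)%:E.
Proof.
move=> p0 pN f0; rewrite /mean (@nneseries_split _ _ 0 N); last first.
  by move=> x _; rewrite mule_ge0 ?lee_fin.
rewrite add0n eseries0 ?adde0; last by move=> x Nx _; rewrite pN ?mul0e.
by rewrite -sumEFin; apply: eq_bigr.
Qed.

Lemma fill_dist eps l N : 0 <= eps -> 1 <= N%:R * eps -> uniq l ->
  l =i iota 0 N -> dist (fill eps l).
Proof.
move=> e0 Ne ul lN; have b x := fill_bound l x e0.
have b0 x : 0 <= fill eps l x by case/andP: (b x).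
split=> //; transitivity (mean (fill eps l) (fun=> 1%:E)).
  by apply: eq_eseriesr => x _; rewrite mule1.
rewrite (@mean_finsupp _ N _) //; last first.
  by move=> x; rewrite /fill lN mem_iota ltnNge add0n => ->.
have sl : size l = N.
  by rewrite (perm_size (uniq_perm ul (iota_uniq 0 N) lN)) size_iota.
have c1 : fill_cdf eps (size l) = 1 by rewrite sl /fill_cdf min_l.
congr EFin; have := @fill_prefix eps l [::] [fset x in l].
rewrite cats0 c1 => /(_ ul) sum1.
under eq_bigr do rewrite mulr1.
rewrite -[RHS]sum1 => [|x]; last by rewrite inE.
rewrite [RHS](perm_big (iota 0 N)) /=; last first.
  by apply: uniq_perm; rewrite ?fset_uniq ?iota_uniq // => x; rewrite inE lN.
by rewrite /index_iota subn0.
Qed.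

End LowerBound.

(** * Three explicit adversaries *)

Section Adversaries.
Context {R : realType}.
Implicit Types (s : seq item) (eps : R).
Local Open Scope fset_scope.
Local Open Scope ring_scope.

Lemma mem_enum_fset (A : cache) x : (x \in enum_fset A) = (x \in A).
Proof. by []. Qed.

Definition cumul (q : seq item -> item -> R) s : R :=
  \sum_(i < size s) q (take i s) (nth 0%N s i).

Lemma cumul_nil q : cumul q [::] = 0.
Proof. by rewrite /cumul big_ord0. Qed.

Lemma cumul_rcons q s x : cumul q (rcons s x) = cumul q s + q s x.
Proof.
rewrite /cumul size_rcons big_ord_recr /= nth_rcons ltnn eqxx.
rewrite -[X in take _ X]cats1 take_size_cat //; congr (_ + _).
apply: eq_bigr => i _.
by rewrite nth_rcons ltn_ord -cats1 takel_cat // ltnW.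
Qed.

(** Every fault loads an item, which is either evicted later or still in the cache. *)
Lemma faults_le_cost k (A : alg) s : online k A ->
  cumul (fun s x => (x \notin A s)%:R) s <= (cost A s)%:R + k%:R.
Proof.
move=> oA; suff : cumul (fun s x => (x \notin A s)%:R) s <=
    (cost A s)%:R + #|` A s|%:R.
  have := online_card s oA; rewrite -(ler_nat R); lra.
elim/last_ind: s => [|s x IH].
  by rewrite cumul_nil cost_nil add0r.
rewrite cumul_rcons (cost_rcons _ _ (proj1 oA)) natrD.
suff : (x \notin A s)%:R + #|` A s|%:R <=
    #|` A s `\` A (rcons s x)|%:R + #|` A (rcons s x)|%:R :> R by lra.
rewrite -!natrD ler_nat; have [xA _] := (proj2 oA) s x.
have := cardfsUD (A (rcons s x)) (A s).
have : (#|` x |` A s| <= #|` A (rcons s x) `|` A s|)%N.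
  by apply: fsubset_leq_card; rewrite fsetSU // fsub1set.
rewrite cardfsU1; clear; clia.
Qed.

(** The common frame of the adversaries below: [w] controls the faults of a phase from below, [h]
    its new requests from above, and [delta] is the rate that excludes bounded costs. The conditions
    are stated for phase sets inside [universe N], since [D] never leaves it. *)
Lemma ratio_ge_faults (k N : nat) (eps : R) (D : seq item -> item -> R)
    (f : seq item -> \bar R) (F : seq item -> R) (w : nat -> R)
    (q : seq item -> item -> R) (fq : seq item -> R) (a c delta h : R) :
  (0 < k)%N -> diffuse eps D ->
  (forall s x, 0 < D s x -> (x < N)%N) ->
  (forall s x, 0 <= q s x <= 1) -> fq [::] = 0 ->
  (forall s x, fq (rcons s x) = fq s + q s x) ->
  (forall s, f s = (F s)%:E) -> tame F -> (forall s, fq s <= F s + a) ->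
  0 < delta ->
  (forall s, (delta%:E <= mean (D s) (fun x => (q s x)%:E))%E) ->
  (forall i, 0 <= w i) -> w 0%N = 0 ->
  (forall s, let M := ph_cur (phases k s) in M `<=` universe N ->
     (#|` M| <= k)%N ->
     ((w #|` M| * (1 - \sum_(x <- M) D s x))%:E <=
        mean (D s) (fun x => (q s x)%:E))%E) ->
  k%:R < h ->
  (forall s, let p := phases k s in let C := ph_old p `|` ph_cur p in
     C `<=` universe N ->
     #|` C| = (k + ph_fresh p)%N -> (0 < ph_fresh p)%N -> (#|` ph_cur p| < k)%N ->
     (\sum_(x <- universe N `\` C) D s x) * (h - #|` ph_cur p|%:R) <=
     (N - k - ph_fresh p)%:R * (1 - \sum_(x <- ph_cur p) D s x)) ->
  c * (1 + (N - k - 1)%:R * (1 - (h - k%:R) / (h - 1))) <=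
     \sum_(1 <= i < k.+1) w i ->
  (c%:E <= Defs.ratio k eps f)%E.
Proof.
move=> hk dD supp q01 fq0 fqS fF tF fqF d0 hd w0 w00 hw kh hnew hc.
have tq := tame_faults q01 fq0 fqS.
have Efq n : emean D n fq <= emean D n F + Num.max a 0.
  have a0 : 0 <= Num.max a 0 by rewrite le_max lexx orbT.
  rewrite -[X in _ <= _ + X](emean_cst dD n a0) -(emeanD dD) //; last exact: tame_cst.
  apply: (le_emean dD) => // [|s]; first by apply: tameD => //; exact: tame_cst.
  by apply: le_trans (fqF s) _; rewrite lerD2l le_max lexx.
have h1 : (1%:R : R) <= k%:R by rewrite ler_nat.
apply: (ratio_lower hk dD (F := F) (alpha := \sum_(1 <= i < k.+1) w i)
  (beta := 1 + (N - k - 1)%:R * (1 - (h - k%:R) / (h - 1)))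
  (a := Num.max a 0 + \sum_(1 <= i < k.+1) w i) (b := k%:R)
  (delta := delta) (d := Num.max a 0)) => //.
- rewrite ltr_pwDl // mulr_ge0 // subr_ge0 ler_pdivrMr; lra.
- move=> n; have := emean_faults_phases hk dD supp q01 fq0 fqS n w0 w00.
  have H s : all (fun x => x < N)%N s -> let M := ph_cur (phases k s) in
     ((w #|` M| * (1 - \sum_(x <- M) D s x))%:E <=
        mean (D s) (fun x => (q s x)%:E))%E.
    move=> sU; have [_ MU] := phases_universe k sU.
    by apply: hw => //; have [] := phases_inv s hk.
  by move=> /(_ H); have := Efq n; lra.
- move=> n; have H s : all (fun x => x < N)%N s -> let p := phases k s in
     (0 < ph_num p)%N -> (#|` ph_cur p| < k)%N ->
     \sum_(x <- universe N `\` (ph_old p `|` ph_cur p)) D s x *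
       (h - #|` ph_cur p|%:R) <=
     (N - k - ph_fresh p)%:R * (1 - \sum_(x <- ph_cur p) D s x).
    move=> sU p F0 ltM; have [OU MU] := phases_universe k sU.
    have [_ hO _ _] := phases_inv s hk; have [cO Fr] := hO F0.
    rewrite -mulr_suml; apply: hnew => //; first exact/fsubUsetP.
    by rewrite cardfsUD cO /ph_fresh F0.
  have := emean_new_phases hk dD supp n kh H.
  have : emean D n (fun s => (optn k s)%:R) <=
      emean D n (fun s => (ph_new (phases k s))%:R + k%:R).
    apply: (le_emean dD) => [||s]; first exact: optn_tame.
      by apply: tameD; [exact: tame_ph_new | exact: tame_cst].
    by rewrite -natrD ler_nat optn_le_ph_new.
  rewrite (emeanD dD); [|exact: tame_ph_new|exact: tame_cst].
  rewrite (emean_cst dD) //; lra.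
- move=> n; apply: le_trans (Efq n).
  by apply: (emean_faults_linear dD supp q01 fq0 fqS) => //; exact: ltW.
Qed.

Section Hole.
Variables (k : nat) (eps : R).
Hypotheses (hk : (0 < k)%N) (ek : (k.+1%:R)^-1 <= eps) (e1 : eps <= 1).

Let e0 : 0 < eps.
Proof. by apply: lt_le_trans ek; rewrite invr_gt0 ltr0n. Qed.

(** An item [h] missing from [C] comes first and gets the full mass [eps]; then come the items of
    the current phase, then all others. The mass outside of the phase is thus as small as [eps]
    allows while a fault keeps probability [eps]. *)
Lemma hole_distribution (C M : cache) : (#|` C| <= k)%N -> M `<=` universe k.+1 ->
  exists p : item -> R, [/\ dist p, forall x, 0 <= p x <= eps,
    forall x, 0 < p x -> (x < k.+1)%N, eps <= 1 - \sum_(x <- C) p x &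
    1 - \sum_(x <- M) p x <= Num.max eps (1 - #|` M|%:R * eps)].
Proof.
move=> Ck MU; have [h hU hC] : exists2 h, h \in universe k.+1 & h \notin C.
  have : universe k.+1 `\` C != fset0.
    apply: contraTneq Ck; move/eqP; rewrite fsetD_eq0 => /fsubset_leq_card.
    by rewrite card_universe -ltnNge.
  by case/fset0Pn => h; rewrite inE => /andP [hC hU]; exists h.
pose l := (h :: enum_fset (M `\ h)) ++ enum_fset (universe k.+1 `\` (h |` M)).
have lE : l =i iota 0 k.+1.
  move=> x; rewrite mem_cat in_cons !mem_enum_fset mem_iota add0n /=.
  rewrite in_fsetD1 in_fsetD in_fset1U in_universe.
  case: (eqVneq x h) => [->|xh] /=; first by move: hU; rewrite in_universe.
  case: (boolP (x \in M)) => xM //=.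
  by have := fsubsetP MU x xM; rewrite in_universe.
have ul : uniq l.
  rewrite /l /= mem_cat cat_uniq !fset_uniq !inE eqxx /= andbT.
  by apply/hasPn => x; rewrite !inE negb_or => /andP [/andP [_ /negPf ->] _]; rewrite andbF.
have Ne : 1 <= k.+1%:R * eps by rewrite -ler_pdivrMl ?ltr0n // mulr1.
have dp := fill_dist (ltW e0) Ne ul lE.
have b x := fill_bound l x (ltW e0).
have ph : fill eps l h = eps.
  have := @fill_prefix R eps [:: h]
    (enum_fset (M `\ h) ++ enum_fset (universe k.+1 `\` (h |` M))) [fset h] ul.
  rewrite big_seq_fset1 => ->; last by move=> x; rewrite !inE.
  by rewrite /fill_cdf mul1r min_r.
exists (fill eps l); split=> //.
- by move=> x; rewrite /fill lE mem_iota add0n; case: ifP => //; rewrite ltxx.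
- rewrite -[leLHS]ph -lee_fin -(mean_notin dp) -(mean_pred1 dp).
  apply: le_mean => // x _; rewrite lee_fin; case: eqP => // ->.
  by rewrite hC.
- case: (boolP (h \in M)) => hM.
    rewrite (@fill_prefix R eps (h :: enum_fset (M `\ h))) //; last first.
      by move=> x; rewrite !inE; case: eqP => [->|].
    rewrite /= -/(#|` M `\ h|) /fill_cdf.
    have -> : (#|` M `\ h|).+1 = #|` M| by rewrite (cardfsD1 h M) hM.
    have := e0; case: (lerP 1 (#|` M|%:R * eps));
      case: (lerP eps (1 - #|` M|%:R * eps)); lra.
  have : \sum_(x <- h |` M) fill eps l x = fill_cdf eps (#|` M|).+1.
    rewrite (@fill_prefix R eps (h :: enum_fset (M `\ h))) //; last first.
      by move=> x; rewrite !inE; case: eqP => [->|].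
    congr (fill_cdf _ _.+1); congr #|` _|.
    by apply/fsetP => x; rewrite !inE; case: eqP => [->|] //; rewrite (negPf hM).
  rewrite big_fsetU1 //= ph /fill_cdf -natr1 mulrDl mul1r => S.
  have -> : \sum_(x <- M) fill eps l x = Num.min 1 (#|` M|%:R * eps + eps) - eps.
    by rewrite -S addrAC subrr add0r.
  have := e0; case: (lerP 1 (#|` M|%:R * eps + eps));
    case: (lerP eps (1 - #|` M|%:R * eps)); lra.
Qed.

(** The probability of a fault divided by the largest possible mass outside of a phase set of size
    [i] is exactly the weight occurring in [Phi]. *)
Lemma weight_max i : weight eps i * Num.max eps (1 - i%:R * eps) = eps.
Proof.
have -> : Num.max eps (1 - i%:R * eps) = Num.max (eps^-1 - i%:R) 1 * eps.
  rewrite maxr_pMl ?ltW // mulrBl mulVf ?gt_eqF // mul1r.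
  by rewrite maxC.
by rewrite mulrA mulVf ?mul1r // gt_eqF // lt_max ltr01 orbT.
Qed.

Lemma opt_det_ge_Phi : ((Phi eps k)%:E <= opt_det_ratio k eps)%E.
Proof.
apply: le_ereal_inf_tmp => _ [A oA <-].
(* [D] has to be defined after every prefix; those that leave the universe have probability 0 and
   are given an arbitrary set. *)
pose M s := let M := ph_cur (phases k s) in if M `<=` universe k.+1 then M else fset0.
have MU s : M s `<=` universe k.+1.
  by rewrite /M; case: ifP => //; rewrite fsub0set.
have [D HD] := boolp.choice (fun s => hole_distribution (online_card s oA) (MU s)).
have Dd s : dist (D s) by case: (HD s).
have dD : diffuse eps D by move=> s; have [[_ ?] ? _ _ _] := HD s.
pose q s x : R := (x \notin A s)%:R.
have mq s : mean (D s) (fun x => (q s x)%:E) = (1 - \sum_(x <- A s) D s x)%:E.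
  exact: mean_notin.
apply: (@ratio_ge_faults k k.+1 eps D _ (fun s => (cost A s)%:R)
   (fun i => if i == 0%N then 0 else weight eps i) q (cumul q) k%:R _ eps k.+1%:R) => //.
- by move=> s x; case: (HD s) => _ _ /(_ x).
- by move=> s x; rewrite /q; case: (_ \notin _); rewrite /= ?lexx ?ler01.
- exact: cumul_nil.
- exact: cumul_rcons.
- exact: tame_cost oA.
- by move=> s; exact: faults_le_cost.
- by move=> s; rewrite mq lee_fin; case: (HD s).
- by move=> i; case: eqP => // _; rewrite ltW // weight_gt0.
- move=> s C CU lC; rewrite mq lee_fin; case: (HD s) => _ _ _ h1.
  rewrite /M -/C CU => h2; apply: le_trans h1.
  case: eqP => [|_]; first by rewrite mul0r ltW.
  by rewrite -[leRHS](weight_max #|` C|) ler_wpM2l // ltW // weight_gt0.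
- by rewrite ltr_nat.
- move=> s p C CU cC Fr _.
  (* With [k.+1] items, two consecutive phases cover the universe as soon as there is one new
     request, so a phase never has a second one. *)
  have -> : universe k.+1 `\` C = fset0.
    apply/eqP; rewrite fsetD_eq0; suff /eqP <- : C == universe k.+1 by [].
    rewrite eqEfcard CU card_universe cC; clear -Fr; lia.
  by rewrite big_seq_fset0 mul0r (_ : k.+1 - k - _ = 0)%N ?mul0r //; clear -Fr; lia.
- rewrite subSnn subnn mul0r addr0 mulr1 /Phi big_nat_recr //= addrC.
  (* The last stage, ended by the first request of the next phase, provides the summand 1 of [Phi];
     this uses [k.+1%:R^-1 <= eps]. *)
  have -> : weight eps k = 1.
    rewrite /weight max_r ?invr1 // lerBlDr nat1r -[leRHS]invrK lef_pV2 // posrE.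
    by rewrite invr_gt0.
  rewrite gtn_eqF // lerD2l.
  by apply: ler_sum_nat => i /andP [i1 _]; rewrite gtn_eqF.
Qed.

End Hole.

Lemma Phi_sub1 (k : nat) eps : 0 < eps -> eps <= (k.+1%:R)^-1 ->
  Phi eps k - 1 = \sum_(1 <= i < k) (eps^-1 - i%:R)^-1.
Proof.
move=> e0 ek; have q : k%:R + 1 <= eps^-1.
  by rewrite natr1 -[leLHS]invrK lef_pV2 // posrE invr_gt0.
rewrite /Phi addrAC subrr add0r; apply: eq_big_nat => i /andP [_ ik].
rewrite max_l //; have : i%:R + 1 <= k%:R :> R by rewrite natr1 ler_nat.
lra.
Qed.

Lemma phase_rate_le (N k : nat) (h c : R) : (0 < k < N)%N -> k%:R + 1 <= h ->
  h <= N%:R -> 0 <= c ->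
  c * (1 + (N - k - 1)%:R * (1 - (h - k%:R) / (h - 1))) <= (N - k)%:R * c.
Proof.
move=> kN kh hN c0; rewrite [leRHS]mulrC ler_wpM2l //.
apply: le_trans (new_phase_rate kN kh hN) _.
have k1 : 1 <= k%:R :> R by rewrite ler1n; case/andP: kN.
rewrite ler_pdivrMr; last by lra.
by rewrite ler_wpM2l //; lra.
Qed.

Section Scarce.
Variables (k : nat) (eps : R).
Hypotheses (hk : (0 < k)%N) (e0 : 0 < eps) (ek : eps <= (k.+1%:R)^-1).

Let N : nat := `|Num.ceil eps^-1|%N.

Let NE : N%:R = (Num.ceil eps^-1)%:~R :> R.
Proof.
rewrite /N natr_absz ger0_norm // -(ler_int R) (le_trans _ (ceil_ge _)) //.
by rewrite invr_ge0 ltW.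
Qed.

Let qN : eps^-1 <= N%:R. Proof. by rewrite NE ceil_ge. Qed.

Let kq : k%:R + 1 <= eps^-1.
Proof. by rewrite natr1 -[leLHS]invrK lef_pV2 // posrE invr_gt0. Qed.

Let kN : (k < N)%N.
Proof. by rewrite -(ltr_nat R); have := qN; have := kq; lra. Qed.

Let ke : k%:R * eps <= 1 - eps.
Proof.
have : (k%:R + 1) * eps <= eps^-1 * eps by rewrite ler_pM2r.
by rewrite mulVf ?gt_eqF // mulrDl mul1r lerBrDr.
Qed.

Let Ne : N%:R * eps < 1 + eps.
Proof.
have : (N%:R - 1) * eps < eps^-1 * eps.
  by rewrite ltr_pM2r // NE; have := ceilB1_lt eps^-1; rewrite intrB.
by rewrite mulVf ?gt_eqF // mulrBl mul1r ltrBlDr.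
Qed.

Let Ne1 : 1 <= N%:R * eps.
Proof.
have : eps^-1 * eps <= N%:R * eps by rewrite ler_pM2r.
by rewrite mulVf // gt_eqF.
Qed.

(** The items of the phase come first and an item [y] outside of the phase comes last, receiving
    only the remainder [1 - (N - 1) eps]. If some cached item of the universe is outside of the
    phase, it is taken as [y], so that the cache has mass at most [(k - 1) eps] plus this remainder.
    Otherwise the cached items of the universe lie in the phase and have mass at most [(k - 1) eps],
    which is small enough because [N eps < 1 + eps]. *)
Lemma scarce_distribution (C M : cache) : (#|` C| <= k)%N ->
  M `<=` universe N -> (#|` M| <= k)%N ->
  exists p : item -> R, [/\ dist p, forall x, 0 <= p x <= eps,
    forall x, 0 < p x -> (x < N)%N,
    (#|` M| < k)%N -> (N - k)%:R * eps <= 1 - \sum_(x <- C) p x &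
    \sum_(x <- M) p x = #|` M|%:R * eps].
Proof.
move=> Ck MU Mk.
have [y [yU yM yC]] : exists y, [/\ y \in universe N, y \notin M &
    (y \in C) || (C `&` universe N `<=` M)].
  case: (boolP (C `&` universe N `<=` M)) => [sub|/fsubsetPn [y]].
    have : universe N `\` M != fset0.
      apply: contraTneq kN; move/eqP; rewrite fsetD_eq0 => /fsubset_leq_card.
      by rewrite card_universe -leqNgt => /leq_trans; apply.
    by case/fset0Pn => y; rewrite inE => /andP [? ?]; exists y; rewrite orbT.
  by rewrite inE => /andP [yC yU] yM; exists y; rewrite yC.
pose l2 := enum_fset (universe N `\` (y |` M)).
pose l := enum_fset M ++ (l2 ++ [:: y]).
have lE : l =i iota 0 N.
  move=> x; rewrite !mem_cat !mem_enum_fset mem_iota add0n /=.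
  rewrite in_fsetD in_fset1U in_universe inE.
  case: (eqVneq x y) => [->|xy] /=; first by rewrite !orbT -in_universe yU.
  case: (boolP (x \in M)) => xM /=; rewrite ?orbF //.
  by have := fsubsetP MU x xM; rewrite in_universe.
have ul : uniq l.
  rewrite /l !cat_uniq !fset_uniq has_cat /= !orbF andbT mem_enum_fset.
  rewrite in_fsetD in_fset1U eqxx /= (negPf yM) orbF andbT.
  by apply/hasPn => x; rewrite !mem_enum_fset in_fsetD in_fset1U negb_or => /andP [/andP [_ ->]].
have dp := fill_dist (ltW e0) Ne1 ul lE.
have b x := fill_bound l x (ltW e0).
have p0 x : 0 <= fill eps l x by case/andP: (b x).
have pM : \sum_(x <- M) fill eps l x = #|` M|%:R * eps.
  rewrite fill_prefix // /fill_cdf min_r //.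
  have : #|` M|%:R * eps <= k%:R * eps by rewrite ler_pM2r // ler_nat.
  by move=> h; apply: le_trans h _; have := ke; have := e0; lra.
have pU x : 0 < fill eps l x -> (x < N)%N.
  by rewrite /fill lE mem_iota add0n; case: ifP => //; rewrite ltxx.
exists (fill eps l); split=> // Mk'.
have sC : #|` C|%:R * eps <= k%:R * eps by rewrite ler_pM2r // ler_nat.
case: (boolP (y \in C)) yC => [yC _|yC /= CM]; last first.
  have : \sum_(x <- C) fill eps l x <= \sum_(x <- M) fill eps l x.
    rewrite -lee_fin -!(mean_mem dp); apply: le_mean => // x /pU xN.
    rewrite lee_fin ler_nat; case: (boolP (x \in C)) => // xC.
    by rewrite (fsubsetP CM) // inE xC in_universe.
  have : (#|` M|%:R + 1) * eps <= k%:R * eps by rewrite ler_pM2r // natr1 ler_nat.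
  rewrite pM mulrDl mul1r natrB ?(ltnW kN) // mulrBl.
  have := Ne; lra.
have py : fill eps l y = 1 - (N%:R - 1) * eps.
  have sl : size l = N.
    by rewrite (perm_size (uniq_perm ul (iota_uniq 0 N) lE)) size_iota.
  have yl : y \in l by rewrite lE mem_iota add0n -in_universe yU.
  have iy : (index y l).+1 = N.
    rewrite -[in RHS]sl /l catA index_cat size_cat /= eqxx addn0 addn1.
    rewrite mem_cat !mem_enum_fset in_fsetD in_fset1U eqxx (negPf yM) /=.
    by [].
  have iN : (index y l)%:R = N%:R - 1 :> R by rewrite -iy -natr1 addrK.
  rewrite /fill yl iy /fill_cdf iN min_l // min_r //.
  by have := Ne; rewrite mulrBl mul1r lerBlDr addrC => /ltW.
rewrite (big_fsetD1 y) //= py.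
have s1 := sum_le_eps (C `\ y) b.
have : (#|` C `\ y|%:R + 1) * eps <= k%:R * eps.
  rewrite ler_pM2r // natr1 ler_nat.
  by apply: leq_trans Ck; rewrite (cardfsD1 y C) yC.
rewrite mulrDl mul1r natrB ?(ltnW kN) // mulrBl.
lra.
Qed.

(** Each stage but the last yields [N - k] times a term of [Phi], matching the bound [N - k] on the
    expected number of new requests of a phase. The last stage yields only [1] and is dropped, which
    costs the summand 1 of [Phi]. *)
Lemma opt_det_ge_Phi_sub1 : ((Phi eps k - 1)%:E <= opt_det_ratio k eps)%E.
Proof.
apply: le_ereal_inf_tmp => _ [A oA <-].
pose M s := let M := ph_cur (phases k s) in if M `<=` universe N then M else fset0.
have MU s : M s `<=` universe N.
  by rewrite /M; case: ifP => //; rewrite fsub0set.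
have Mk s : (#|` M s| <= k)%N.
  by rewrite /M; case: ifP => _; [have [] := phases_inv s hk | rewrite cardfs0].
have [D HD] := boolp.choice (fun s =>
  scarce_distribution (online_card s oA) (MU s) (Mk s)).
have Dd s : dist (D s) by case: (HD s).
have De s x : 0 <= D s x <= eps by case: (HD s).
have dD : diffuse eps D by move=> s; have [[_ ?] ? _ _ _] := HD s.
pose q s x : R := (x \notin A s)%:R.
have mq s : mean (D s) (fun x => (q s x)%:E) = (1 - \sum_(x <- A s) D s x)%:E.
  exact: mean_notin.
have qk : 0 < 1 - k%:R * eps by have := ke; have := e0; lra.
have mqk s : 1 - k%:R * eps <= 1 - \sum_(x <- A s) D s x.
  rewrite lerD2l lerN2; apply: le_trans (sum_le_eps _ (De s)) _.
  by rewrite ler_pM2r // ler_nat online_card.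
pose w i : R := if (i == 0)%N then 0 else if (i < k)%N
  then (N - k)%:R / (eps^-1 - i%:R) else (i == k)%:R.
have qi i : (i < k)%N -> 1 <= eps^-1 - i%:R.
  move=> ik; have : i%:R + 1 <= k%:R :> R by rewrite natr1 ler_nat.
  have := kq; lra.
have qie i : (eps^-1 - i%:R) * eps = 1 - i%:R * eps.
  by rewrite mulrBl mulVf ?gt_eqF.
apply: (@ratio_ge_faults k N eps D _ (fun s => (cost A s)%:R)
   w q (cumul q) k%:R _ (1 - k%:R * eps) eps^-1) => //.
- by move=> s x; case: (HD s) => _ _ /(_ x).
- by move=> s x; rewrite /q; case: (_ \notin _); rewrite /= ?lexx ?ler01.
- exact: cumul_nil.
- exact: cumul_rcons.
- exact: tame_cost oA.
- by move=> s; exact: faults_le_cost.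
- by move=> s; rewrite mq lee_fin.
- move=> i; rewrite /w; case: ifP => // _; case: ifP => // ik.
  by rewrite divr_ge0 // (le_trans _ (qi i ik)).
- move=> s C CU lC; rewrite mq lee_fin; case: (HD s) => _ _ _.
  rewrite /M -/C CU => h1 h2; rewrite h2 /w.
  case: eqP => [_|C0]; first by rewrite mul0r (le_trans (ltW qk)).
  move: lC; rewrite leq_eqVlt => /orP [/eqP ->|ltC].
    by rewrite ltnn eqxx mul1r.
  rewrite ltC; apply: le_trans (h1 ltC).
  rewrite -qie mulrA divfK // gt_eqF // (lt_le_trans ltr01) //.
  exact: qi.
- have := kq; lra.
- move=> s p C CU cC Fr ltM; have [lM _ _ _] := phases_inv s hk.
  have MU' : ph_cur p `<=` universe N.
    by apply: fsubset_trans CU; apply: fsubsetUr.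
  case: (HD s) => _ _ _ _; rewrite /M -/p MU' => ->.
  have := sum_le_eps (universe N `\` C) (De s).
  rewrite cardfsDS // card_universe cC subnDA => le.
  have h0 : 0 <= eps^-1 - #|` ph_cur p|%:R by rewrite (le_trans ler01) // qi.
  apply: le_trans (ler_wpM2r h0 le) _.
  by rewrite -mulrA [eps * _]mulrC qie.
- rewrite (Phi_sub1 e0 ek); set P := \sum_(1 <= i < k) _.
  have P0 : 0 <= P.
    rewrite /P big_nat_cond; apply: sumr_ge0 => i /andP [/andP [_ ik] _].
    by rewrite invr_ge0 (le_trans ler01) // qi.
  apply: le_trans (phase_rate_le _ kq qN P0) _; first by rewrite hk kN.
  rewrite big_nat_recr //= (_ : w k = 1); last first.
    by rewrite /w gtn_eqF // ltnn eqxx.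
  rewrite mulr_sumr ler_wpDr //; apply: ler_sum_nat => i /andP [i1 ik].
  by rewrite /w gtn_eqF // ik.
Qed.

End Scarce.

Section Uniform.
Variables (k N : nat) (eps : R).
Hypotheses (hk : (0 < k)%N) (kN : (k < N)%N) (eN : N%:R^-1 <= eps).

Definition uniform (N : nat) (x : item) : R := if (x < N)%N then N%:R^-1 else 0.

Let N0 : 0 < N%:R :> R.
Proof. by rewrite ltr0n (leq_trans _ kN). Qed.

Let u0 x : 0 <= uniform N x.
Proof. by rewrite /uniform; case: ifP => // _; rewrite invr_ge0. Qed.

Let mean_uniform (f : item -> R) : (forall x, 0 <= f x) ->
  mean (uniform N) (fun x => (f x)%:E) = (N%:R^-1 * \sum_(0 <= x < N) f x)%:E.
Proof.
move=> f0; rewrite (@mean_finsupp _ _ N) //; last first.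
  by move=> x; rewrite /uniform ltnNge => ->.
congr EFin; rewrite mulr_sumr; apply: eq_big_nat => x /andP [_ xN].
by rewrite /uniform xN.
Qed.

Let uniform_dist : dist (uniform N).
Proof.
split=> //; transitivity (mean (uniform N) (fun=> 1%:E)).
  by apply: eq_eseriesr => x _; rewrite mule1.
rewrite mean_uniform // sumr_const_nat subn0 -[in X in (_ * X)%:E]mulr_natl.
by rewrite mulr1 mulVf // gt_eqF.
Qed.

Let sum_uniform (C : cache) : C `<=` universe N ->
  \sum_(x <- C) uniform N x = #|` C|%:R / N%:R.
Proof.
move=> CU; rewrite big_seq (eq_bigr (fun=> N%:R^-1)) => [|x xC].
  by rewrite -big_seq big_const_seq count_predT iter_addr_0 mulr_natl.
by rewrite /uniform -in_universe (fsubsetP CU).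
Qed.

(** Whatever the cache, [N - k] of the [N] items are missing on average, while [N - i] items are
    outside of a phase set of size [i]; [w i] is the quotient of the two probabilities. *)
Lemma ratio_ge_uniform (f : seq item -> \bar R) F q (a c : R) :
  (forall s, f s = (F s)%:E) -> tame F ->
  (forall s x, 0 <= q s x <= 1) ->
  (forall s, cumul q s <= F s + a) ->
  (forall s, (N - k)%:R <= \sum_(0 <= x < N) q s x) ->
  0 <= c -> c <= \sum_(1 <= i < k.+1) (N%:R - i%:R)^-1 ->
  (c%:E <= Defs.ratio k eps f)%E.
Proof.
move=> fF tF q01 qF sq c0 hc.
have mq s : mean (uniform N) (fun x => (q s x)%:E) =
    (N%:R^-1 * \sum_(0 <= x < N) q s x)%:E.
  by apply: mean_uniform => x; case/andP: (q01 s x).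
have Ni i : (i <= k)%N -> 1 <= N%:R - i%:R :> R.
  move=> ik; rewrite lerBrDr nat1r ler_nat; exact: leq_ltn_trans ik kN.
apply: (@ratio_ge_faults k N eps (fun=> uniform N) _ F
   (fun i => if (0 < i <= k)%N then (N - k)%:R / (N%:R - i%:R) else 0)
   q (cumul q) a _ ((N - k)%:R / N%:R) N%:R) => //.
- move=> s; split; last by case: uniform_dist.
  move=> x; rewrite u0 /uniform; case: ifP => // _.
  by rewrite (le_trans _ eN) // invr_ge0 ltW.
- by move=> s x; rewrite /uniform; case: ifP => //; rewrite ltxx.
- exact: cumul_nil.
- exact: cumul_rcons.
- by rewrite divr_gt0 // ltr0n subn_gt0.
- by move=> s; rewrite mq lee_fin mulrC ler_wpM2l // invr_ge0 ltW.
- move=> i; case: ifP => // /andP [_ ik].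
  by rewrite divr_ge0 // (le_trans ler01) // Ni.
- move=> s C CU lC; rewrite mq lee_fin sum_uniform // lC andbT.
  apply: le_trans (_ : (N - k)%:R / N%:R <= _); last first.
    by rewrite mulrC ler_wpM2l // invr_ge0 ltW.
  case: ifP => _; last by rewrite mul0r divr_ge0 // ltW.
  have := Ni _ lC; set i := #|` C|%:R => Ni1.
  rewrite le_eqVlt; apply/orP; left; apply/eqP; field.
  by rewrite !gt_eqF // (lt_le_trans ltr01).
- by rewrite ltr_nat.
- move=> s p C CU cC Fr ltM.
  have MU' : ph_cur p `<=` universe N.
    by apply: fsubset_trans CU; apply: fsubsetUr.
  rewrite !sum_uniform // ?fsubsetDl //.
  rewrite cardfsDS // card_universe cC subnDA.
  rewrite le_eqVlt; apply/orP; left; apply/eqP; field.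
  by rewrite gt_eqF.
- have k1N : k%:R + 1 <= N%:R :> R by rewrite natr1 ler_nat.
  apply: le_trans (phase_rate_le _ k1N (lexx _) c0) _; first by rewrite hk kN.
  apply: le_trans (ler_wpM2l _ hc) _ => //.
  rewrite mulr_sumr; apply: ler_sum_nat => i /andP [i1 ik].
  by rewrite i1 -ltnS ik.
Qed.

End Uniform.
End Adversaries.

(** * Randomized algorithms *)

Section RandomAlgorithms.
Context {R : realType}.
Implicit Types (s : seq item) (eps : R) (A : alg) (Q : randalg R).
Local Open Scope ring_scope.
Local Open Scope classical_set_scope.
Local Notation algT := (g_sigma_algebraType cylinders).

Lemma measurable_cache s (C : cache) :
  measurable ([set A : alg | A s = C] : set algT).
Proof. by apply: sub_sigma_algebra; exists s, C. Qed.

(** There are countably many finite sequences of caches, so an event that depends on finitely many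
    caches is a countable union of finite intersections of cylinders. *)
Lemma measurable_cylindrical (ss : seq (seq item)) (P : seq cache -> Prop) :
  measurable ([set A : alg | P (map A ss)] : set algT).
Proof.
have -> : [set A : alg | P (map A ss)] =
    (\bigcup_(Cs : seq cache) [set A : alg | map A ss = Cs /\ P Cs])%classic.
  by apply/seteqP; split=> [A PA|A [Cs _ [<- PCs]]] //; exists (map A ss).
apply: countable_bigcupT_measurable => [|Cs]; first exact: countableP.
have [PCs|nP] := pselect (P Cs); last first.
  rewrite (_ : [set A : alg | _ /\ _] = set0) //.
  by apply/seteqP; split=> // A [].
rewrite (_ : [set A : alg | _ /\ _] = [set A : alg | map A ss = Cs]); last first.
  by apply/seteqP; split=> A // [].
clear; elim: ss Cs => [|s ss IH] [|C Cs] /=.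
- by rewrite (_ : [set A : alg | _] = setT) //; apply/seteqP.
- by rewrite (_ : [set A : alg | _] = set0) //; apply/seteqP; split.
- by rewrite (_ : [set A : alg | _] = set0) //; apply/seteqP; split.
rewrite (_ : [set A : alg | _] =
    [set A : alg | A s = C] `&` [set A : alg | map A ss = Cs]); last first.
  by apply/seteqP; split=> A /= [e1 e2]; [split | rewrite e1 e2].
apply: measurableI; [exact: measurable_cache | exact: IH].
Qed.

Lemma measurable_cylindrical1 s (P : cache -> Prop) :
  measurable ([set A : alg | P (A s)] : set algT).
Proof. exact: (measurable_cylindrical [:: s] (fun Cs => P (head fset0 Cs))). Qed.

Lemma measurable_cylindrical2 s t (P : cache -> cache -> Prop) :
  measurable ([set A : alg | P (A s) (A t)] : set algT).
Proof.
exact: (measurable_cylindrical [:: s; t] (fun Cs => P (nth fset0 Cs 0) (nth fset0 Cs 1))).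
Qed.

Lemma measurable_all_steps (P : seq item -> item -> set alg) :
  (forall s x, measurable (P s x : set algT)) ->
  measurable ([set A : alg | forall s x, P s x A] : set algT).
Proof.
move=> mP; rewrite (_ : [set A : alg | _] =
    ~` (\bigcup_(sx : seq item * item) ~` P sx.1 sx.2)%classic).
  apply: measurableC; apply: countable_bigcupT_measurable => [|sx].
    exact: countableP.
  exact: measurableC.
apply/seteqP; split=> A /= PA; first by case=> -[s x] _ /=; apply; exact: PA.
by move=> s x; apply: contrapT => nP; apply: PA; exists (s, x).
Qed.

Lemma measurable_online k : measurable ([set A : alg | online k A] : set algT).
Proof.
apply: measurableI; first exact: measurable_cache.
apply: measurable_all_steps => s x.
exact: (measurable_cylindrical1 (rcons s x) (fun C => x \in C /\ (#|` C| <= k)%N)).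
Qed.

Lemma measurable_lazy k : measurable ([set A : alg | lazy k A] : set algT).
Proof.
apply: measurable_all_steps => s x.
exact: (measurable_cylindrical2 s (rcons s x) (fun C C' =>
  (C `\` C' != fset0 -> x \notin C /\ #|` C| = k)%fset /\
  (x \notin C -> #|` C| = k -> #|` C `\` C'| = 1%N)%fset)).
Qed.

Definition cylindrical (g : alg -> R) :=
  exists ss G, forall A, g A = G (map A ss).

Lemma cylindrical_measurable (g : alg -> R) : cylindrical g ->
  measurable_fun [set: algT] (fun A => (g A)%:E : \bar R).
Proof.
move=> [ss [G gG]] _ Y _; rewrite setTI.
rewrite (_ : _ @^-1` Y = [set A : alg | Y (G (map A ss))%:E]).
  exact: (measurable_cylindrical ss (fun Cs => Y (G Cs)%:E)).
by apply/seteqP; split=> A /=; rewrite gG.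
Qed.

Lemma cylindrical_cost s : cylindrical (fun A => (cost A s)%:R).
Proof.
exists [seq take t s | t <- iota 1 (size s)], (fun S => (sched_cost S)%:R) => A.
by rewrite -map_comp.
Qed.

Lemma cylindrical_absent s (x : item) : cylindrical (fun A => (x \notin A s)%:R).
Proof. by exists [:: s], (fun Cs => (x \notin head fset0 Cs)%:R). Qed.

Lemma cylindrical_sum (I : finType) (g : I -> alg -> R) :
  (forall i, cylindrical (g i)) -> cylindrical (fun A => \sum_i g i A).
Proof.
move=> cg; suff H (r : seq I) : cylindrical (fun A => \sum_(i <- r) g i A).
  exact: H.
elim: r => [|i r [ss [G GE]]].
  by exists [::], (fun=> 0) => A; rewrite big_nil.
have [ss' [G' GE']] := cg i.
exists (ss' ++ ss), (fun Cs => G' (take (size ss') Cs) + G (drop (size ss') Cs)).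
move=> A; rewrite big_cons GE GE' map_cat.
by rewrite take_size_cat ?drop_size_cat ?size_map.
Qed.

Lemma cylindrical_faults s :
  cylindrical (fun A => cumul (fun s x => (x \notin A s)%:R) s).
Proof. by apply: cylindrical_sum => i; exact: cylindrical_absent. Qed.

Section Integral.
Variables (Q : randalg R) (S : set alg).
Hypotheses (mS : measurable (S : set algT)) (QS : Q S = 1%:E).

Lemma integral_cst_prob (c : R) : (\int[Q]_A (cst c%:E) A)%E = c%:E.
Proof.
rewrite integral_cst // [X in (_ * X)%E](_ : _ = 1%:E) ?mule1 //.
exact: probability_setT.
Qed.

(** Being online or lazy is only known almost surely, so inequalities between costs are integrated
    over a set of probability 1. *)
Lemma le_integral_on (f g : alg -> R) (c : R) :
  cylindrical f -> cylindrical g -> (forall A, 0 <= f A) -> (forall A, 0 <= g A) ->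
  0 <= c -> (forall A, S A -> f A <= g A + c) ->
  (\int[Q]_A (f A)%:E <= \int[Q]_A (g A)%:E + c%:E)%E.
Proof.
move=> /cylindrical_measurable mf /cylindrical_measurable mg f0 g0 c0 fg.
rewrite -(integral_cst_prob c) -ge0_integralD //; last first.
  by move=> A _; rewrite lee_fin.
apply: ae_ge0_le_integral => //.
- by move=> A _; rewrite lee_fin.
- by move=> A _; rewrite adde_ge0 // lee_fin.
- by apply: emeasurable_funD => //; exact: measurable_cst.
exists (~` S); split; first exact: measurableC.
  by rewrite [LHS](probability_setC Q mS) [X in (_ - X)%E]QS subee.
apply: subsetC => A SA _; rewrite -EFinD lee_fin; exact: fg.
Qed.

End Integral.

Lemma prob_setI1 (Q : randalg R) (S T : set alg) : measurable (S : set algT) ->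
  measurable (T : set algT) -> Q T = 1%:E -> Q (S `&` T) = Q S.
Proof.
move=> mS mT QT.
have -> : Q S = (Q (S `\` T) + Q (S `&` T))%E := measureDI Q mS mT.
have -> : Q (S `\` T) = 0%:E; last by rewrite add0e.
apply/eqP; rewrite eq_le measure_ge0 andbT.
have <- : Q (~` T) = 0%:E.
  by rewrite [LHS](probability_setC Q mT) [X in (_ - X)%E]QT subee.
apply: le_measure; rewrite ?inE; [exact: measurableD|exact: measurableC|].
by move=> A [].
Qed.

Section RandAlg.
Variables (k : nat) (Q : randalg R).
Hypotheses (hk : (0 < k)%N) (oQ : rand_online k Q).

Let on_online := le_integral_on (@measurable_online k) oQ.

Definition absent s x : R := fine (Q [set A : alg | x \notin A s]).

Let mabs s (x : item) : measurable ([set A : alg | x \notin A s] : set algT).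
Proof. exact: (measurable_cylindrical1 s (fun C => x \notin C)). Qed.

Lemma absentE s x : Q [set A : alg | x \notin A s] = (absent s x)%:E.
Proof.
rewrite /absent fineK // ge0_fin_numE ?measure_ge0 //.
by apply: le_lt_trans (probability_le1 Q (mabs s x)) (ltry _).
Qed.

Lemma absent01 s x : 0 <= absent s x <= 1.
Proof.
by rewrite -!lee_fin -absentE measure_ge0 /=; exact: (probability_le1 Q (mabs s x)).
Qed.

Lemma integral_absent s x :
  (\int[Q]_A (x \notin A s)%:R%:E = (absent s x)%:E)%E.
Proof.
rewrite -absentE -[in RHS](setIT [set A : alg | _]) -integral_indic //.
apply: eq_integral => A _; rewrite indicE; congr (_%:R%:E).
by case: (boolP (x \notin A s)) => xA; [rewrite mem_set | rewrite memNset //; apply/negP].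
Qed.

Lemma integral_sum_absent (I : Type) (r : seq I) (t : I -> seq item) (x : I -> item) :
  (\int[Q]_A (\sum_(i <- r) (x i \notin A (t i))%:R : R)%:E =
   (\sum_(i <- r) absent (t i) (x i))%:E)%E.
Proof.
transitivity (\int[Q]_A (\sum_(i <- r) (x i \notin A (t i))%:R%:E))%E.
  by apply: eq_integral => A _; rewrite sumEFin.
rewrite ge0_integral_sum // => [|i].
  by rewrite -sumEFin; apply: eq_bigr => i _; exact: integral_absent.
exact: cylindrical_measurable (cylindrical_absent _ _).
Qed.

Lemma integral_faults s :
  (\int[Q]_A (cumul (fun s x => (x \notin A s)%:R) s)%:E =
   (cumul absent s)%:E)%E.
Proof. exact: integral_sum_absent. Qed.

Lemma ecost_fin s : ecost Q s \is a fin_num.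
Proof.
rewrite ge0_fin_numE; last by apply: integral_ge0 => A _; rewrite lee_fin.
apply: le_lt_trans (ltry (0 + (k * size s)%:R)).
rewrite EFinD -{1}(integral_cst_prob Q 0).
apply: (@on_online _ (fun=> 0)) => //; first exact: cylindrical_cost.
  by exists [::], (fun=> 0).
move=> A oA; rewrite add0r ler_nat; elim/last_ind: s => [//|s x IH].
rewrite (cost_rcons _ _ (proj1 oA)) size_rcons mulnS addnC leq_add //.
exact: online_evict_le.
Qed.

Definition rcost s : R := fine (ecost Q s).

Lemma rcostE s : ecost Q s = (rcost s)%:E.
Proof. by rewrite /rcost fineK // ecost_fin. Qed.

Let faults_ge0 A s : 0 <= cumul (fun s x => (x \notin A s)%:R) s :> R.
Proof. by apply: sumr_ge0 => *; exact: ler0n. Qed.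

Lemma cumul_absent_le s : cumul absent s <= rcost s + k%:R.
Proof.
rewrite -lee_fin -integral_faults EFinD -rcostE.
apply: on_online => //; first exact: cylindrical_faults; first exact: cylindrical_cost.
by move=> A oA; exact: faults_le_cost.
Qed.

(** By linearity the expected number of faults involves only the law of the cache after each prefix,
    and a lazy algorithm never evicts without a fault. *)
Lemma rcost_le_cumul s : Q [set A : alg | lazy k A] = 1%:E ->
  rcost s <= cumul absent s.
Proof.
move=> lQ; rewrite -lee_fin -integral_faults -rcostE -[leRHS]adde0.
have mI := measurableI _ _ (@measurable_online k) (@measurable_lazy k).
have QI : Q ([set A : alg | online k A] `&` [set A : alg | lazy k A]) = 1%:E.
  by rewrite (prob_setI1 (measurable_online k) (measurable_lazy k)).
apply: (le_integral_on mI QI) => //; [exact: cylindrical_cost|exact: cylindrical_faults|].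
move=> A [oA lA]; rewrite addr0; elim/last_ind: s => [|s x IH].
  by rewrite cost_nil cumul_nil.
rewrite (cost_rcons _ _ (proj1 oA)) cumul_rcons natrD lerD // ler_nat.
exact: lazy_evict lA.
Qed.

Lemma tame_rcost : tame rcost.
Proof.
split=> [s|].
  by rewrite -lee_fin -rcostE; apply: integral_ge0 => A _; rewrite lee_fin.
exists k%:R => // s x; rewrite -lee_fin EFinD -!rcostE.
apply: on_online => //; [exact: cylindrical_cost|exact: cylindrical_cost|].
move=> A oA; rewrite -natrD ler_nat.
by rewrite (cost_rcons _ _ (proj1 oA)) leq_add2l (online_evict_le _ _ oA).
Qed.

Lemma sum_absent_ge N s : (k <= N)%N ->
  (N - k)%:R <= \sum_(0 <= x < N) absent s x.
Proof.
move=> kN; rewrite -lee_fin -integral_sum_absent -[leRHS]adde0.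
rewrite -(integral_cst_prob Q (N - k)%:R).
apply: (@on_online (fun=> (N - k)%:R)) => //.
- by exists [::], (fun=> (N - k)%:R).
- rewrite /index_iota subn0 -val_enum_ord.
  under [fun A => _]eq_fun do rewrite big_map big_enum.
  by apply: cylindrical_sum => i; exact: cylindrical_absent.
- by move=> A; apply: sumr_ge0 => *; exact: ler0n.
move=> A oA; rewrite addr0 -natr_sum ler_nat.
have -> : (\sum_(0 <= x < N) (x \notin A s) =
    count (predC (mem (A s))) (iota 0 N))%N.
  rewrite -sum1_count [RHS]big_mkcond /= /index_iota subn0.
  by apply: eq_bigr => x _; case: (_ \in _).
have := count_predC (mem (A s)) (iota 0 N); rewrite size_iota.
have : (count (mem (A s)) (iota 0 N) <= k)%N.
  apply: leq_trans (online_card s oA).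
  rewrite -size_filter; apply: uniq_leq_size.
    by rewrite filter_uniq // iota_uniq.
  by move=> x; rewrite mem_filter => /andP [].
clear; lia.
Qed.

Lemma rand_ratio_ge N eps c : (k < N)%N -> N%:R^-1 <= eps -> 0 <= c ->
  c <= \sum_(1 <= i < k.+1) (N%:R - i%:R)^-1 ->
  (c%:E <= rand_ratio k eps Q)%E.
Proof.
move=> kN eN c0 hc.
apply: (ratio_ge_uniform hk kN eN rcostE tame_rcost absent01
  cumul_absent_le _ c0 hc).
by move=> s; apply: sum_absent_ge; exact: ltnW.
Qed.

Lemma lazy_ratio_le eps c b : 0 <= c -> Q [set A : alg | lazy k A] = 1%:E ->
  (forall s, cumul absent s <= c * (optn k s)%:R + b) ->
  (rand_ratio k eps Q <= c%:E)%E.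
Proof.
move=> c0 lQ H.
apply: (ratio_le hk rcostE tame_rcost) => D dD; exists (Num.max b 0) => n.
have b0 : 0 <= Num.max b 0 by rewrite le_max lexx orbT.
have to := @optn_tame R k hk.
rewrite -[X in _ + X](emean_cst dD n b0) -(emeanZ dD) //.
rewrite -(emeanD dD); [|exact: tameZ|exact: tame_cst].
apply: (le_emean dD); first exact: tame_rcost.
  by apply: tameD; [exact: tameZ | exact: tame_cst].
move=> s; apply: le_trans (rcost_le_cumul s lQ) _.
by apply: le_trans (H s) _; rewrite lerD2l le_max lexx.
Qed.

End RandAlg.

(** A deterministic algorithm is a Dirac mass. *)
Lemma opt_rand_le_det k eps : (opt_rand_ratio k eps <= opt_det_ratio k eps)%E.
Proof.
apply: le_ereal_inf_tmp => _ [A oA <-]; apply: ereal_inf_lbound.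
exists (\d_(A : g_sigma_algebraType cylinders)).
  by rewrite /rand_online /= diracE mem_set.
rewrite /rand_ratio /det_ratio; congr (Defs.ratio _ _ _); apply: funext => s.
rewrite /ecost integral_dirac //; last exact: cylindrical_measurable (cylindrical_cost s).
by rewrite diracT mul1e.
Qed.

End RandomAlgorithms.

(** * Prescribed transition probabilities realized by nested intervals *)

Section Pick.
Context {R : realType}.
Implicit Types (w : cache -> R) (l : seq cache).

(* The element of [l] whose interval contains [u], with the left end of this
   interval, when consecutive intervals of lengths given by [w] are laid out
   from [a] on. *)
Fixpoint pick w l (a u : R) (d : cache) : cache * R :=
  if l is C :: l' then
    if u < a + w C then (C, a) else pick w l' (a + w C) u d
  else (d, a).

Definition offset w l (C : cache) : R := \sum_(B <- take (index C l) l) w B.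

Lemma pick_mem w l a u d : d \in l -> (pick w l a u d).1 \in l.
Proof.
suff H l' b : (forall C, C \in l' -> C \in l) -> d \in l ->
    (pick w l' b u d).1 \in l.
  by move=> dl; apply: H.
elim: l' b => [//|C l' IH] b sub dl /=; case: ifP => _.
  by apply: sub; rewrite inE eqxx.
by apply: IH => // B Bl; apply: sub; rewrite inE Bl orbT.
Qed.

Let offset_cons w C l B : C \notin l -> B \in l ->
  offset w (C :: l) B = w C + offset w l B.
Proof.
move=> Cl Bl; have /negPf CB : C != B by apply: contraNneq Cl => ->.
by rewrite /offset /= CB /= big_cons.
Qed.

Let offset_head w C l : offset w (C :: l) C = 0.
Proof. by rewrite /offset /= eqxx big_nil. Qed.

Lemma pick_total w l a u d : uniq l -> a <= u < a + \sum_(C <- l) w C ->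
  exists C, [/\ C \in l, pick w l a u d = (C, a + offset w l C) &
      a + offset w l C <= u < a + offset w l C + w C].
Proof.
elim: l a => [|C l IH] a /=.
  by rewrite big_nil addr0 => _ /andP [h1 h2]; have := le_lt_trans h1 h2; rewrite ltxx.
rewrite big_cons addrA => /andP [Cl ul] /andP [au ul']; case: ltP => uC.
  by exists C; rewrite offset_head addr0 inE eqxx au uC.
have [|B [Bl -> Bu]] := IH (a + w C) ul; first by rewrite uC ul'.
by exists B; rewrite inE Bl orbT offset_cons // addrA.
Qed.

Lemma offset_ge0 w l C : (forall B, 0 <= w B) -> 0 <= offset w l C.
Proof. by move=> w0; apply: sumr_ge0. Qed.

Lemma offset_le w l C : (forall B, 0 <= w B) -> C \in l -> uniq l ->
  offset w l C + w C <= \sum_(B <- l) w B.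
Proof.
move=> w0; elim: l => [//|D l IH] /=.
rewrite inE big_cons => /orP [/eqP <- _|Cl /andP [Dl ul]].
  by rewrite offset_head add0r lerDl sumr_ge0.
by rewrite offset_cons // -addrA lerD2l IH.
Qed.

Lemma pick_eq w l a u d C : (forall B, 0 <= w B) -> uniq l -> C \in l ->
  a + offset w l C <= u < a + offset w l C + w C ->
  pick w l a u d = (C, a + offset w l C).
Proof.
move=> w0; elim: l a => [//|D l IH] a /= /andP [Dl ul].
rewrite inE => /orP [/eqP ->|Cl].
  by rewrite offset_head addr0 => /andP [_ ->].
rewrite offset_cons // !addrA => Cu; rewrite IH //.
case: ltP => // uD; case/andP: Cu => h _.
exfalso; have := offset_ge0 l C w0; lra.
Qed.

End Pick.

Section Construction.
Context {R : realType}.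
Local Open Scope classical_set_scope.
Local Notation algT := (g_sigma_algebraType cylinders).
Implicit Types (s : seq item) (h : seq cache) (x : item) (C : cache) (u : R).

(* [K s h x] is the law of the cache after the requests [rcons s x], when [h]
   is the sequence of the caches held so far. *)
Variables (K : seq item -> seq cache -> item -> cache -> R).
Variables (supp : seq item -> seq cache -> item -> seq cache).
Hypotheses (K_ge0 : forall s h x C, 0 <= K s h x C)
  (supp_uniq : forall s h x, uniq (supp s h x))
  (K_supp : forall s h x C, C \notin supp s h x -> K s h x C = 0)
  (K_sum : forall s h x, \sum_(C <- supp s h x) K s h x C = 1).

Definition history (A : alg) s : seq cache :=
  [seq A (take i s) | i <- iota 0 (size s).+1].

Lemma history_rcons (A : alg) s x :
  history A (rcons s x) = rcons (history A s) (A (rcons s x)).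
Proof.
rewrite /history size_rcons -[(size s).+2]addn1 iotaD map_cat add0n -[RHS]cats1.
congr (_ ++ _); last by rewrite /= -(size_rcons s x) take_size.
apply/eq_in_map => i; rewrite mem_iota add0n ltnS => /andP [_ ile].
by rewrite -cats1 takel_cat.
Qed.

Lemma last_history (A : alg) s : last fset0 (history A s) = A s.
Proof. by case/lastP: s => [//|s x]; rewrite history_rcons last_rcons. Qed.

Lemma agreeP (A0 A : alg) s : agree A0 s A <-> history A s = history A0 s.
Proof.
split=> [AA|eqh i ile].
  by apply/eq_in_map => i; rewrite mem_iota add0n ltnS => /andP [_]; exact: AA.
have hn B : nth fset0 (history B s) i = B (take i s).
  by rewrite (nth_map 0%N) ?size_iota ?ltnS // nth_iota ?add0n ?ltnS.
by rewrite -hn eqh hn.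
Qed.

(** Caches of probability 0 are discarded beforehand, so that every sample, and not only almost
    every one, makes moves of positive probability only. *)
Let positive s h x := [seq C <- supp s h x | 0 < K s h x C].

Let positive_uniq s h x : uniq (positive s h x).
Proof. exact: filter_uniq. Qed.

Let positive_sum s h x : \sum_(C <- positive s h x) K s h x C = 1.
Proof.
rewrite -(K_sum s h x) big_filter [RHS](bigID (fun C => 0 < K s h x C)) /=.
rewrite [X in _ = _ + X]big1 ?addr0 // => C nK; apply/eqP.
by rewrite eq_le K_ge0 leNgt nK.
Qed.

Let positiveE s h x C : (C \in positive s h x) = (0 < K s h x C).
Proof.
rewrite mem_filter andb_idr // => K0; apply: contraT => /K_supp Kz.
by rewrite Kz ltxx in K0.
Qed.

(** Along with the history drawn from [u], the left end and the length of the interval of all the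
    numbers that draw the same history. *)
Fixpoint run_rev u (r : seq item) : seq cache * R * R :=
  if r is x :: r' then
    let: (h, a, len) := run_rev u r' in
    let l := positive (rev r') h x in
    let: (C, b) := pick (fun C => len * K (rev r') h x C) l a u (head fset0 l) in
    (rcons h C, b, len * K (rev r') h x C)
  else ([:: fset0], 0, 1).

Let run u s := run_rev u (rev s).

Definition sample u : alg := fun s => last fset0 (run u s).1.1.

Let run_rcons u s x : run u (rcons s x) =
  let: (h, a, len) := run u s in let l := positive s h x in
  let: (C, b) := pick (fun C => len * K s h x C) l a u (head fset0 l) in
  (rcons h C, b, len * K s h x C).
Proof. by rewrite /run rev_rcons /= revK. Qed.

Lemma history_sample u s : history (sample u) s = (run u s).1.1.
Proof.
elim/last_ind: s => [//|s x IH]; rewrite history_rcons IH /sample run_rcons.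
case: (run u s) => -[h a] len /=; case: pick => C b /=.
by rewrite last_rcons.
Qed.

Lemma sample_positive u s x :
  0 < K s (history (sample u) s) x (sample u (rcons s x)).
Proof.
rewrite history_sample /sample run_rcons.
case: (run u s) => -[h a] len /=; set l := positive s h x.
have : l != [::].
  apply/eqP => l0; have := positive_sum s h x; rewrite -/l l0 big_nil.
  by move/eqP; rewrite eq_sym oner_eq0.
case El : l => [//|B l'] _; rewrite -El.
have := @pick_mem _ (fun C => len * K s h x C) l a u (head fset0 l).
case: pick => C b /=; rewrite last_rcons -positiveE -/l; apply.
by rewrite El /= inE eqxx.
Qed.

Let occupies s h a len := [/\ 0 <= a, 0 <= len, a + len <= 1 &
  forall u, 0 <= u < 1 -> ((run u s).1.1 = h <-> a <= u < a + len) /\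
    ((run u s).1.1 = h -> run u s = (h, a, len))].

Let occupies_rcons s h a len x C : occupies s h a len ->
  exists b, occupies (rcons s x) (rcons h C) b (len * K s h x C).
Proof.
move=> [a0 len0 al1 H]; pose w B := len * K s h x B.
have w0 B : 0 <= w B by rewrite mulr_ge0.
set l := positive s h x; have ul : uniq l by exact: positive_uniq.
have sw : \sum_(B <- l) w B = len by rewrite -mulr_sumr positive_sum mulr1.
have Hr u : 0 <= u < 1 -> (run u (rcons s x)).1.1 = rcons h C ->
    a <= u < a + len /\ run u (rcons s x) =
      let: (B, b) := pick w l a u (head fset0 l) in (rcons h B, b, len * K s h x B).
  move=> u01; have [H1 H2] := H u u01; rewrite run_rcons => e.
  have hh : (run u s).1.1 = h.
    move: e; case: (run u s) => -[h' a'] len' /=; case: pick => B b /=.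
    by case/rcons_inj.
  by split; [exact/H1 | rewrite (H2 hh)].
have Hl u : a <= u < a + len -> 0 <= u < 1.
  by case/andP => h1 h2; rewrite (le_trans a0 h1) (lt_le_trans h2 al1).
have [Cl|nCl] := boolP (C \in l); last first.
  have -> : K s h x C = 0.
    by apply/eqP; rewrite eq_le K_ge0 leNgt -positiveE -/l nCl.
  exists a; rewrite mulr0; split=> //; first by rewrite addr0; lra.
  move=> u u01; rewrite addr0.
  have no : (run u (rcons s x)).1.1 <> rcons h C.
    move=> e; have [au] := Hr u u01 e; rewrite -sw in au.
    have [B [Bl -> _]] := pick_total (head fset0 l) ul au => e'.
    by move: e; rewrite e' /= => /rcons_inj [] BC; rewrite -BC Bl in nCl.
  split; last by move/no.
  by split=> [/no //|/andP [h1 h2]]; have := le_lt_trans h1 h2; rewrite ltxx.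
exists (a + offset w l C).
have o0 := offset_ge0 l C w0; have ole := offset_le w0 Cl ul.
rewrite sw in ole; rewrite -/(w C); have wC := w0 C.
split=> //; [by rewrite addr_ge0 | by lra | move=> u u01].
have fwd : (run u (rcons s x)).1.1 = rcons h C ->
    a + offset w l C <= u < a + offset w l C + w C /\
    run u (rcons s x) = (rcons h C, a + offset w l C, w C).
  move=> e; have [au] := Hr u u01 e; rewrite -sw in au.
  have [B [Bl -> Bu]] := pick_total (head fset0 l) ul au => e'.
  move: e; rewrite e' /= => /rcons_inj [] BC.
  by move: Bu; rewrite BC.
split; last by move=> /fwd [].
split; first by move=> /fwd [].
move=> uC; have au : a <= u < a + len by case/andP: uC => h1 h2; lra.
have [[_ H1] H2] := H u u01; rewrite run_rcons (H2 (H1 au)).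
by rewrite /= -/l -/w (pick_eq (head fset0 l) w0 ul Cl uC).
Qed.

(** A history that is never drawn occupies an empty interval of length 0, so every history has a
    probability without case distinction. *)
Let occupies_ex s h : exists a len, occupies s h a len.
Proof.
have empty t g : (forall u, (run u t).1.1 <> g) -> occupies t g 0 0.
  move=> no; split; rewrite ?addr0 // => u _; split; last by move/no.
  by split=> [/no //|/andP [h1 h2]]; have := le_lt_trans h1 h2; rewrite ltxx.
elim/last_ind: s h => [|s x IH] h.
  have [->|h0] := eqVneq h [:: fset0].
    by exists 0, 1; split; rewrite ?add0r //= => u ->.
  by exists 0, 0; apply: empty => u /= e; rewrite -e eqxx in h0.
case/lastP: h => [|h C].
  exists 0, 0; apply: empty => u; rewrite run_rcons.
  by case: (run u s) => -[h a] len /=; case: pick => C b /=; case: h.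
have [a [len sh]] := IH h.
by have [b sb] := occupies_rcons x C sh; exists b, (len * K s h x C).
Qed.

Lemma uniform_itv (a b : R) : 0 <= a -> a <= b -> b <= 1 ->
  uniform_prob (@ltr01 R) `[a, b[ = (b - a)%:E.
Proof.
move=> a0 ab b1; rewrite /uniform_prob.
rewrite (eq_integral (fun=> 1%:E)); last first.
  move=> u; rewrite inE /= in_itv /= => /andP [au ub]; rewrite /uniform_pdf.
  by rewrite (le_trans a0 au) (le_trans (ltW ub) b1) /= subr0 invr1.
rewrite integral_cst //= mul1e lebesgue_measure_itv /= lte_fin.
case: ltP => [_|ba]; first by rewrite EFinB.
by have -> : b - a = 0 by apply/eqP; rewrite subr_eq0 eq_le ab ba.
Qed.

(** The uniform law lives on the whole line; the values outside of [[0, 1)], a null set, are sent to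
    an arbitrary point of it. *)
Let clip u : R := if 0 <= u < 1 then u else 0.

Let sampling : measurableTypeR R -> algT := fun u => sample (clip u).

Let history_event s h :
  measurable ([set u : measurableTypeR R | history (sampling u) s = h]) /\
  forall a len, occupies s h a len ->
    uniform_prob (@ltr01 R) [set u | history (sampling u) s = h] = len%:E.
Proof.
have [a [len sh]] := occupies_ex s h.
have E a' len' : occupies s h a' len' ->
    measurable ([set u : measurableTypeR R | history (sampling u) s = h]) /\
    uniform_prob (@ltr01 R) [set u | history (sampling u) s = h] = len'%:E.
  move=> [a0 len0 al1 H].
  have eqS : [set u | history (sampling u) s = h] `&` `[0, 1[ = `[a', (a' + len')[.
    apply/seteqP; split=> u /=; rewrite !in_itv /= history_sample.
      by move=> [+ u01]; rewrite /clip u01 => /(H u u01).1.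
    move=> ua; have u01 : 0 <= u < 1.
      by case/andP: ua => h1 h2; rewrite (le_trans a0 h1) (lt_le_trans h2 al1).
    by split=> //; rewrite /clip u01; apply/(H u u01).1.
  have mI : measurable (`[0, 1[ : set (measurableTypeR R)) by [].
  have mS : measurable ([set u : measurableTypeR R | history (sampling u) s = h]).
    (* Outside of [[0, 1)] the sampled algorithm is constant, so the event contains all of this part
       or none of it. *)
    rewrite (_ : [set u | _] = `[a', (a' + len')[ `|`
        (~` `[0, 1[ `&` [set u : R | history (sample 0) s = h])); last first.
      rewrite -eqS; apply/seteqP; split=> u /=.
        rewrite in_itv /= /sampling /clip; case: ifP => u01 e.
          by left; split=> //; rewrite u01.
        by right; split=> //; rewrite u01.
      rewrite in_itv /= /sampling /clip; case: ifP => u01 [[]|[]] //.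
    apply: measurableU => //.
    have [e|ne] := pselect (history (sample 0) s = h).
      rewrite (_ : _ `&` _ = ~` `[0, 1[); first exact: (measurableC mI).
      by apply/seteqP; split=> u; [case | split].
    rewrite (_ : _ `&` _ = set0); first exact: measurable0.
    by apply/seteqP; split=> u // [].
  split=> //; have -> : uniform_prob (@ltr01 R) [set u | history (sampling u) s = h] =
      (uniform_prob (@ltr01 R) ([set u | history (sampling u) s = h] `\` `[0%R, 1%R[) +
       uniform_prob (@ltr01 R) ([set u | history (sampling u) s = h] `&` `[0%R, 1%R[))%E.
    exact: (measureDI (uniform_prob (@ltr01 R)) mS mI).
  rewrite eqS uniform_itv // ?lerDl // [X in X%:E]addrC addKr.
  suff -> : uniform_prob (@ltr01 R) ([set u | history (sampling u) s = h] `\` `[0%R, 1%R[) = 0%:E.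
    by rewrite add0e.
  apply/eqP; rewrite eq_le measure_ge0 andbT.
  have <- : uniform_prob (@ltr01 R) (~` `[0%R, 1%R[) = 0%:E.
    rewrite [LHS](probability_setC (uniform_prob (@ltr01 R)) mI).
    by rewrite [X in (_ - X)%E](uniform_itv (lexx 0) ler01 (lexx 1)) subr0 subee.
  apply: le_measure; rewrite ?inE; [exact: measurableD|exact: measurableC|].
  by move=> u [].
split; first by case: (E a len sh).
by move=> a' len' sh'; case: (E a' len' sh').
Qed.

Let measurable_sampling : measurable_fun [set: measurableTypeR R] sampling.
Proof.
apply: (@measurability _ _ (measurableTypeR R) algT setT sampling cylinders) => //.
move=> _ [_ [s [C ->]] <-]; rewrite setTI.
rewrite (_ : _ @^-1` _ = (\bigcup_(h : seq cache)
    [set u | history (sampling u) s = h /\ last fset0 h = C])%classic); last first.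
  apply/seteqP; split=> u /=.
    by move=> e; exists (history (sampling u) s); [|split; [|rewrite last_history]].
  by move=> [h _ [<- <-]]; rewrite last_history.
apply: countable_bigcupT_measurable => [|h]; first exact: countableP.
have [e|ne] := pselect (last fset0 h = C).
  rewrite (_ : [set _ | _ /\ _] = [set u | history (sampling u) s = h]).
    exact: (history_event s h).1.
  by apply/seteqP; split=> u //= [].
rewrite (_ : [set _ | _ /\ _] = set0); first exact: measurable0.
by apply/seteqP; split=> u // [].
Qed.

Theorem exists_randalg : exists Q : randalg R,
  (forall S : set alg, (forall A : alg, A [::] = fset0 ->
     (forall s x, 0 < K s (history A s) x (A (rcons s x))) -> S A) ->
     Q S = 1%:E) /\
  forall (A0 : alg) s x C,
    Q (agree A0 s `&` [set A : alg | A (rcons s x) = C]) =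
    (Q (agree A0 s) * (K s (history A0 s) x C)%:E)%E.
Proof.
have mf : (sampling : measurableTypeR R -> algT) \in mfun.
  by rewrite inE; exact: measurable_sampling.
pose X : {mfun measurableTypeR R >-> algT} := mfun_Sub mf.
exists (distribution (uniform_prob (@ltr01 R)) X); split=> [S HS|A0 s x C].
  rewrite /distribution /pushforward /=.
  rewrite (_ : _ @^-1` S = setT) ?probability_setT //.
  apply/seteqP; split=> u // _; apply: HS => // s x; exact: sample_positive.
rewrite /distribution /pushforward /=.
have -> : sampling @^-1` (agree A0 s `&` [set A : alg | A (rcons s x) = C]) =
    [set u | history (sampling u) (rcons s x) = rcons (history A0 s) C].
  apply/seteqP; split=> u /=; rewrite history_rcons.
    by move=> [/agreeP -> ->].
  rewrite -[_ :: rcons _ C]/(rcons (history A0 s) C).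
  move=> /rcons_inj e; split; last exact: (congr1 snd e).
  by apply/agreeP; exact: (congr1 fst e).
have -> : sampling @^-1` agree A0 s =
    [set u | history (sampling u) s = history A0 s].
  by apply/seteqP; split=> u /= /agreeP.
have [a [len sh]] := occupies_ex s (history A0 s).
have [b sb] := occupies_rcons x C sh.
by rewrite ((history_event _ _).2 _ _ sh) ((history_event _ _).2 _ _ sb).
Qed.

End Construction.

(** * Finite distributions as weighted lists *)

Section FiniteDistributions.
Context {R : realType}.

Definition fmean (T : Type) (d : seq (R * T)) (f : T -> R) : R :=
  \sum_(p <- d) p.1 * f p.2.

Definition fdist (T : eqType) (d : seq (R * T)) :=
  (forall p, p \in d -> 0 <= p.1) /\ \sum_(p <- d) p.1 = 1.

Lemma fmean_cst (T : eqType) (d : seq (R * T)) c : fdist d -> fmean d (fun=> c) = c.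
Proof. by move=> [_ d1]; rewrite /fmean -mulr_suml d1 mul1r. Qed.

Lemma fmeanD (T : Type) (d : seq (R * T)) f g :
  fmean d (fun X => f X + g X) = fmean d f + fmean d g.
Proof. by rewrite /fmean -big_split; apply: eq_bigr => p _; rewrite mulrDr. Qed.

Lemma fmeanZ (T : Type) (d : seq (R * T)) c f :
  fmean d (fun X => c * f X) = c * fmean d f.
Proof. by rewrite /fmean mulr_sumr; apply: eq_bigr => p _; rewrite mulrCA. Qed.

Lemma fmean_sum (T I : Type) (d : seq (R * T)) (r : seq I) (f : I -> T -> R) :
  fmean d (fun X => \sum_(i <- r) f i X) = \sum_(i <- r) fmean d (f i).
Proof.
rewrite /fmean exchange_big /=; apply: eq_bigr => p _.
by rewrite mulr_sumr.
Qed.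

Lemma fmean_ge0 (T : eqType) (d : seq (R * T)) f : fdist d ->
  (forall X, 0 <= f X) -> 0 <= fmean d f.
Proof.
move=> [d0 _] f0; rewrite /fmean big_seq; apply: sumr_ge0 => p pd.
by rewrite mulr_ge0 // d0.
Qed.

Definition fbind (T U : Type) (d : seq (R * T)) (e : T -> seq (R * U)) : seq (R * U) :=
  flatten [seq [seq (p.1 * q.1, q.2) | q <- e p.2] | p <- d].

Lemma fmean_bind (T U : Type) (d : seq (R * T)) (e : T -> seq (R * U)) f :
  fmean (fbind d e) f = fmean d (fun X => fmean (e X) f).
Proof.
rewrite /fmean /fbind big_flatten big_map /=; apply: eq_bigr => p _.
by rewrite big_map mulr_sumr; apply: eq_bigr => q _; rewrite mulrA.
Qed.

Lemma mem_fbind (T U : eqType) (d : seq (R * T)) (e : T -> seq (R * U)) q :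
  q \in fbind d e -> exists p q', [/\ p \in d, q' \in e p.2 &
    q = (p.1 * q'.1, q'.2)].
Proof.
by move=> /flattenP [l /mapP [p pd ->] /mapP [q' qe ->]]; exists p, q'.
Qed.

Lemma fdist_bind (T U : eqType) (d : seq (R * T)) (e : T -> seq (R * U)) :
  fdist d -> (forall p, p \in d -> fdist (e p.2)) -> fdist (fbind d e).
Proof.
move=> [d0 d1] de; split.
  move=> q /mem_fbind [p [q' [pd qe ->]]] /=.
  by rewrite mulr_ge0 ?d0 //; have [+ _] := de p pd; apply.
have -> : \sum_(p <- fbind d e) p.1 = fmean (fbind d e) (fun=> 1).
  by apply: eq_bigr => p _; rewrite mulr1.
rewrite fmean_bind -[RHS]d1 /fmean big_seq [RHS]big_seq; apply: eq_bigr => p pd.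
by rewrite -/(fmean (e p.2) (fun=> 1)) fmean_cst ?mulr1 //; exact: de.
Qed.

Definition fpoint (T : Type) (X : T) : seq (R * T) := [:: (1, X)].

Lemma fmean_point (T : Type) (X : T) f : fmean (fpoint X) f = f X.
Proof. by rewrite /fmean big_seq1 mul1r. Qed.

Lemma fdist_point (T : eqType) (X : T) : fdist (fpoint X).
Proof.
split; last by rewrite big_seq1.
by move=> p; rewrite inE => /eqP ->; exact: ler01.
Qed.

Definition funif (T : Type) (l : seq T) : seq (R * T) :=
  [seq ((size l)%:R^-1, X) | X <- l].

Lemma fmean_unif (T : Type) (l : seq T) f : fmean (funif l) f = unif l f.
Proof.
rewrite /fmean /funif big_map /unif mulr_suml; apply: eq_bigr => X _.
by rewrite mulrC.
Qed.

Lemma fdist_unif (T : eqType) (l : seq T) : l != [::] -> fdist (funif l).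
Proof.
move=> l0; split; first by move=> p /mapP [X _ ->]; rewrite invr_ge0.
rewrite /funif big_map /= big_const_seq count_predT iter_addr_0.
by rewrite -[RHS](@mulfV _ (size l)%:R) ?pnatr_eq0 ?size_eq0 // mulr_natl.
Qed.

Lemma mem_funif (T : eqType) (l : seq T) p : p \in funif l -> p.2 \in l.
Proof. by case/mapP => X Xl ->. Qed.

End FiniteDistributions.

(** * Laws of the cache after a prefix *)

Section Laws.
Context {R : realType}.
Local Open Scope classical_set_scope.
Local Notation algT := (g_sigma_algebraType cylinders).
Implicit Types (s : seq item) (x : item) (C : cache) (A : alg) (Q : randalg R).

Lemma measurable_history s (P : seq cache -> Prop) :
  measurable ([set A : alg | P (history A s)] : set algT).
Proof.
have := measurable_cylindrical [seq take i s | i <- iota 0 (size s).+1] P.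
rewrite (_ : [set A : alg | P (map A _)] = [set A : alg | P (history A s)]) //.
by apply/seteqP; split=> A; rewrite /= /history -map_comp.
Qed.

(** There are countably many histories, enumerated here by their codes; the event splits into
    classes [agree A0 s], on each of which the hypothesis gives the same factor [c]. *)
Lemma prob_given_history Q s (P : seq cache -> Prop) (E : set alg) (c : R) :
  0 <= c -> measurable (E : set algT) ->
  (forall A0, P (history A0 s) ->
     Q (agree A0 s `&` E) = (Q (agree A0 s) * c%:E)%E) ->
  Q ([set A : alg | P (history A s)] `&` E) =
  (Q [set A : alg | P (history A s)] * c%:E)%E.
Proof.
move=> c0 mE H.
pose F i := [set A : alg | P (history A s) /\ choice.pickle (history A s) = i].
have mF i : measurable (F i : set algT).
  exact: (measurable_history s (fun h => P h /\ choice.pickle h = i)).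
have FE : [set A : alg | P (history A s)] = (\bigcup_(i in setT) F i)%classic.
  apply/seteqP; split=> A /=; last by move=> [i _ []].
  by move=> PA; exists (choice.pickle (history A s)).
have tF : trivIset setT F.
  apply/trivIsetP => i j _ _ /eqP ij; apply/seteqP; split=> A //= [[_ ei] [_ ej]].
  by apply: ij; rewrite -ei -ej.
have QF i : Q (F i `&` E) = (Q (F i) * c%:E)%E.
  have [[A0 [PA0 A0i]]|nF] := pselect (exists A, F i A).
    have -> : F i = agree A0 s; last exact: H.
    apply/seteqP; split=> A.
      move=> [_ Ai]; apply/agreeP; apply: (pcan_inj choice.pickleK).
      by rewrite Ai A0i.
    by move=> /agreeP e; rewrite /F /= e.
  have -> : F i = set0 by apply/seteqP; split=> A // FA; case: nF; exists A.
  by rewrite set0I measure0 mul0e.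
rewrite FE setI_bigcupl !measure_bigcup //; last first.
- apply/trivIsetP => i j _ _ ij; rewrite setIACA setIid.
  by move/trivIsetP: tF => /(_ i j I I ij) ->; rewrite set0I.
- by move=> i _; apply: measurableI.
rewrite [LHS](eq_eseriesr (g := fun i => (c%:E * Q (F i))%E)).
  by rewrite [RHS]muleC; apply: nneseriesZl => i _; exact: measure_ge0.
by move=> i _; rewrite [LHS]QF muleC.
Qed.

Definition has_law Q s (d : seq (R * cache)) :=
  forall C, Q [set A : alg | A s = C] = (fmean d (fun X => (C == X)%:R))%:E.

Lemma prob_split Q s (l : seq cache) (E : set alg) : uniq l ->
  measurable (E : set algT) ->
  Q ([set A : alg | A s \in l] `&` E) =
  (\sum_(C <- l) Q ([set A : alg | A s = C] `&` E))%E.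
Proof.
move=> ul mE; elim: l ul => [_|C l IH /= /andP [Cl ul]].
  rewrite big_nil (_ : _ `&` _ = set0) ?measure0 //.
  by apply/seteqP; split=> A // [].
rewrite big_cons -IH // -measureU; first last.
- apply/seteqP; split=> A // [[/= e _] [/= h _]].
  by move: Cl; rewrite -e h.
- apply: measurableI => //; exact: (measurable_cylindrical1 s (fun D => D \in l)).
- apply: measurableI => //; exact: measurable_cache.
congr (Q _); rewrite -setIUl; congr (_ `&` _).
apply/seteqP; split=> A /=; rewrite inE.
  by move=> /orP [/eqP|]; [left|right].
by move=> [->|->]; rewrite ?eqxx ?orbT.
Qed.

Lemma fmean_undup (T : eqType) (d : seq (R * T)) f :
  fmean d f = \sum_(C <- undup (map snd d)) f C * fmean d (fun X => (C == X)%:R).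
Proof.
under [RHS]eq_bigr do rewrite -fmeanZ.
rewrite -fmean_sum /fmean big_seq [RHS]big_seq; apply: eq_bigr => p pd; congr (_ * _).
rewrite (bigD1_seq p.2) ?undup_uniq ?mem_undup ?map_f //= eqxx mulr1.
by rewrite big1 ?addr0 // => C /negPf ->; rewrite mulr0.
Qed.

Lemma law_split Q s d (E : set alg) : fdist d -> has_law Q s d ->
  measurable (E : set algT) ->
  Q E = (\sum_(C <- undup (map snd d)) Q ([set A : alg | A s = C] `&` E))%E.
Proof.
move=> dd ld mE; rewrite -prob_split ?undup_uniq // setIC.
have mS := measurable_cylindrical1 s (fun D => D \in undup (map snd d)).
rewrite prob_setI1 //.
rewrite -[X in Q X]setIT prob_split ?undup_uniq //.
under eq_bigr do rewrite setIT ld.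
rewrite sumEFin; congr (_%:E).
rewrite -[RHS](@fmean_cst R _ d 1 dd) fmean_undup.
by apply: eq_bigr => C _; rewrite mul1r.
Qed.

Lemma law_prob Q s d (P : pred cache) : fdist d -> has_law Q s d ->
  Q [set A : alg | P (A s)] = (fmean d (fun X => (P X)%:R))%:E.
Proof.
move=> dd ld; rewrite (law_split dd ld); last exact: (measurable_cylindrical1 s P).
rewrite fmean_undup -sumEFin; apply: eq_bigr => C _.
case PC : (P C).
  rewrite mul1r -ld; congr (Q _); apply/seteqP; split=> A /=; first by case.
  by move=> e; rewrite e.
rewrite mul0r (_ : _ `&` _ = set0) ?measure0 //.
by apply/seteqP; split=> A //= [->]; rewrite PC.
Qed.

End Laws.

(** * Lazy algorithms from couplings of consecutive laws *)

Section Coupling.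
Context {R : realType}.
Implicit Types (s : seq item) (x : item) (C : cache) (A : alg).
Local Open Scope fset_scope.
Local Open Scope ring_scope.

Definition lazy_move k x C C' : Prop :=
  [/\ x \in C', (#|` C'| <= k)%N,
      C `\` C' != fset0 -> x \notin C /\ #|` C| = k &
      x \notin C -> #|` C| = k -> #|` C `\` C'| = 1%N].

Lemma lazy_moves_online k A : A [::] = fset0 ->
  (forall s x, (#|` A s| <= k)%N -> lazy_move k x (A s) (A (rcons s x))) ->
  online k A /\ lazy k A.
Proof.
move=> A0 step; have cA s : (#|` A s| <= k)%N.
  elim/last_ind: s => [|s x IH]; first by rewrite A0 cardfs0.
  by case: (step s x IH).
split; first by split=> // s x; case: (step s x (cA s)).
by move=> s x; case: (step s x (cA s)).
Qed.

(** Transitions must be prescribed even from caches of probability 0, where a coupling says nothing;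
    this move keeps the algorithm lazy there as well. *)
Definition default_move (k : nat) C x : cache :=
  if x \in C then C else if (#|` C| < k)%N then x |` C
  else x |` (C `\ head 0%N (enum_fset C)).

Lemma lazy_move_hit k C x : x \in C -> (#|` C| <= k)%N -> lazy_move k x C C.
Proof. by move=> xC Ck; split=> //; rewrite ?fsetDv ?eqxx // xC. Qed.

Lemma lazy_move_load k C x : x \notin C -> (#|` C| < k)%N ->
  lazy_move k x C (x |` C).
Proof.
move=> xC Ck; split; rewrite ?fset1U1 ?cardfsU1 ?xC //.
  by case/negP; rewrite fsetD_eq0 fsubsetU1.
by move=> _ e; rewrite e ltnn in Ck.
Qed.

Lemma lazy_move_swap k C x y : x \notin C -> y \in C -> #|` C| = k ->
  lazy_move k x C (x |` (C `\ y)).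
Proof.
move=> xC yC eC; have xy : x != y by apply: contraNneq xC => ->.
split; rewrite ?fset1U1 //.
  rewrite cardfsU1 !inE (negPf xC) andbF /=; have := cardfsD1 y C.
  by rewrite yC eC /= => ->.
move=> _ _; rewrite (_ : _ `\` _ = [fset y]) ?cardfs1 //.
apply/fsetP => z; rewrite !inE; case: eqVneq => [->|zx] /=.
  by apply/esym/negP => /eqP e; rewrite e eqxx in xy.
by case: (eqVneq z y) => [->|_] /=; [rewrite yC|case: (z \in C)].
Qed.

Lemma lazy_move_default k C x : (0 < k)%N -> (#|` C| <= k)%N ->
  lazy_move k x C (default_move k C x).
Proof.
move=> k0 Ck; rewrite /default_move; case: ifPn => xC; first exact: lazy_move_hit.
case: ltnP => h; first exact: lazy_move_load.
have eC : #|` C| = k by apply/eqP; rewrite eqn_leq Ck h.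
apply: lazy_move_swap => //.
have : (0 < size (enum_fset C))%N by rewrite -[size _]/(#|` C|) eC.
have -> : forall y, (y \in C) = (y \in enum_fset C) by [].
by case: (enum_fset C) => //= a l _; rewrite in_cons eqxx.
Qed.

Lemma fmean_gt0 (T : eqType) (d : seq (R * T)) (P : pred T) :
  (forall p, p \in d -> 0 <= p.1) -> 0 < fmean d (fun X => (P X)%:R) ->
  exists p, [/\ p \in d, 0 < p.1 & P p.2].
Proof.
move=> d0 m0; apply: contrapT => nex; move: m0.
rewrite /fmean big_seq big1 ?ltxx // => p pd.
case Pp : (P p.2); last by rewrite mulr0.
have := d0 p pd; rewrite le_eqVlt => /orP [/eqP <-|p0]; first by rewrite mul0r.
by case: nex; exists p.
Qed.

Variables (k : nat) (d : seq item -> seq (R * cache)).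
Hypothesis k_gt0 : (0 < k)%N.
Hypothesis dP : forall s, fdist (d s).
Hypothesis d_nil : forall f, fmean (d [::]) f = f fset0.

Definition lazy_coupling x (d d' : seq (R * cache)) (J : seq (R * (cache * cache))) :=
  [/\ (forall p, p \in J -> 0 <= p.1),
      (forall f, fmean J (fun q => f q.1) = fmean d f),
      (forall f, fmean J (fun q => f q.2) = fmean d' f) &
      (forall p, p \in J -> 0 < p.1 -> lazy_move k x p.2.1 p.2.2)].

Hypothesis couple : forall s x, exists J, lazy_coupling x (d s) (d (rcons s x)) J.

(** Running the conditional laws of the couplings as a Markov chain preserves the marginals, so that
    the cache after [s] has law [d s] while all moves are lazy. *)
Theorem exists_lazy_with_law (law : seq item -> cache -> R) :
  (forall s C, law s C = fmean (d s) (fun X => (C == X)%:R)) ->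
  exists Q : randalg R, lazy_with_law k law Q.
Proof.
move=> lawE.
have [J JP] : {J & forall sx, lazy_coupling sx.2 (d sx.1) (d (rcons sx.1 sx.2)) (J sx)}.
  exists (fun sx => sval (cid (couple sx.1 sx.2))) => sx.
  exact: (svalP (cid (couple sx.1 sx.2))).
pose m s x C := fmean (J (s, x)) (fun q => (q.1 == C)%:R).
(* The law of the second coordinate of the coupling given that the first one is the current
   cache. *)
pose K s (h : seq cache) x C' : R := let C := last fset0 h in
  if m s x C == 0 then (C' == default_move k C x)%:R
  else fmean (J (s, x)) (fun q => ((q.1 == C) && (q.2 == C'))%:R) / m s x C.
pose supp s (h : seq cache) x :=
  undup (default_move k (last fset0 h) x :: map (fun p => p.2.2) (J (s, x))).
have m0 s x C : 0 <= m s x C.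
  rewrite /m /fmean big_seq sumr_ge0 // => p pJ; rewrite mulr_ge0 //.
  by case: (JP (s, x)) => + _ _ _; apply.
have K0 s h x C : 0 <= K s h x C.
  rewrite /K; case: eqP => // _; rewrite divr_ge0 //.
  rewrite /fmean big_seq sumr_ge0 // => p pJ; rewrite mulr_ge0 //.
  by case: (JP (s, x)) => + _ _ _; apply.
have Ksupp s h x C : C \notin supp s h x -> K s h x C = 0.
  rewrite mem_undup inE negb_or => /andP [/negPf Cd CJ]; rewrite /K /= Cd.
  case: eqP => // _; rewrite /fmean big_seq big1 ?mul0r // => p pJ.
  case: (eqVneq p.2.2 C) => [e|_]; last by rewrite andbF mulr0.
  by move: CJ; rewrite -e (map_f (fun p : R * (cache * cache) => p.2.2)).
have Ksum s h x : \sum_(C <- supp s h x) K s h x C = 1.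
  rewrite /K; case: (eqVneq (m s x (last fset0 h)) 0) => [e|ne].
    rewrite (bigD1_seq (default_move k (last fset0 h) x)) ?undup_uniq //=; last first.
      by rewrite mem_undup inE eqxx.
    by rewrite eqxx big1 ?addr0 // => C /negPf ->.
  rewrite -mulr_suml -fmean_sum; apply: (mulIf ne); rewrite mul1r divfK //.
  rewrite /m /fmean big_seq [RHS]big_seq; apply: eq_bigr => p pJ; congr (_ * _).
  rewrite (bigD1_seq p.2.2) ?undup_uniq //=; last first.
    by rewrite mem_undup inE (map_f (fun p : R * (cache * cache) => p.2.2)) ?orbT.
  by rewrite eqxx andbT big1 ?addr0 // => C; rewrite eq_sym => /negPf ->; rewrite andbF.
have [Q [Qsure Qstep]] := exists_randalg K0 (fun s h x => undup_uniq _) Ksupp Ksum.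
have good A : A [::] = fset0 ->
    (forall s x, 0 < K s (history A s) x (A (rcons s x))) -> online k A /\ lazy k A.
  move=> A0 Apos; apply: lazy_moves_online => // s x As.
  have := Apos s x; rewrite /K last_history /=; case: eqVneq => [_|mne].
    case: eqP => [-> _|]; last by rewrite ltxx.
    exact: lazy_move_default.
  rewrite pmulr_lgt0; last by rewrite invr_gt0 lt_def mne m0.
  have [Jge0 _ _ Jl] := JP (s, x); move/(fmean_gt0 Jge0) => [p [pJ p0]].
  move=> /andP [/eqP <- /eqP <-].
  exact: Jl.
have lawQ s : has_law Q s (d s).
  elim/last_ind: s => [|s x IH] C.
    rewrite d_nil; have Q0 : Q [set A : alg | A [::] = fset0]%classic = 1%:E by apply: Qsure.
    case: eqVneq => [->|Cn]; first by rewrite Q0.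
    rewrite -(prob_setI1 (measurable_cache _ _) (measurable_cache _ _) Q0).
    rewrite (_ : (_ `&` _)%classic = set0) ?measure0 //.
    by apply/seteqP; split=> A //= [-> e]; rewrite e eqxx in Cn.
  rewrite (law_split (dP s) IH (measurable_cache _ _)).
  have [Jge0 J1 J2 _] := JP (s, x); move: J1 J2 => /= J1 J2.
  have mE B : m s x B = fmean (d s) (fun X => (B == X)%:R).
    by rewrite -(J1 (fun X => (B == X)%:R)) /m; apply: eq_bigr => p _; rewrite eq_sym.
  rewrite (eq_bigr (fun B => (fmean (J (s, x))
      (fun q => ((q.1 == B) && (q.2 == C))%:R))%:E)); last first.
    move=> B _.
    have -> : (Q ([set A : alg | A s = B] `&` [set A : alg | A (rcons s x) = C])%classic =
       Q [set A : alg | A s = B]%classic * (K s [:: B] x C)%:E)%E.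
      have e : [set A : alg | A s = B]%classic =
          [set A : alg | last fset0 (history A s) = B]%classic.
        by apply/seteqP; split=> A; rewrite /mkset last_history.
      rewrite e; apply: (prob_given_history (P := fun h => last fset0 h = B)) => //.
        exact: measurable_cache.
      by move=> A0 lA; rewrite Qstep /K lA.
    rewrite IH -mE -EFinM /K /=; congr (_%:E); case: (eqVneq (m s x B) 0) => [e|ne].
      rewrite e mul0r; apply/esym/le_anti/andP; split.
        rewrite -[leRHS]e.
        rewrite /m /fmean big_seq [leRHS]big_seq ler_sum // => p pJ.
        by rewrite ler_wpM2l ?Jge0 // ler_nat; case: (_ == B); case: (_ == C).
      by rewrite /fmean big_seq sumr_ge0 // => p pJ; rewrite mulr_ge0 ?Jge0.
    by rewrite mulrC divfK.
  rewrite sumEFin; congr (_%:E); rewrite -fmean_sum -(J2 (fun X => (C == X)%:R)).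
  have e : fmean (J (s, x)) (fun q => (q.1 \notin undup (map snd (d s)))%:R) = 0.
    rewrite (J1 (fun X => (X \notin undup (map snd (d s)))%:R)) /fmean big_seq big1 //.
    by move=> p pd; rewrite mem_undup map_f ?mulr0.
  rewrite /fmean big_seq [RHS]big_seq; apply: eq_bigr => p pJ.
  have := Jge0 p pJ; rewrite le_eqVlt => /orP [/eqP <-|p0]; first by rewrite !mul0r.
  congr (_ * _).
  have pS : p.2.1 \in undup (map snd (d s)).
    apply: contraPT e => pS; apply/eqP; rewrite gt_eqF //.
    rewrite /fmean (big_rem p) //= pS mulr1 ltr_pwDl // big_seq sumr_ge0 // => q.
    by move=> /mem_rem qJ; rewrite mulr_ge0 ?Jge0.
  rewrite (bigD1_seq p.2.1) ?undup_uniq //= eqxx /= eq_sym big1 ?addr0 // => B.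
  by rewrite eq_sym => /negPf ->.
exists Q; split=> [||s C]; last by rewrite lawE; exact: lawQ.
- by apply: Qsure => A A0 /(good A A0) [].
- by apply: Qsure => A A0 /(good A A0) [].
Qed.

End Coupling.

(** * Lower bounds on the optimum from cardinality constraints *)

Section Constraints.
Local Open Scope fset_scope.
Local Open Scope nat_scope.
Implicit Types (s : seq item) (x : item) (X : cache).

(* [(r, U)] stands for the constraint that at least [r] items of [U] be in the
   cache. *)
Definition deficit (W : seq (nat * cache)) X : nat :=
  \max_(p <- W) (p.1 - #|` p.2 `&` X|).

Lemma deficit_leP W X n :
  (forall p, p \in W -> p.1 <= n + #|` p.2 `&` X|) -> deficit W X <= n.
Proof.
move=> H; rewrite /deficit big_seq; apply: (big_ind (fun m => m <= n)) => // [a b h1 h2|p pW].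
  by rewrite geq_max h1.
by rewrite leq_subLR addnC; exact: H.
Qed.

Lemma le_deficit W X p : p \in W -> p.1 <= deficit W X + #|` p.2 `&` X|.
Proof.
move=> pW; rewrite addnC -leq_subLR /deficit.
by rewrite (big_rem p) //= leq_maxl.
Qed.

(** How the constraints after a request may be derived: the requested item itself satisfies a demand
    for one item; after a request that is not new, a constraint may be weakened; and a set without
    [x] gains an item when [x] is added to it. For a new request this gain is not added to the
    demand, so that the deficit falls by one. *)
Definition constraint_step (new : bool) x (W : seq (nat * cache)) (p' : nat * cache) :=
  [\/ x \in p'.2 /\ p'.1 <= 1,
      ~~ new /\ (exists2 p, p \in W & p.2 `<=` p'.2 /\ p'.1 <= p.1) |
      exists2 p, p \in W & [/\ x \notin p.2, x |` p.2 `<=` p'.2 & p'.1 <= ~~ new + p.1]].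

Definition occurrences (new : seq item -> item -> bool) s : nat :=
  \sum_(i < size s) new (take i s) (nth 0 s i).

Lemma occurrences_nil new : occurrences new [::] = 0.
Proof. by rewrite /occurrences big_ord0. Qed.

Lemma occurrences_rcons new s x :
  occurrences new (rcons s x) = occurrences new s + new s x.
Proof.
rewrite /occurrences size_rcons big_ord_recr /= nth_rcons ltnn eqxx.
rewrite -[X in take _ X]cats1 take_size_cat //; congr (_ + _).
apply: eq_bigr => i _.
by rewrite nth_rcons ltn_ord -cats1 takel_cat // ltnW.
Qed.

(** The count of new requests plus the deficit never exceeds the cost. An eviction raises the
    deficit by at most one; a new request lowers the deficit by one to make room for its own
    occurrence. *)
Lemma occurrences_le_optn k (new : seq item -> item -> bool)
    (W : seq item -> seq (nat * cache)) : 0 < k ->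
  (forall p, p \in W [::] -> p.1 = 0) ->
  (forall s x p', p' \in W (rcons s x) -> constraint_step (new s x) x (W s) p') ->
  (forall s x, new s x -> exists2 p, p \in W s & k <= p.1 /\ x \notin p.2) ->
  forall s, occurrences new s <= optn k s.
Proof.
move=> hk W0 WS Wnew s.
have [[X rX] _] := optnP s hk.
suff : occurrences new s + deficit (W s) X <= optn k s by apply: leq_trans; exact: leq_addr.
apply: (proj2 (reach_ind (P := fun s X c => occurrences new s + deficit (W s) X <= c) _ _ rX)).
  by rewrite occurrences_nil; apply: deficit_leP => p /W0 ->.
move=> {X rX}{}s x X X' c lX IH xX' lX'.
rewrite occurrences_rcons -addnA.
suff h : new s x + deficit (W (rcons s x)) X' <= deficit (W s) X'.
  have h2 : deficit (W s) X' <= deficit (W s) X + #|` X `\` X'|.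
    apply: deficit_leP => p /(le_deficit X); move/leq_trans; apply.
    rewrite -addnA leq_add2l.
    have : #|` p.2 `&` X| <= #|` (X `\` X') `|` (p.2 `&` X')|.
      apply: fsubset_leq_card; apply/fsubsetP => z; rewrite !inE.
      by case: (z \in X); case: (z \in p.2); case: (z \in X').
    by move/leq_trans; apply; apply: leq_trans (leq_card_fsetU _ _) _.
  move: IH h h2; clear; clia.
(* The request is outside of the set [U] of a constraint that demands at least [k] items; since [x]
   takes one of the at most [k] places of [X'], this constraint is violated. *)
have dnew : new s x <= deficit (W s) X'.
  case E : (new s x) => //; have [[r U] pW /= [kp xp]] := Wnew s x E.
  have /= := le_deficit X' pW.
  have : #|` U `&` X'| < #|` X'|.
    apply: fproper_ltn_card; rewrite fproperE fsubsetIr /=.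
    by apply/negP => /fsubsetP /(_ x xX'); rewrite inE (negPf xp).
  move: kp lX'.
  by move: (deficit _ _) #|` U `&` _| #|` X'| => a b c1; clear; clia.
suff : deficit (W (rcons s x)) X' <= deficit (W s) X' - new s x.
  by move: dnew; clear; clia.
apply: deficit_leP => p' /WS; case.
- move=> [xp' p1]; apply: leq_trans p1 _; rewrite (cardfsD1 x) !inE xp' xX'.
  by clear; clia.
- move=> [/negPf -> [p pW [sub le1]]]; rewrite subn0; apply: leq_trans le1 _.
  apply: leq_trans (le_deficit X' pW) _; rewrite leq_add2l.
  by apply: fsubset_leq_card; apply: fsetSI.
- move=> [[r U] pW /= [xp sub le1]].
  have : #|` U `&` X'| < #|` p'.2 `&` X'|.
    apply: fproper_ltn_card; rewrite fproperE.
    have /fsubsetP h := sub; apply/andP; split.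
      by apply: fsetSI; apply/fsubsetP => z zp; apply: h; rewrite !inE zp orbT.
    apply/negP => /fsubsetP /(_ x); rewrite !inE xX' (negPf xp) h; last exact: fset1U1.
    by move=> /(_ isT).
  suff H (a b d r1 r2 : nat) (n : bool) : r1 <= ~~ n + r2 -> n <= d ->
      r2 <= d + a -> a < b -> r1 <= d - n + b by apply: H le1 dnew (le_deficit X' pW).
  by clear; case: n => /=; clia.
Qed.

End Constraints.

Section PotentialBound.
Context {R : realType}.
Local Open Scope ring_scope.

(** [N] bounds the items of the whole sequence and is chosen after it, which allows potentials over
    a finite universe; only the initial potential must be bounded uniformly in [N]. *)
Lemma potential_ratio k (Q : randalg R) eps (pot : nat -> seq item -> R)
    (new : seq item -> item -> bool) (c b : R) :
  (0 < k)%N -> rand_online k Q -> Q [set A : alg | lazy k A]%classic = 1%:E ->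
  0 <= c -> (forall N s, 0 <= pot N s) -> (forall N, pot N [::] <= b) ->
  (forall s, occurrences new s <= optn k s)%N ->
  (forall N s x, all (fun y => y < N)%N (rcons s x) ->
     absent Q s x + pot N (rcons s x) <= pot N s + c * (new s x)%:R) ->
  (rand_ratio k eps Q <= c%:E)%E.
Proof.
move=> hk oQ lQ c0 pot0 potb nle step.
apply: (@lazy_ratio_le _ k Q hk oQ eps c b) => // s.
have [N sN] : exists N, all (fun y => y < N)%N s.
  elim: s => [|y s [N sN]]; first by exists 0%N.
  exists (maxn N y.+1); rewrite /= leq_max ltnSn orbT.
  by apply: sub_all sN => z zN; rewrite leq_max zN.
apply: le_trans (_ : c * (occurrences new s)%:R + b <= _); last first.
  by rewrite lerD2r ler_wpM2l // ler_nat.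
suff : cumul (absent Q) s + pot N s <= c * (occurrences new s)%:R + b.
  by have := pot0 N s; lra.
elim/last_ind: s sN => [|s x IH] sN.
  by rewrite cumul_nil occurrences_nil mulr0 !add0r.
have := step N s x sN; move: sN; rewrite all_rcons => /andP [_ /IH].
rewrite cumul_rcons occurrences_rcons natrD mulrDr; lra.
Qed.

End PotentialBound.

(** * Dropping a uniformly random item *)

Section Drops.
Context {R : realType}.
Local Open Scope fset_scope.
Local Open Scope ring_scope.
Implicit Types (x y z w : item) (P M C : cache) (f : cache -> R).

Lemma eq_fmean_in (T : eqType) (d : seq (R * T)) (f g : T -> R) :
  (forall p, p \in d -> f p.2 = g p.2) -> fmean d f = fmean d g.
Proof. by move=> fg; rewrite /fmean; apply: eq_big_seq => p /fg ->. Qed.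

Lemma fmean_map (T U : Type) (h : T -> U) (d : seq (R * T)) (f : U -> R) :
  fmean [seq (p.1, h p.2) | p <- d] f = fmean d (fun X => f (h X)).
Proof. by rewrite /fmean big_map. Qed.

Lemma fmean_le (T : eqType) (d : seq (R * T)) (f g : T -> R) :
  (forall p, p \in d -> 0 <= p.1) -> (forall p, p \in d -> f p.2 <= g p.2) ->
  fmean d f <= fmean d g.
Proof.
move=> d0 fg; rewrite /fmean big_seq [leRHS]big_seq ler_sum // => p pd.
by rewrite ler_wpM2l ?d0 ?fg.
Qed.

Lemma fdist_map (T U : eqType) (h : T -> U) (d : seq (R * T)) : fdist d ->
  fdist [seq (p.1, h p.2) | p <- d].
Proof.
move=> [d0 d1]; split; last by rewrite big_map.
by move=> _ /mapP [p pd ->]; exact: d0.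
Qed.

Definition drop_one P : seq (R * cache) := funif [seq P `\ w | w <- enum_fset P].

Lemma fmean_drop_one P f :
  fmean (drop_one P) f = (\sum_(w <- enum_fset P) f (P `\ w)) / #|` P|%:R.
Proof. by rewrite fmean_unif /unif big_map size_map. Qed.

Lemma fdist_drop_one P : P != fset0 -> fdist (drop_one P).
Proof.
move=> P0; apply: fdist_unif; rewrite -size_eq0 size_map.
by rewrite -[size _]/(#|` P|) cardfs_eq0.
Qed.

Lemma mem_drop_one P p : p \in drop_one P -> exists2 w, w \in P & p.2 = P `\ w.
Proof. by move=> /mem_funif /mapP [w wP ->]; exists w. Qed.

(** Choosing a subset with one element less amounts to choosing the element to drop. *)
Lemma unif_subsets P l f : #|` P| = l.+1 ->
  unif [seq X <- enum_fset (fpowerset P) | #|` X| == l] f = fmean (drop_one P) f.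
Proof.
move=> Pl; rewrite /drop_one fmean_unif.
have e : @perm_eq cache [seq X <- enum_fset (fpowerset P) | #|` X| == l]
    [seq P `\ w | w <- enum_fset P].
  apply: uniq_perm.
  - by apply: filter_uniq; exact: fset_uniq.
  - rewrite map_inj_in_uniq ?fset_uniq // => w z wP zP e.
    have : w \notin P `\ z by rewrite -e !inE eqxx.
    by rewrite !inE [w \in P]wP andbT negbK => /eqP.
  move=> X; rewrite mem_filter fpowersetE; apply/andP/mapP.
    move=> [/eqP Xl XP]; have : #|` P `\` X| == 1%N.
      by rewrite cardfsD (fsetIidPr XP) Pl Xl subSnn.
    move=> /cardfs1P [w ew]; exists w.
      have : w \in P `\` X by rewrite ew inE.
      by rewrite inE => /andP [].
    by rewrite -ew fsetDK.
  move=> [w wP ->]; split; last exact: fsubsetDl.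
  by have := cardfsD1 w P; rewrite [w \in P]wP Pl add1n => -[->].
by rewrite /unif (perm_big _ e) (perm_size e).
Qed.

(* When [P'] is [P] minus one item, this couples [drop_one P] and [drop_one P']
   in such a way that the two results differ by one item. *)
Definition drop_both P P' : seq (R * (cache * cache)) :=
  flatten [seq if w \in P' then [:: (#|` P|%:R^-1, (P `\ w, P' `\ w))]
    else [seq ((#|` P| * #|` P'|)%:R^-1, (P `\ w, P' `\ w')) | w' <- enum_fset P']
    | w <- enum_fset P].

Lemma fmean_drop_both P P' (f : cache * cache -> R) :
  fmean (drop_both P P') f = \sum_(w <- enum_fset P) (if w \in P'
    then #|` P|%:R^-1 * f (P `\ w, P' `\ w)
    else \sum_(w' <- enum_fset P') (#|` P| * #|` P'|)%:R^-1 * f (P `\ w, P' `\ w')).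
Proof.
rewrite /fmean big_flatten big_map; apply: eq_bigr => w _.
by case: ifP => _; rewrite ?big_seq1 ?big_map.
Qed.

Lemma fmean_drop_both1 P P' f : P' != fset0 ->
  fmean (drop_both P P') (fun q => f q.1) = fmean (drop_one P) f.
Proof.
move=> P'0; rewrite fmean_drop_both fmean_drop_one mulr_suml.
apply: eq_bigr => w _; case: ifP => _ /=; first by rewrite mulrC.
rewrite big_const_seq count_predT iter_addr_0 -[X in _ *+ X]/(#|` P'|).
by rewrite -[LHS]mulr_natr natrM invfM mulrAC mulfVK ?pnatr_eq0 ?cardfs_eq0 // mulrC.
Qed.

Lemma fmean_drop_both2 P y f : y \in P -> P `\ y != fset0 ->
  fmean (drop_both P (P `\ y)) (fun q => f q.2) = fmean (drop_one (P `\ y)) f.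
Proof.
move=> yP; rewrite -cardfs_eq0 => n0; rewrite fmean_drop_both fmean_drop_one.
have e : perm_eq (enum_fset P) (y :: enum_fset (P `\ y)).
  apply: uniq_perm; rewrite /= ?fset_uniq ?andbT //.
    by rewrite -[_ \in _]/(y \in P `\ y) !inE eqxx.
  move=> z; rewrite in_cons -[X in _ || X]/(z \in P `\ y) -[LHS]/(z \in P) !inE.
  by case: eqVneq => [->|].
rewrite (perm_big _ e) big_cons /= !inE eqxx /= -mulr_sumr.
rewrite [X in _ + X](_ : _ = #|` P|%:R^-1 *
  \sum_(w <- enum_fset (P `\ y)) f ((P `\ y) `\ w)); last first.
  by rewrite [RHS]mulr_sumr; apply: eq_big_seq => w; rewrite -[_ \in _]/(w \in P `\ y) => ->.
have -> : #|` P| = #|` P `\ y|.+1 by rewrite (cardfsD1 y) yP.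
move: (\sum_(_ <- _) _) n0 => S; case: (#|` _|) => // n _.
by field; rewrite -!natr1; have := ler0n R n; lra.
Qed.

Lemma mem_drop_both P y x p : y \in P -> (x \in P -> y = x) ->
  p \in drop_both P (P `\ y) ->
  [/\ 0 <= p.1, p.2.1 `<=` P, #|` p.2.1|.+1 = #|` P| &
      exists2 z, z \in p.2.1 & p.2.2 = p.2.1 `\ z /\ (x \in p.2.1 -> z = x)].
Proof.
move=> yP xy /flattenP [l /mapP [w wP ->]]; case: ifP => wP'.
  rewrite inE => /eqP -> /=; split.
  - by rewrite invr_ge0.
  - exact: fsubsetDl.
  - by rewrite [RHS](cardfsD1 w) [w \in P]wP.
  exists y; first by rewrite !inE yP andbT eq_sym; move: wP'; rewrite !inE => /andP [].
  by split; [rewrite !fsetDDl fsetUC | rewrite !inE => /andP [_ /xy]].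
move=> /mapP [w' w'P ->] /=; split.
- by rewrite invr_ge0.
- exact: fsubsetDl.
- by rewrite [RHS](cardfsD1 w) [w \in P]wP.
have ewy : w = y by apply/eqP; move: wP'; rewrite !inE [w \in P]wP andbT => /negbFE.
rewrite ewy; exists w' => //; split=> //.
by rewrite !inE => /andP [/eqP xny /xy yx]; case: xny.
Qed.

End Drops.

(** * Partition *)

Section Partition.
Context {R : realType}.
Local Open Scope fset_scope.
Local Open Scope ring_scope.
Implicit Types (s : seq item) (x y : item) (B M C U top : cache) (L : seq (cache * nat)).

(** The label of the level just below the top, hence the number of marked items in the cache; [0]
    for an empty list, as no item of the lowest set is marked. *)
Definition lab L : nat := if L is (_, l) :: _ then l else 0%N.

Fixpoint under L : cache := if L is (B, _) :: L' then B `|` under L' else fset0.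

(* [S_(i+1) U M_i] has [k_(i+1) + 1] elements, so that [M_(i+1)] is obtained from
   it by dropping exactly one of them. *)
Fixpoint blocks L : bool :=
  if L is (B, l) :: L' then
    [&& (#|` B| + lab L' == l.+1)%N, [disjoint B & under L']%fset & blocks L']
  else true.

Definition positive_labels L := all (fun Bl : cache * nat => (0 < Bl.2)%N) L.

Lemma mem_under x L : (x \in under L) = has (fun Bl : cache * nat => x \in Bl.1) L.
Proof. by elim: L => [|[B l] L IH] //=; rewrite inE IH. Qed.

Fixpoint marked_dist L : seq (R * cache) :=
  if L is (B, _) :: L' then fbind (marked_dist L') (fun M => drop_one (B `|` M))
  else fpoint fset0.

Lemma blocks_card B l L M : blocks ((B, l) :: L) -> M `<=` under L ->
  #|` M| = lab L -> #|` B `|` M| = l.+1.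
Proof.
move=> /= /and3P [/eqP e dis _] ML cM; rewrite cardfsU -cM in e *.
suff -> : B `&` M = fset0 by rewrite cardfs0 subn0.
apply/eqP; rewrite -fsetI_eq0 in dis; move: dis; rewrite -!fsubset0.
by apply: fsubset_trans; apply: fsetIS.
Qed.

Lemma mem_marked_dist L p : blocks L -> p \in marked_dist L ->
  p.2 `<=` under L /\ #|` p.2| = lab L.
Proof.
elim: L p => [|[B l] L IH] p; first by rewrite /= inE => _ /eqP ->; rewrite fsub0set cardfs0.
move=> bL /mem_fbind [q [q' [qL q'd ->]]] /=.
have [sq cq] : q.2 `<=` under L /\ #|` q.2| = lab L.
  by apply: IH => //; case/and3P: bL.
have [w wP ->] := mem_drop_one q'd; split.
  by apply: fsubset_trans (fsubsetDl _ _) _; apply: fsetUS.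
have := cardfsD1 w (B `|` q.2); rewrite wP (blocks_card bL sq cq) add1n => -[->].
by [].
Qed.

Lemma fdist_marked_dist L : blocks L -> fdist (marked_dist L).
Proof.
elim: L => [|[B l] L IH] bL; first exact: fdist_point.
have bL' : blocks L by case/and3P: bL.
apply: fdist_bind => [|p pL]; first exact: IH.
have [sp cp] := mem_marked_dist bL' pL.
by apply: fdist_drop_one; rewrite -cardfs_eq0 (blocks_card bL sp cp).
Qed.

Lemma partition_markedE L f : blocks L ->
  partition_marked L f = fmean (marked_dist L) f.
Proof.
elim: L f => [|[B l] L IH] f bL; first by rewrite fmean_point.
have bL' : blocks L by case/and3P: bL.
rewrite /= IH // fmean_bind; apply: eq_fmean_in => p pL.
have [sp cp] := mem_marked_dist bL' pL.
by rewrite unif_subsets // (blocks_card bL sp cp).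
Qed.

Lemma lab_collapse L : lab (collapse L) = lab L.
Proof. by case: L => [|[B l] L] //=; case: eqP => [->|]. Qed.

Lemma under_collapse L : under (collapse L) `<=` under L.
Proof.
elim: L => [|[B l] L IH] //=; case: ifP => _ /=; first exact: fsub0set.
exact: fsetUS.
Qed.

Lemma positive_collapse L : positive_labels (collapse L).
Proof.
elim: L => [|[B l] L IH] //=; case: ifP => // l0 /=.
by rewrite lt0n l0.
Qed.

Lemma blocks_collapse L : blocks L -> blocks (collapse L).
Proof.
elim: L => [|[B l] L IH] //= /and3P [e dis bL]; case: ifP => // _ /=.
rewrite lab_collapse e IH // andbT /=.
by apply: fdisjointWr dis; exact: under_collapse.
Qed.

(** A label 0 means that the level has a single candidate, which is dropped: no mark survives,
    whatever happened below. *)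
Lemma marked_dist_collapse L f : blocks L ->
  fmean (marked_dist (collapse L)) f = fmean (marked_dist L) f.
Proof.
elim: L f => [|[B l] L IH] f //= bL; have bL' : blocks L by case/and3P: bL.
case: ifP => [/eqP l0|_]; last by rewrite /= !fmean_bind IH.
rewrite fmean_point fmean_bind -[LHS](fmean_cst _ (fdist_marked_dist bL')).
apply: eq_fmean_in => p pL; have [sp cp] := mem_marked_dist bL' pL.
have cP := blocks_card bL sp cp; rewrite l0 in cP.
rewrite fmean_drop_one cP divr1.
have /cardfs1P [w ->] : #|` B `|` p.2| == 1%N by rewrite cP.
by rewrite big_seq_fset1 fsetDv.
Qed.

Lemma lab_extract x L : lab (extract x L) = (lab L).-1.
Proof. by case: L => [|[B l] L] //=; case: ifP. Qed.

Lemma under_extract x L : blocks L -> x \in under L ->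
  under (extract x L) = under L `\ x.
Proof.
elim: L => [|[B l] L IH] //= /and3P [_ dis bL]; rewrite inE.
  case: ifP => xB /=; last by move=> xL; rewrite IH // fsetDUl [B `\ x]mem_fsetD1 ?xB.
move=> _; rewrite fsetDUl [under L `\ x]mem_fsetD1 //.
by apply: contraTN dis => xL; apply/fdisjointP => /(_ x xB); rewrite xL.
Qed.

Lemma blocks_extract x L : blocks L -> positive_labels L -> x \in under L ->
  blocks (extract x L).
Proof.
elim: L => [|[B l] L IH] //= /and3P [/eqP e dis bL] /andP [l0 pL].
rewrite inE; case: ifP => xB /=.
  move=> _; rewrite bL andbT; apply/andP; split.
    by move: e l0; rewrite (cardfsD1 x) xB; clear; case: l => // l; clia.
  by apply: fdisjointWl dis; exact: fsubsetDl.
move=> xL; rewrite lab_extract IH // andbT; apply/andP; split.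
  have : (0 < lab L)%N.
    by case: L xL pL {IH e dis bL} => [|[B' l'] L] //= _ /andP [].
  by move: e l0; clear; clia.
by apply: fdisjointWr dis; rewrite under_extract // fsubsetDl.
Qed.

(** Below the level of [x] nothing changes and the same marks serve both states. From that level on,
    the two sets of candidates differ by exactly one item, and [drop_both] preserves this. *)
Fixpoint extract_coupling x L : seq (R * (cache * cache)) :=
  if L is (B, _) :: L' then
    if x \in B then fbind (marked_dist L') (fun M => drop_both (B `|` M) ((B `|` M) `\ x))
    else fbind (extract_coupling x L')
           (fun MM => drop_both (B `|` MM.1) (B `|` MM.2))
  else [::].

(** [z] is the item evicted to make room for [x]; if [x] was marked, it merely moves from the marked
    items to the top set and nothing is evicted. *)
Definition drops_one x M M' := exists2 z, z \in M & M' = M `\ z /\ (x \in M -> z = x).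

Lemma mem_extract_coupling x L p : blocks L -> positive_labels L -> x \in under L ->
  p \in extract_coupling x L ->
  [/\ 0 <= p.1, p.2.1 `<=` under L, #|` p.2.1| = lab L & drops_one x p.2.1 p.2.2].
Proof.
elim: L p => [|[B l] L IH] p //= bL /andP [l0 pL]; have /and3P [_ dis bL'] := bL.
rewrite inE; case: ifP => xB /=.
  move=> _ /mem_fbind [q [q' [qL q'd ->]]] /=.
  have [sq cq] := mem_marked_dist bL' qL.
  have xP : x \in B `|` q.2 by rewrite inE xB.
  have [q'0 sub cq' ex] := mem_drop_both xP (fun=> erefl) q'd; split=> //.
  - by rewrite mulr_ge0 //; have [+ _] := fdist_marked_dist bL'; apply.
  - by apply: fsubset_trans sub _; apply: fsetUS.
  - by move: cq'; rewrite (blocks_card bL sq cq) => -[].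
move=> xL /mem_fbind [q [q' [qL q'd ->]]] /=.
have [q0 sq cq [z zq [eq2 xz]]] := IH _ bL' pL xL qL.
have zB : z \notin B.
  by apply: contraTN dis => zB; apply/fdisjointP => /(_ z zB); rewrite (fsubsetP sq).
have zP : z \in B `|` q.2.1 by rewrite inE zq orbT.
have eP : B `|` q.2.2 = (B `|` q.2.1) `\ z by rewrite eq2 fsetDUl [B `\ z]mem_fsetD1.
rewrite eP in q'd.
have xz' : x \in B `|` q.2.1 -> z = x by rewrite inE xB.
have [q'0 sub cq' ex] := mem_drop_both zP xz' q'd; split=> //.
- by rewrite mulr_ge0.
- by apply: fsubset_trans sub _; apply: fsetUS.
- by move: cq'; rewrite (blocks_card bL sq cq) => -[].
Qed.

Lemma extract_coupling1 x L f : blocks L -> positive_labels L -> x \in under L ->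
  fmean (extract_coupling x L) (fun q => f q.1) = fmean (marked_dist L) f.
Proof.
elim: L f => [|[B l] L IH] f //= bL /andP [l0 pL]; have /and3P [_ dis bL'] := bL.
rewrite inE; case: ifP => xB /=.
  move=> _; rewrite !fmean_bind; apply: eq_fmean_in => q qL.
  have [sq cq] := mem_marked_dist bL' qL.
  rewrite fmean_drop_both1 // -cardfs_eq0; have := cardfsD1 x (B `|` q.2).
  by rewrite inE xB (blocks_card bL sq cq) add1n => -[<-]; rewrite -lt0n.
move=> xL; rewrite !fmean_bind.
rewrite -(IH (fun M => fmean (drop_one (B `|` M)) f)) //.
apply: eq_fmean_in => q qL.
have [q0 sq cq [z zq [eq2 xz]]] := mem_extract_coupling bL' pL xL qL.
rewrite fmean_drop_both1 //; apply/fset0Pn.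
have zB : z \notin B.
  by apply: contraTN dis => zB; apply/fdisjointP => /(_ z zB); rewrite (fsubsetP sq).
have : (0 < #|` (B `|` q.2.1) `\ z|)%N.
  have := cardfsD1 z (B `|` q.2.1).
  by rewrite inE zq orbT (blocks_card bL sq cq) add1n => -[<-].
rewrite cardfs_gt0 => /fset0Pn [w]; rewrite fsetDUl [B `\ z]mem_fsetD1 // -eq2.
by move=> wP; exists w.
Qed.

Lemma extract_coupling2 x L f : blocks L -> positive_labels L -> x \in under L ->
  fmean (extract_coupling x L) (fun q => f q.2) =
  fmean (marked_dist (extract x L)) f.
Proof.
elim: L f => [|[B l] L IH] f //= bL /andP [l0 pL]; have /and3P [_ dis bL'] := bL.
rewrite inE; case: ifP => xB /=.
  move=> _; rewrite !fmean_bind; apply: eq_fmean_in => q qL.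
  have [sq cq] := mem_marked_dist bL' qL.
  have xq : x \notin q.2.
    apply: contraTN dis => xq; apply/fdisjointP => /(_ x xB).
    by rewrite (fsubsetP sq).
  rewrite fmean_drop_both2 ?inE ?xB //; last first.
    rewrite -cardfs_eq0; have := cardfsD1 x (B `|` q.2).
    by rewrite inE xB (blocks_card bL sq cq) add1n => -[<-]; rewrite -lt0n.
  by rewrite fsetDUl [q.2 `\ x]mem_fsetD1.
move=> xL; rewrite !fmean_bind.
rewrite -(IH (fun M => fmean (drop_one (B `|` M)) f)) //.
apply: eq_fmean_in => q qL.
have [q0 sq cq [z zq [eq2 xz]]] := mem_extract_coupling bL' pL xL qL.
have zB : z \notin B.
  by apply: contraTN dis => zB; apply/fdisjointP => /(_ z zB); rewrite (fsubsetP sq).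
have eP : B `|` q.2.2 = (B `|` q.2.1) `\ z by rewrite eq2 fsetDUl [B `\ z]mem_fsetD1.
rewrite eP fmean_drop_both2 ?inE ?zq ?orbT //.
rewrite -cardfs_gt0; have := cardfsD1 z (B `|` q.2.1).
by rewrite inE zq orbT (blocks_card bL sq cq) add1n => -[<-].
Qed.

Definition partition_valid k (st : pstate) : bool :=
  [&& blocks st.2, positive_labels st.2, [disjoint st.1 & under st.2]%fset &
      (#|` st.1| + lab st.2 == k)%N || (st.2 == [::]) && (#|` st.1| < k)%N].

Variant partition_step_spec k (st : pstate) x : pstate -> bool -> Type :=
| PartitionTop of x \in st.1 : partition_step_spec k st x st false
| PartitionExtract of x \notin st.1 & x \in under st.2
    & (#|` st.1| + lab st.2 = k)%N & (0 < lab st.2)%N :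
    partition_step_spec k st x (x |` st.1, collapse (extract x st.2)) false
| PartitionFill of x \notin st.1 & st.2 = [::] & (#|` st.1| < k)%N :
    partition_step_spec k st x (x |` st.1, [::]) false
| PartitionNew of x \notin st.1 & x \notin under st.2
    & (#|` st.1| + lab st.2 = k)%N :
    partition_step_spec k st x ([fset x], collapse ((st.1, k.-1) :: st.2)) true.

Definition partition_new k (st : pstate) x : bool :=
  [&& x \notin st.1, x \notin under st.2 & (#|` st.1| + lab st.2 == k)%N].

Lemma partition_stepP k st x : partition_valid k st ->
  partition_step_spec k st x (partition_step k st x) (partition_new k st x).
Proof.
case: st => [top L] /and4P [/= bL pL dis lk].
rewrite /partition_step /partition_new /= -mem_under.
case: ifPn => xt /=; first exact: PartitionTop.
case: ifPn => xL /=.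
  have L0 : L != [::] by case: L xL {bL pL dis lk}.
  have l0 : (0 < lab L)%N by case: L L0 pL {xL bL dis lk} => [|[B l] L] //= _ /andP [].
  move: lk; rewrite (negPf L0) orbF => /eqP lk.
  exact: (@PartitionExtract k (top, L) x).
case: ifPn => [/andP [/eqP -> tk]|nw].
  by rewrite (_ : (_ == k) = false); [exact: PartitionFill | rewrite addn0 ltn_eqF].
by move: lk; rewrite (negPf nw) orbF => lk; rewrite lk; apply: PartitionNew => //; exact/eqP.
Qed.

Lemma blocks_cons k top L : (0 < k)%N -> blocks L -> [disjoint top & under L]%fset ->
  (#|` top| + lab L = k)%N -> blocks ((top, k.-1) :: L).
Proof. by move=> k0 bL dis lk /=; rewrite lk prednK // eqxx dis. Qed.

Lemma partition_validI k top L : blocks L -> positive_labels L ->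
  [disjoint top & under L]%fset ->
  (#|` top| + lab L == k)%N || (L == [::]) && (#|` top| < k)%N ->
  partition_valid k (top, L).
Proof. by move=> *; apply/and4P. Qed.

Lemma partition_step_valid k st x : (0 < k)%N -> partition_valid k st ->
  partition_valid k (partition_step k st x).
Proof.
move=> k0 vst; have := vst; move: vst => /and4P [bL pL dis lk] vst.
case: (partition_stepP x vst) => // [xt xL lk' l0|xt e tk|xt xL lk'];
  apply: partition_validI => //.
- by rewrite blocks_collapse ?blocks_extract.
- exact: positive_collapse.
- apply/fdisjointP => y yt; apply/negP => /(fsubsetP (under_collapse _)).
    rewrite under_extract // !inE => /andP [yx yL].
    move: yt; rewrite !inE (negPf yx) /= => yt.
    by move/fdisjointP: dis => /(_ y yt); rewrite yL.
- rewrite lab_collapse lab_extract cardfsU1 xt.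
  by apply/orP; left; apply/eqP; move: lk' l0; clear; clia.
- exact: fdisjointX0.
- by rewrite cardfsU1 xt addn0 /=; move: tk; clear; clia.
- by rewrite blocks_collapse //; exact: blocks_cons.
- exact: positive_collapse.
- apply/fdisjointP => y; rewrite inE => /eqP ->.
  apply/negP => /(fsubsetP (under_collapse _)); rewrite /= inE.
  by rewrite (negPf xt) (negPf xL).
- by rewrite lab_collapse cardfs1 /= add1n prednK // eqxx.
Qed.

Definition partition_dist (st : pstate) : seq (R * cache) :=
  [seq (p.1, st.1 `|` p.2) | p <- marked_dist st.2].

Lemma mem_partition_dist k st p : partition_valid k st -> p \in partition_dist st ->
  0 <= p.1 /\ #|` p.2| = (#|` st.1| + lab st.2)%N.
Proof.
move=> /and4P [bL _ dis _] /mapP [q qL ->] /=.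
have [d0 _] := fdist_marked_dist bL; split; first exact: d0.
have [sq cq] := mem_marked_dist bL qL; rewrite cardfsUD -cq (_ : _ `\` _ = q.2) //.
apply/fsetP => y; rewrite inE; case: (boolP (y \in q.2)); last by rewrite andbF.
move=> /(fsubsetP sq) yL.
by rewrite andbT; apply: contraTN dis => yt; apply/fdisjointP => /(_ y yt); rewrite yL.
Qed.

Lemma fdist_partition_dist k st : partition_valid k st -> fdist (partition_dist st).
Proof. by move=> /and4P [bL _ _ _]; apply/fdist_map/fdist_marked_dist. Qed.

Lemma lazy_coupling_map k x (d d' : seq (R * cache)) (g : cache -> cache) :
  fdist d -> (forall f, fmean d' f = fmean d (fun C => f (g C))) ->
  (forall p, p \in d -> lazy_move k x p.2 (g p.2)) ->
  lazy_coupling k x d d' [seq (p.1, (p.2, g p.2)) | p <- d].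
Proof.
move=> [d0 _] d'E dl; split.
- by move=> _ /mapP [p pd ->] /=; exact: d0.
- by move=> f; rewrite (fmean_map (fun C => (C, g C))).
- by move=> f; rewrite (fmean_map (fun C => (C, g C))) d'E.
- by move=> _ /mapP [p pd ->] _ /=; exact: dl.
Qed.

(** For a new request the old cache, with [k] items, is the set of candidates of the new level of
    label [k.-1], so that dropping one of them at random is an ordinary eviction. The other cases
    use [extract_coupling] or a deterministic move. *)
Lemma partition_coupling k st x : (0 < k)%N -> partition_valid k st ->
  exists J, lazy_coupling k x (partition_dist st)
    (partition_dist (partition_step k st x)) J.
Proof.
move=> k0 vst; have dd := fdist_partition_dist vst.
have cle p : p \in partition_dist st -> (#|` p.2| <= k)%N.
  move=> /(mem_partition_dist vst) [_ ->]; have /and4P [_ _ _] := vst.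
  by case/orP => [/eqP -> //|/andP [/eqP -> /ltnW]]; rewrite addn0.
have sub p : p \in partition_dist st -> p.2 `<=` st.1 `|` under st.2.
  move=> /mapP [q qL ->] /=; apply: fsetUS.
  by have /and4P [bL _ _ _] := vst; have [] := mem_marked_dist bL qL.
have /and4P [bL pL dis _] := vst.
case: (partition_stepP x vst) => [xt|xt xL lk l0|xt e tk|xt xL lk].
- exists [seq (p.1, (p.2, id p.2)) | p <- partition_dist st].
  apply: (lazy_coupling_map (g := id)) => // p pd.
  apply: lazy_move_hit; last exact: cle.
  by case/mapP: pd => q _ -> /=; rewrite inE xt.
- exists [seq (p.1, (st.1 `|` p.2.1, x |` (st.1 `|` p.2.2))) | p <- extract_coupling x st.2].
  split.
  + by move=> _ /mapP [p /(mem_extract_coupling bL pL xL) [] ? _ _ _ ->].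
  + move=> f; rewrite (fmean_map (fun q : cache * cache => (st.1 `|` q.1, x |` (st.1 `|` q.2)))).
    rewrite (extract_coupling1 (fun M => f (st.1 `|` M))) // /partition_dist.
    by rewrite (fmean_map (fsetU st.1)).
  + move=> f; rewrite (fmean_map (fun q : cache * cache => (st.1 `|` q.1, x |` (st.1 `|` q.2)))).
    rewrite (extract_coupling2 (fun M => f (x |` (st.1 `|` M)))) // /partition_dist /=.
    rewrite (fmean_map (fsetU (x |` st.1))) marked_dist_collapse ?blocks_extract //.
    by apply: eq_fmean_in => p _; rewrite fsetUA.
  + move=> _ /mapP [p pE ->] _ /=.
    have [_ sp cp [z zp [-> xz]]] := mem_extract_coupling bL pL xL pE.
    have zt : z \notin st.1.
      by apply: contraTN dis => zt; apply/fdisjointP => /(_ z zt); rewrite (fsubsetP sp).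
    have cC : #|` st.1 `|` p.2.1| = k.
      rewrite -lk -cp cardfsUD (_ : _ `\` _ = p.2.1) //.
      apply/fsetP => y; rewrite inE; case: (boolP (y \in p.2.1)); last by rewrite andbF.
      move=> /(fsubsetP sp) yL.
      by rewrite andbT; apply: contraTN dis => yt; apply/fdisjointP => /(_ y yt); rewrite yL.
    have eD : st.1 `|` p.2.1 `\ z = (st.1 `|` p.2.1) `\ z by rewrite fsetDUl [st.1 `\ z]mem_fsetD1.
    rewrite eD; case: (boolP (x \in p.2.1)) => xp.
      rewrite (xz xp) fsetD1K; last by rewrite inE -(xz xp) zp orbT.
      by apply: lazy_move_hit; rewrite ?cC // inE -(xz xp) zp orbT.
    by apply: lazy_move_swap => //; rewrite inE ?(negPf xt) ?(negPf xp) ?zp ?orbT.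
- exists [seq (p.1, (p.2, x |` p.2)) | p <- partition_dist st].
  apply: lazy_coupling_map => // [f|p pd].
    by rewrite /partition_dist e /= /fmean !big_seq1 /= !fsetU0.
  have [_ cp] := mem_partition_dist vst pd; rewrite e addn0 in cp.
  apply: lazy_move_load; last by rewrite cp.
  by case/mapP: pd => q; rewrite e /= inE => /eqP -> -> /=; rewrite fsetU0.
- exists (fbind (partition_dist st) (fun C => [seq (p.1, (C, x |` p.2)) | p <- drop_one C])).
  have cC p : p \in partition_dist st -> #|` p.2| = k.
    by move=> /(mem_partition_dist vst) [_ ->].
  have Cn0 p : p \in partition_dist st -> p.2 != fset0.
    by move=> /cC e; rewrite -cardfs_eq0 e -lt0n.
  split.
  + move=> _ /mem_fbind [q [_ [qd /mapP [p pq ->] ->]]] /=.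
    rewrite mulr_ge0 //; first by case: dd => + _; apply.
    by have [+ _] := fdist_drop_one (R := R) (Cn0 _ qd); apply.
  + move=> f; rewrite fmean_bind; apply: eq_fmean_in => p pd.
    rewrite (fmean_map (fun C => (p.2, x |` C))) /= fmean_cst //.
    exact/fdist_drop_one/Cn0.
  + move=> f; rewrite fmean_bind /partition_dist [RHS](fmean_map (fsetU [fset x])).
    rewrite marked_dist_collapse; last exact: blocks_cons.
    rewrite /= fmean_bind (fmean_map (fsetU st.1)); apply: eq_fmean_in => q qL.
    by rewrite (fmean_map (fun C => (st.1 `|` q.2, x |` C))).
  + move=> _ /mem_fbind [q [_ [qd /mapP [p pq ->] ->]]] _ /=.
    have [w wq ->] := mem_drop_one pq; apply: lazy_move_swap => //; last exact: cC.
    apply/negP => /(fsubsetP (sub _ qd)); rewrite inE.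
    by rewrite (negPf xt) (negPf xL).
Qed.

Lemma partition_state_rcons k s x :
  partition_state k (rcons s x) = partition_step k (partition_state k s) x.
Proof. by rewrite /partition_state -cats1 foldl_cat. Qed.

Lemma partition_state_valid k s : (0 < k)%N -> partition_valid k (partition_state k s).
Proof.
move=> k0; elim/last_ind: s => [|s x IH].
  apply/and4P; split=> //=; first exact: fdisjoint0X.
  by rewrite -[X in _ || X]/(#|` fset0 : cache| < k)%N cardfs0 k0 orbT.
by rewrite partition_state_rcons; exact: partition_step_valid.
Qed.

Lemma partition_lawE k s C : (0 < k)%N -> partition_law R k s C =
  fmean (partition_dist (partition_state k s)) (fun X => (C == X)%:R).
Proof.
move=> k0; rewrite /partition_law; have := partition_state_valid s k0.
case: (partition_state k s) => top L vst; have /and4P [bL _ _ _] := vst.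
by rewrite (partition_markedE _ bL) /partition_dist (fmean_map (fsetU top)).
Qed.

Lemma exists_partition k : (0 < k)%N -> exists Q : randalg R, is_partition k Q.
Proof.
move=> k0; apply: (exists_lazy_with_law (d := fun s => partition_dist (partition_state k s))) => //.
- by move=> s; apply/fdist_partition_dist/partition_state_valid.
- by move=> f; rewrite /partition_dist /= /fmean big_seq1 /= mul1r fsetU0.
- by move=> s x; rewrite partition_state_rcons; exact/partition_coupling/partition_state_valid.
- by move=> s C; exact: partition_lawE.
Qed.

Lemma harmS k : harm R k.+1 = harm R k + k.+1%:R^-1.
Proof. by rewrite /harm big_nat_recr. Qed.

Lemma harm_ge1 k : 1 <= harm R k.+1.
Proof.
elim: k => [|k IH]; first by rewrite /harm big_nat1 invr1.
by rewrite harmS; apply: le_trans IH _; rewrite lerDl invr_ge0.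
Qed.

(** A level of label [l] drops a candidate with probability [1 / (l + 1)], and a request that
    exploits this decrements the label. Down to label 0, this adds up to
    [1 / (l + 1) + ... + 1 / 2]. *)
Definition level_potential L : R := \sum_(Bl <- L) (harm R Bl.2.+1 - 1).

Lemma level_potential_ge0 L : 0 <= level_potential L.
Proof. by apply: sumr_ge0 => Bl _; rewrite subr_ge0 harm_ge1. Qed.

Lemma level_potential_collapse L : level_potential (collapse L) <= level_potential L.
Proof.
elim: L => [|[B l] L IH] //=; case: ifP => _.
  by rewrite [leLHS]/level_potential big_nil level_potential_ge0.
by rewrite /level_potential !big_cons lerD2l.
Qed.

(** A union bound over the levels, from that of [x] up to the top: each of them drops [x] with
    probability at most [1 / (l + 1)] and has its label decremented by [extract], which releases
    exactly this amount. The levels below that of [x] are untouched. *)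
Lemma marked_absent x L : blocks L -> positive_labels L -> x \in under L ->
  fmean (marked_dist L) (fun M => (x \notin M)%:R) + level_potential (extract x L)
  <= level_potential L.
Proof.
elim: L => [|[B l] L IH] //= bL /andP [l0 pL]; have /and3P [_ dis bL'] := bL.
have absent p : p \in marked_dist L -> x \in B `|` p.2 ->
    fmean (drop_one (B `|` p.2)) (fun M => (x \notin M)%:R) = l.+1%:R^-1 :> R.
  move=> pd xP; have [sp cp] := mem_marked_dist bL' pd.
  rewrite fmean_drop_one (blocks_card bL sp cp) (big_fsetD1 x) //=.
  rewrite !inE eqxx /= big_seq big1 ?addr0 ?mul1r // => w.
  move=> wP; have wx : w != x by move: wP; rewrite !inE => /andP [].
  by rewrite !inE eq_sym wx -in_fsetU xP.
have harml : harm R l.+1 = harm R l.-1.+1 + l.+1%:R^-1 by rewrite prednK // harmS.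
rewrite inE fmean_bind; case: ifP => xB /=.
  move=> _; rewrite /level_potential !big_cons /= addrA lerD2r.
  rewrite (_ : fmean _ _ = l.+1%:R^-1 :> R).
    by rewrite harml; move: (harm _ _) (_^-1) => a b; lra.
  rewrite -[RHS](fmean_cst _ (fdist_marked_dist bL')); apply: eq_fmean_in => p pd.
  by apply: absent => //; rewrite inE xB.
move=> xL; have := IH bL' pL xL; rewrite /level_potential !big_cons /=.
suff : fmean (marked_dist L) (fun M => fmean (drop_one (B `|` M))
    (fun M' => (x \notin M')%:R)) <=
    l.+1%:R^-1 + fmean (marked_dist L) (fun M => (x \notin M)%:R).
  by rewrite harml; move: (harm _ _) (_^-1) => a b; lra.
rewrite -[X in X + _](fmean_cst _ (fdist_marked_dist bL')) -fmeanD.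
apply: fmean_le => p pd; first by case: (fdist_marked_dist bL') => + _; apply.
have i0 : 0 <= l.+1%:R^-1 :> R by rewrite invr_ge0.
have [xp|xp] := boolP (x \in p.2); last first.
  rewrite addrC -[leLHS]addr0 lerD // fmean_drop_one ler_pdivrMr; last first.
    have [sp cp] := mem_marked_dist bL' pd.
    by rewrite (blocks_card bL sp cp) ltr0n.
  rewrite mul1r -[X in _ <= X%:R]/(size (enum_fset (B `|` p.2))).
  rewrite -sum1_size natr_sum ler_sum // => w _.
  by rewrite ler_nat; case: (_ \notin _).
by rewrite absent ?addr0 // inE xp orbT.
Qed.

(** The first term pays for the faults that fill the cache; it vanishes once [k] distinct items have
    been requested. *)
Definition partition_potential k (st : pstate) : R :=
  (k - (#|` st.1| + lab st.2))%:R + level_potential st.2.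

(** A new request costs one fault and creates a level of label [k.-1], whose potential is
    [H(k) - 1]; together this is the [H(k)] charged to it. *)
Lemma partition_potential_step k st x : (0 < k)%N -> partition_valid k st ->
  fmean (partition_dist st) (fun C => (x \notin C)%:R) +
    partition_potential k (partition_step k st x) <=
  partition_potential k st + harm R k * (partition_new k st x)%:R.
Proof.
move=> k0 vst; have := vst; move: vst => /and4P [bL pL dis _] vst.
have le1 : fmean (partition_dist st) (fun C => (x \notin C)%:R) <= 1.
  rewrite -[leRHS](fmean_cst _ (fdist_partition_dist vst)); apply: fmean_le => p pd.
    by case: (mem_partition_dist vst pd).
  by case: (_ \notin _); rewrite ?lexx ?ler01.
have stab top L : (#|` top| + lab L = k)%N ->
    partition_potential k (top, collapse L) <= level_potential L.
  move=> e; rewrite /partition_potential /= lab_collapse e subnn add0r.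
  exact: level_potential_collapse.
case: (partition_stepP x vst) => [xt|xt xL lk l0|xt e tk|xt xL lk].
- rewrite mulr0 addr0 gerDr (_ : fmean _ _ = 0) // /partition_dist fmean_map.
  rewrite /fmean big1 // => p _; by rewrite inE xt /= mulr0.
- have h1 := marked_absent bL pL xL; rewrite mulr0 addr0.
  have h2 : partition_potential k (x |` st.1, collapse (extract x st.2)) <=
      level_potential (extract x st.2).
    by apply: stab; rewrite lab_extract cardfsU1 xt; move: lk l0; clear; clia.
  have h3 : partition_potential k st = level_potential st.2.
    by rewrite /partition_potential lk subnn add0r.
  have h4 : fmean (partition_dist st) (fun C => (x \notin C)%:R) =
      fmean (marked_dist st.2) (fun M => (x \notin M)%:R) :> R.
    rewrite /partition_dist (fmean_map (fsetU st.1)); apply: eq_fmean_in => p _.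
    by rewrite inE (negPf xt).
  by move: h1 h2; rewrite h3 h4; lra.
- have -> : partition_potential k (x |` st.1, [::]) = (k - #|` st.1|.+1)%:R.
    by rewrite /partition_potential /= cardfsU1 xt addn0 /level_potential big_nil addr0.
  have -> : partition_potential k st = (k - #|` st.1|)%:R.
    by rewrite /partition_potential e /= addn0 /level_potential big_nil addr0.
  rewrite mulr0 addr0 (_ : (k - #|` st.1|)%N = (k - #|` st.1|.+1).+1); last first.
    by move: tk; clear; clia.
  by rewrite -natr1 addrC lerD2l.
- have h2 : partition_potential k ([fset x], collapse ((st.1, k.-1) :: st.2)) <=
      level_potential ((st.1, k.-1) :: st.2).
    by apply: stab; rewrite cardfs1 /= add1n prednK.
  have h3 : partition_potential k st = level_potential st.2.
    by rewrite /partition_potential lk subnn add0r.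
  have h4 : level_potential ((st.1, k.-1) :: st.2) = harm R k - 1 + level_potential st.2.
    by rewrite /level_potential big_cons /= prednK.
  by rewrite mulr1 h3; move: le1 h2; rewrite h4; lra.
Qed.

(** At most as many cached items as the label of a level lie outside of the sets above this level.
    At the end of the list the bound is 0: all [k] cached items lie in the listed sets. *)
Fixpoint level_constraints k U L : seq (nat * cache) :=
  ((k - lab L)%N, U) ::
  if L is (B, _) :: L' then level_constraints k (U `|` B) L' else [::].

Definition partition_constraints k (st : pstate) : seq (nat * cache) :=
  if (st.2 == [::]) && (#|` st.1| < k)%N then [:: (#|` st.1|, st.1)]
  else level_constraints k st.1 st.2.

Lemma level_constraints_collapse k U L p :
  p \in level_constraints k U (collapse L) -> p \in level_constraints k U L.
Proof.
elim: L U => [|[B l] L IH] U //=; case: ifP => [/eqP ->|_] /=.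
  by rewrite !inE => ->.
by rewrite !inE => /orP [->//|/IH ->]; rewrite orbT.
Qed.

Lemma level_constraints_extract k x U L p : x \notin U -> x \in under L ->
  p \in level_constraints k (x |` U) (extract x L) ->
  constraint_step false x (level_constraints k U L) p.
Proof.
elim: L U => [|[B l] L IH] U //= xU; rewrite inE.
case: ifP => xB /=.
  move=> _; rewrite inE => /predU1P [->|pL].
    apply: Or33; exists (k - l, U)%N; first by rewrite inE eqxx.
    by split=> //=; clear; clia.
  apply: Or32; split=> //; exists p => //; rewrite inE; apply/orP; right.
  rewrite (_ : U `|` B = x |` U `|` B `\ x) //.
  apply/fsetP => y; rewrite !inE; case: (eqVneq y x) => [->|//].
  by rewrite xB orbT.
move=> xL; rewrite inE => /predU1P [->|pL].
  apply: Or33; exists (k - l, U)%N; first by rewrite inE eqxx.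
  by split=> //=; clear; clia.
rewrite -fsetUA in pL; have xUB : x \notin U `|` B by rewrite inE negb_or xU xB.
have mono W q q' : constraint_step false x W q' -> constraint_step false x (q :: W) q'.
  move=> [h|[_ [r rW h]]|[r rW h]]; first exact: Or31.
    by apply: Or32; split=> //; exists r => //; rewrite inE rW orbT.
  by apply: Or33; exists r => //; rewrite inE rW orbT.
by apply: mono; exact: (IH _ xUB).
Qed.

Lemma level_constraints_new k x U L p : x \notin U -> x \notin under L ->
  p \in level_constraints k (x |` U) L ->
  exists2 q, q \in level_constraints k U L &
    [/\ x \notin q.2, x |` q.2 `<=` p.2 & (p.1 <= q.1)%N].
Proof.
elim: L U => [|[B l] L IH] U xU /=.
  by rewrite inE => _ /eqP ->; exists (k - 0, U)%N; rewrite ?inE.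
rewrite inE negb_or => /andP [xB xL]; rewrite inE => /predU1P [->|pL].
  by exists (k - l, U)%N; rewrite ?inE ?eqxx.
have xUB : x \notin U `|` B by rewrite inE negb_or xU xB.
rewrite -fsetUA in pL; have [q qL h] := IH _ xUB xL pL.
by exists q => //; rewrite inE qL orbT.
Qed.

Lemma level_constraints_full k x U L : x \notin U -> x \notin under L ->
  exists2 q, q \in level_constraints k U L & (k <= q.1)%N /\ x \notin q.2.
Proof.
elim: L U => [|[B l] L IH] U xU /=.
  by move=> _; exists (k - 0, U)%N; rewrite ?inE // subn0.
rewrite inE negb_or => /andP [xB xL].
have xUB : x \notin U `|` B by rewrite inE negb_or xU xB.
have [q qL h] := IH _ xUB xL.
by exists q => //; rewrite inE qL orbT.
Qed.

Lemma partition_constraints_steady k st : (#|` st.1| + lab st.2 = k)%N ->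
  partition_constraints k st = level_constraints k st.1 st.2.
Proof.
move=> e; rewrite /partition_constraints; case: ifP => // /andP [/eqP L0].
by rewrite -e L0 /= addn0 ltnn.
Qed.

Lemma partition_occurrences k s : (0 < k)%N ->
  (occurrences (fun s => partition_new k (partition_state k s)) s <= optn k s)%N.
Proof.
move=> k0; apply: (occurrences_le_optn
  (W := fun s => partition_constraints k (partition_state k s)) k0).
- move=> p; rewrite /partition_constraints -[(_ [::]).1]/(fset0 : cache).
  by rewrite -[(_ [::]).2]/[::] eqxx cardfs0 k0 /= inE => /eqP ->.
- move=> {}s x p; rewrite partition_state_rcons.
  have vst := partition_state_valid s k0; move: (partition_state k s) vst => st vst.
  have := partition_step_valid x k0 vst.
  case: (partition_stepP x vst) => [xt|xt xL lk l0|xt e tk|xt xL lk] vst'.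
  + by move=> pW; apply: Or32; split=> //; exists p.
  + rewrite !partition_constraints_steady //=; last first.
      by rewrite lab_collapse lab_extract cardfsU1 xt; move: lk l0; clear; clia.
    by move=> /level_constraints_collapse; exact: level_constraints_extract.
  + rewrite {2}/partition_constraints e eqxx tk /= => pW.
    apply: Or33; exists (#|` st.1|, st.1); first by rewrite inE.
    move: pW; rewrite /partition_constraints /= cardfsU1 xt add1n.
    case: ltnP => tk'; rewrite inE => /eqP -> /=; first by split; rewrite ?add1n.
    by split=> //; move: tk'; clear; clia.
  + rewrite !partition_constraints_steady //; last first.
      by rewrite lab_collapse cardfs1 /= add1n prednK.
    move=> /level_constraints_collapse /=; rewrite inE => /predU1P [->|pL].
      by apply: Or31; split; rewrite /= ?inE //; move: k0; clear; clia.
    by have [q qL h] := level_constraints_new xt xL pL; apply: Or33; exists q.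
- move=> {}s x /and3P [xt xL /eqP lk].
  rewrite partition_constraints_steady //; exact: level_constraints_full.
Qed.

Lemma absent_law k (law : seq item -> cache -> R) (Q : randalg R) s x d : fdist d ->
  (forall C, law s C = fmean d (fun X => (C == X)%:R)) -> lazy_with_law k law Q ->
  absent Q s x = fmean d (fun C => (x \notin C)%:R).
Proof.
move=> dd lawE [_ _ lQ]; rewrite /absent.
rewrite (@law_prob R Q s d (fun C => x \notin C) dd) // => C.
by rewrite lQ lawE.
Qed.

Lemma partition_ratio_le k (Q : randalg R) eps : (0 < k)%N -> is_partition k Q ->
  (rand_ratio k eps Q <= (harm R k)%:E)%E.
Proof.
move=> k0 pQ; have [oQ lQ _] := pQ.
apply: (@potential_ratio R k Q eps (fun=> fun s => partition_potential k (partition_state k s))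
  (fun s => partition_new k (partition_state k s)) _ _ k0 oQ lQ _ _ (fun=> lexx _)) => //.
- by apply: le_trans ler01 _; case: k k0 {pQ oQ lQ} => // k _; exact: harm_ge1.
- by move=> _ s; rewrite addr_ge0 // level_potential_ge0.
- by move=> s; exact: partition_occurrences.
move=> _ s x _; rewrite partition_state_rcons; have vst := partition_state_valid s k0.
rewrite (absent_law x (fdist_partition_dist vst) (fun C => partition_lawE s C k0) pQ).
exact: partition_potential_step.
Qed.

End Partition.

(** * Equitable *)

Section Matroids.
Local Open Scope fset_scope.
Local Open Scope nat_scope.
Implicit Types (I : cache -> bool) (x y z w : item) (A B X : cache) (t : seq item).

Definition matroid I :=
  [/\ I fset0, (forall A B, A `<=` B -> I B -> I A) &
      forall A B, I A -> I B -> #|` A| < #|` B| ->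
        exists2 y, y \in B `\` A & I (y |` A)].

(* Contracting a loop does nothing, which makes contractions commute. *)
Definition contract I x X := if I [fset x] then (x \notin X) && I (x |` X) else I X.

Lemma contract_loop I x : ~~ I [fset x] -> contract I x = I.
Proof. by move=> /negPf xI; apply/funext => X; rewrite /contract xI. Qed.

Lemma contract_self I x : ~~ contract I x [fset x].
Proof. by rewrite /contract; case: ifPn => //; rewrite inE eqxx. Qed.

Lemma matroid_contract I x : matroid I -> matroid (contract I x).
Proof.
move=> mI; have [I0 Isub Iex] := mI; have [xI|xI] := boolP (I [fset x]); last first.
  by rewrite contract_loop.
rewrite /contract xI; split=> [|A B AB|A B].
- by rewrite inE /= fsetU0.
- move=> /andP [xB IB]; rewrite (Isub _ _ _ IB) ?fsetUS // andbT.
  by apply: contraNN xB; exact: (fsubsetP AB).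
- move=> /andP [xA IA] /andP [xB IB] AB.
  have [|y] := Iex _ _ IA IB; first by rewrite !cardfsU1 xA xB.
  rewrite !inE negb_or => /andP [/andP [yx yA] /orP [/eqP e|yB]].
    by rewrite e eqxx in yx.
  move=> Iy; exists y; first by rewrite !inE yA.
  by rewrite !inE negb_or eq_sym yx xA fsetUCA.
Qed.

Lemma contract_loop_loop I x z : matroid I -> ~~ I [fset z] -> ~~ contract I x [fset z].
Proof.
move=> [_ Isub _] zI; rewrite /contract; case: ifP => // _.
apply: contraNN zI => /andP [_]; apply: Isub.
by rewrite fsub1set !inE eqxx orbT.
Qed.

(* The exchange axiom extends [z] to a subset of [z |` X] as large as [x |` X]. *)
Lemma parallel_swap I x z X : matroid I -> I [fset z] -> ~~ I [fset x; z] ->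
  x \notin X -> I (x |` X) -> (z \notin X) && I (z |` X).
Proof.
move=> [I0 Isub Iex] zI xzI xX IxX.
have zX : z \notin X.
  apply: contraNN xzI => zX; apply: Isub IxX.
  by apply/fsubsetP => y; rewrite !inE => /orP [->//|/eqP ->]; rewrite zX orbT.
rewrite zX /=; suff H n : n <= #|` X| -> exists A,
    [/\ z \in A, A `<=` z |` X, I A & #|` A| = n.+1].
  have [A [_ AX IA cA]] := H _ (leqnn _); suff <- : A = z |` X by [].
  by apply/eqP; rewrite eqEfcard AX cardfsU1 zX cA add1n leqnn.
elim: n => [_|n IH nX].
  by exists [fset z]; rewrite inE eqxx fsub1set !inE eqxx cardfs1.
have [A [zA AX IA cA]] := IH (ltnW nX).
have [|y yB Iy] := Iex _ _ IA IxX; first by rewrite cA cardfsU1 xX.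
move: yB; rewrite !inE => /andP [yA /predU1P [yx|yX]].
  case/negP: xzI; apply: Isub Iy; rewrite yx.
  by apply/fsubsetP => w; rewrite !inE => /orP [->//|/eqP ->]; rewrite zA orbT.
exists (y |` A); split=> //; first by rewrite !inE zA orbT.
  by rewrite fsubUset AX andbT fsub1set !inE yX orbT.
by rewrite cardfsU1 yA cA.
Qed.

(** If [x] and [z] are not loops but are dependent together, contracting one of them makes the other
    a loop, and the two contractions coincide by [parallel_swap]. *)
Lemma contractC I x z : matroid I -> contract (contract I x) z = contract (contract I z) x.
Proof.
move=> mI; have [xI|xI] := boolP (I [fset x]); last first.
  by rewrite (contract_loop xI) [RHS]contract_loop //; exact: contract_loop_loop.
have [zI|zI] := boolP (I [fset z]); last first.
  by rewrite (contract_loop zI) [LHS]contract_loop //; exact: contract_loop_loop.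
case: (eqVneq x z) => [->//|xz].
have xzC : [fset z; x] = [fset x; z] by rewrite fsetUC.
have nx : x \notin [fset z] by rewrite inE.
have nz : z \notin [fset x] by rewrite inE eq_sym.
apply/funext => X; rewrite /contract xI zI nx nz /= xzC; case: ifP => xzI.
  rewrite !in_fsetU (negPf nx) (negPf nz) /= fsetUCA.
  by case: (x \in X) => //=; rewrite ?andbF.
apply/idP/idP => /andP [h1 h2]; apply: (parallel_swap mI _ _ h1 h2) => //.
  by rewrite xzI.
by rewrite xzC xzI.
Qed.

(** The greedy basis for the order [t]: passing to the contraction replaces the test against the
    items accepted so far. *)
Fixpoint greedy I t : cache :=
  if t is z :: t' then
    (if I [fset z] then [fset z] else fset0) `|` greedy (contract I z) t'
  else fset0.

Lemma mem_greedy I t y : matroid I -> y \in greedy I t -> I [fset y] /\ y \in t.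
Proof.
elim: t I => [|z t IH] I mI //=; rewrite inE => /orP [].
  by case: ifP => // zI; rewrite inE => /eqP ->; rewrite inE eqxx.
move=> /IH [|yI yt]; first exact: matroid_contract.
by rewrite inE yt orbT; split=> //; apply: contraTT yI; exact: contract_loop_loop.
Qed.

Lemma loop_notin_greedy I t x : matroid I -> ~~ I [fset x] -> x \notin greedy I t.
Proof. by move=> mI; apply: contraNN => /(mem_greedy mI) []. Qed.

Lemma greedy_indep I t : matroid I -> I (greedy I t).
Proof.
elim: t I => [|z t IH] I mI /=; first by case: mI.
have := IH _ (matroid_contract z mI); rewrite {1}/contract; case: ifP => zI //.
  by move=> /andP [].
by rewrite fset0U.
Qed.

(** Until [x] comes up in the order or becomes a loop, both runs take the same decisions. The
    accepted item that makes [x] a loop is refused in the contraction, and from there on the two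
    matroids agree. This item is the one evicted for [x]. *)
Lemma greedy_contract I x t : matroid I -> I [fset x] -> x \in t ->
  exists2 y, y \in greedy I t &
    greedy (contract I x) t = greedy I t `\ y /\ (x \in greedy I t -> y = x).
Proof.
elim: t I => [|z t IH] I mI xI //=; rewrite inE.
have [<- _|xz /= xt] := eqVneq x z.
  exists x; first by rewrite xI !inE eqxx.
  rewrite xI (negPf (contract_self _ _)) fset0U (contract_loop (contract_self I x)) fsetU1K //.
  by apply: loop_notin_greedy; [exact: matroid_contract | exact: contract_self].
have [zI|zI] := boolP (I [fset z]); last first.
  rewrite (negPf (contract_loop_loop x mI zI)) !fset0U contractC // (contract_loop zI).
  exact: IH.
have nz : x \notin [fset z] by rewrite inE.
have -> : contract I x [fset z] = I [fset x; z] by rewrite /contract xI nz.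
case: ifPn => xzI; rewrite contractC //.
  have xz' : contract I z [fset x] by rewrite /contract zI inE eq_sym xz fsetUC.
  have [y yg [e xy]] := IH _ (matroid_contract z mI) xz' xt.
  exists y; first by rewrite !inE yg orbT.
  rewrite e !inE (negPf xz) /=; split=> //.
  apply/fsetP => w; rewrite !inE; case: (eqVneq w z) => //= ->.
  have : z \notin greedy (contract I z) t.
    by apply: loop_notin_greedy; [exact: matroid_contract | exact: contract_self].
  by move=> zg; rewrite andbT; apply/esym; apply: contraNneq zg => zy; rewrite [X in X \in _]zy.
have xz' : ~~ contract I z [fset x] by rewrite /contract zI inE eq_sym xz fsetUC.
exists z; first by rewrite !inE eqxx.
rewrite fset0U (contract_loop xz') fsetU1K; last first.
  by apply: loop_notin_greedy; [exact: matroid_contract | exact: contract_self].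
split=> //; rewrite !inE (negPf xz) /= => xg.
by move: (loop_notin_greedy t (matroid_contract z mI) xz'); rewrite xg.
Qed.

Lemma greedy_maximal I t y : matroid I -> y \in t -> y \notin greedy I t ->
  ~~ I (y |` greedy I t).
Proof.
elim: t I => [|z t IH] I mI //=; rewrite inE.
have [_ Isub _] := mI.
have [-> _|yz /= yt] := eqVneq y z.
  case: ifP => zI; first by rewrite !inE eqxx.
  by move=> _; apply: contraFN zI; apply: Isub; rewrite fsub1set !inE eqxx.
rewrite inE negb_or => /andP [_ yg]; have := IH _ (matroid_contract z mI) yt yg.
have zg : z \notin greedy (contract I z) t.
  by apply: loop_notin_greedy; [exact: matroid_contract | exact: contract_self].
rewrite {1}/contract; case: ifP => zI; last by rewrite fset0U.
by rewrite !inE negb_or eq_sym yz zg /= fsetUCA.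
Qed.

Lemma card_greedy I t B : matroid I -> I B -> {subset B <= t} ->
  #|` B| <= #|` greedy I t|.
Proof.
move=> mI IB Bt; rewrite leqNgt; apply/negP => lt; have [_ _ Iex] := mI.
have [y] := Iex _ _ (greedy_indep t mI) IB lt; rewrite inE => /andP [yg yB].
by apply/negP; apply: greedy_maximal => //; exact: Bt.
Qed.

(** The matroid with [x] made a coloop: the item just requested belongs to every admissible
    cache. *)
Definition coloop x I X := I (X `\ x).

Lemma coloopE x I y : I fset0 -> coloop x I [fset y] = (y == x) || I [fset y].
Proof.
move=> I0; rewrite /coloop; case: eqVneq => [->|yx]; first by rewrite fsetDv.
by rewrite mem_fsetD1 // inE eq_sym.
Qed.

Lemma contract_coloop_self I x : matroid I -> ~~ I [fset x] -> contract (coloop x I) x = I.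
Proof.
move=> [I0 Isub _] xI; apply/funext => X; rewrite /contract coloopE // eqxx /=.
rewrite /coloop; case: (boolP (x \in X)) => xX /=; last by rewrite fsetU1K.
by apply/esym; apply: contraNF xI; apply: Isub; rewrite fsub1set.
Qed.

Lemma contract_coloop I x y : matroid I -> x != y ->
  contract (coloop x I) y = coloop x (contract I y).
Proof.
move=> [I0 _ _] xy; apply/funext => X.
rewrite /contract coloopE // eq_sym (negPf xy) /=; rewrite /coloop; case: ifP => // yI.
by rewrite !inE eq_sym xy /= fsetDUl [[fset y] `\ x]mem_fsetD1 // inE.
Qed.

Lemma greedy_coloop I x t : matroid I -> ~~ I [fset x] -> x \in t ->
  greedy (coloop x I) t = x |` greedy I t.
Proof.
elim: t I => [|z t IH] I mI xI //=; have [I0 _ _] := mI; rewrite inE.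
have [<- _|xz /= xt] := eqVneq x z.
  by rewrite coloopE // eqxx contract_coloop_self // (negPf xI) fset0U contract_loop.
have zx : (z == x) = false by rewrite eq_sym; exact: negPf.
rewrite coloopE // zx /= contract_coloop // IH; first exact: fsetUCA.
- exact: matroid_contract.
- exact: contract_loop_loop.
- by [].
Qed.

Definition trunc r I X := I X && (#|` X| <= r).

Lemma matroid_trunc r I : matroid I -> matroid (trunc r I).
Proof.
move=> [I0 Isub Iex]; split=> [|A B AB|A B].
- by rewrite /trunc I0 cardfs0.
- by move=> /andP [IB Br]; rewrite /trunc (Isub _ _ AB) // (leq_trans (fsubset_leq_card AB)).
- move=> /andP [IA Ar] /andP [IB Br] AB; have [y yB Iy] := Iex _ _ IA IB AB.
  exists y => //; rewrite /trunc Iy (leq_trans _ Br) //.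
  by move: yB; rewrite cardfsU1 inE => /andP [-> _].
Qed.

Lemma contract_trunc r I x : contract (trunc r.+1 I) x =
  if I [fset x] then trunc r (contract I x) else trunc r.+1 I.
Proof.
apply/funext => X; rewrite /contract /trunc cardfs1 andbT; case: ifP => // xI.
by rewrite cardfsU1; case: (boolP (x \in X)) => //= _; rewrite add1n ltnS.
Qed.

(** The truncated run accepts the same items as the full one until it has [r] of them, so it loses
    at most the last of [r.+1]. *)
Lemma greedy_trunc r I t : matroid I -> (forall X, I X -> #|` X| <= r.+1) ->
  (exists2 y, y \in greedy I t & greedy (trunc r I) t = greedy I t `\ y) \/
  greedy (trunc r I) t = greedy I t /\ #|` greedy I t| <= r.
Proof.
elim: t r I => [|z t IH] r I mI le_r; first by right; rewrite [greedy I _]/= cardfs0.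
rewrite /=.
have [zI|zI] := boolP (I [fset z]); last first.
  have nz : ~~ trunc r I [fset z] by rewrite /trunc (negPf zI).
  by rewrite (negPf nz) !fset0U !contract_loop //; exact: IH.
case: r le_r => [|r] le_r.
  have loops y : ~~ trunc 0 I [fset y] by rewrite /trunc cardfs1 andbF.
  left; exists z; first by rewrite !inE eqxx.
  rewrite (negPf (loops z)) fset0U contract_loop // (_ : greedy _ _ = fset0); last first.
    apply/eqP; rewrite -fsubset0; apply/fsubsetP => y.
    by rewrite (negPf (loop_notin_greedy t (matroid_trunc 0 mI) (loops y))).
  apply/esym/eqP; rewrite -cardfs_eq0; have := le_r _ (greedy_indep (z :: t) mI).
  by rewrite /= zI (cardfsD1 z) !inE eqxx /=; case: #|` _|.
have zT : trunc r.+1 I [fset z] by rewrite /trunc zI cardfs1.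
have zg : z \notin greedy (contract I z) t.
  by apply: loop_notin_greedy; [exact: matroid_contract | exact: contract_self].
rewrite zT contract_trunc zI.
have [|[y yg ->]|[-> gr]] := IH r _ (matroid_contract z mI).
- move=> X; rewrite /contract zI => /andP [zX /le_r].
  by rewrite cardfsU1 zX add1n ltnS.
- left; exists y; first by rewrite !inE yg orbT.
  apply/fsetP => w; rewrite !inE; case: (eqVneq w z) => //= ->.
  by rewrite andbT; apply/esym; apply: contraNneq zg => e; rewrite [X in X \in _]e.
- by right; rewrite cardfsU1 zg add1n.
Qed.

End Matroids.

(** * Greedy bases for random orders and their fault probabilities *)

Section Shuffles.
Context {R : realType}.
Local Open Scope fset_scope.
Local Open Scope ring_scope.
Implicit Types (I : cache -> bool) (x y z w : item) (A B S X : cache) (t : seq item).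

Fixpoint shuffle (n : nat) S : seq (R * seq item) :=
  if n is m.+1 then
    fbind (funif (enum_fset S))
      (fun z => [seq (p.1, z :: p.2) | p <- shuffle m (S `\ z)])
  else fpoint [::].

Lemma card_remove S z n : #|` S| = n.+1 -> z \in S -> #|` S `\ z| = n.
Proof. by move=> Sn zS; have := cardfsD1 z S; rewrite zS Sn => -[]. Qed.

Lemma fdist_shuffle n S : #|` S| = n -> fdist (shuffle n S).
Proof.
elim: n S => [|n IH] S Sn; first exact: fdist_point.
apply: fdist_bind => [|p /mem_funif pS]; last by apply/fdist_map/IH/card_remove.
by apply: fdist_unif; rewrite -size_eq0 -[size _]/(#|` S|) Sn.
Qed.

Lemma mem_shuffle n S p x : #|` S| = n -> p \in shuffle n S -> (x \in p.2) = (x \in S).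
Proof.
elim: n S p => [|n IH] S p Sn /=.
  by rewrite inE => /eqP ->; rewrite (cardfs0_eq Sn) !inE.
move=> /mem_fbind [z [q [/mem_funif zS /mapP [r rS ->] ->]]] /=.
rewrite inE (IH _ _ (card_remove Sn zS) rS) !inE.
by case: eqVneq => // ->; rewrite [_ \in S]zS.
Qed.

Definition greedy_mean S I (f : cache -> R) : R :=
  fmean (shuffle #|` S| S) (fun t => f (greedy I t)).

Lemma eq_greedy_mean S I f g : (forall t, S =i t -> f (greedy I t) = g (greedy I t)) ->
  greedy_mean S I f = greedy_mean S I g.
Proof.
move=> fg; apply: eq_fmean_in => p pS; apply: fg => x.
by rewrite (mem_shuffle x erefl pS).
Qed.

Lemma greedy_mean_le S I f g : (forall t, S =i t -> f (greedy I t) <= g (greedy I t)) ->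
  greedy_mean S I f <= greedy_mean S I g.
Proof.
move=> fg; apply: fmean_le => p pS; first by case: (fdist_shuffle (erefl #|` S|)) => + _; apply.
by apply: fg => x; rewrite (mem_shuffle x erefl pS).
Qed.

Lemma greedy_mean_cst S I c : greedy_mean S I (fun=> c) = c.
Proof. exact/fmean_cst/fdist_shuffle. Qed.

Lemma greedy_mean_rec S I f : #|` S|%:R * greedy_mean S I f = \sum_(z <- enum_fset S)
  greedy_mean (S `\ z) (contract I z) (fun X => f ((if I [fset z] then [fset z] else fset0) `|` X)).
Proof.
rewrite /greedy_mean; case E : #|` S| => [|n].
  by rewrite (cardfs0_eq E) big_seq_fset0 mul0r.
rewrite /= fmean_bind fmean_unif /unif -[size _]/(#|` S|) E mulrC divfK ?pnatr_eq0 //.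
apply: eq_big_seq => z zS; rewrite (fmean_map (cons z)) (card_remove E) //.
Qed.

(** A greedy run skips loops, and a uniformly random order remains uniform when an item is removed
    from it. *)
Lemma greedy_mean_loop S I z f : matroid I -> ~~ I [fset z] -> z \in S ->
  greedy_mean S I f = greedy_mean (S `\ z) I f.
Proof.
elim/ltn_ind: {S}#|` S| {-2}S (erefl #|` S|) I f => n IH S Sn I f mI zI zS.
have n0 : (0 < n)%N by rewrite -Sn cardfs_gt0; apply/fset0Pn; exists z.
have cS : #|` S `\ z| = n.-1 by apply: card_remove => //; rewrite prednK.
have cSR : n%:R = (n.-1)%:R + 1 :> R by rewrite natr1 prednK.
apply: (@mulfI _ n%:R); first by rewrite pnatr_eq0 -lt0n.
rewrite -{1}Sn greedy_mean_rec (big_fsetD1 z) //= (negPf zI) (contract_loop zI).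
have -> : greedy_mean (S `\ z) I (fun X => f (fset0 `|` X)) = greedy_mean (S `\ z) I f.
  by apply: eq_greedy_mean => t _; rewrite fset0U.
rewrite cSR mulrDl mul1r addrC; congr (_ + _); rewrite -cS greedy_mean_rec.
apply: eq_big_seq => w; rewrite -[_ \in _]/(w \in S `\ z) !inE => /andP [wz wS].
have -> : (S `\ z) `\ w = (S `\ w) `\ z by rewrite !fsetDDl fsetUC.
apply: (IH n.-1); rewrite ?prednK //.
- by apply: card_remove => //; rewrite prednK.
- exact: matroid_contract.
- exact: contract_loop_loop.
- by rewrite !inE eq_sym wz.
Qed.

Definition greedy_prob S I x : R := greedy_mean S I (fun X => (x \in X)%:R).

Lemma greedy_prob_loop S I x : matroid I -> ~~ I [fset x] -> greedy_prob S I x = 0.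
Proof.
move=> mI xI; rewrite -[RHS](greedy_mean_cst S I 0); apply: eq_greedy_mean => t _.
by rewrite (negPf (loop_notin_greedy t mI xI)).
Qed.

Lemma greedy_prob_le S I x : matroid I -> greedy_prob S I x <= (I [fset x])%:R.
Proof.
move=> mI; rewrite -[leRHS](greedy_mean_cst S I); apply: greedy_mean_le => t _; rewrite ler_nat.
by case: (boolP (x \in _)) => // /(mem_greedy mI) [->].
Qed.

Lemma greedy_prob_rec S I x : matroid I -> x \in S -> #|` S|%:R * greedy_prob S I x =
  (I [fset x])%:R + \sum_(z <- enum_fset (S `\ x)) greedy_prob (S `\ z) (contract I z) x.
Proof.
move=> mI xS; rewrite /greedy_prob greedy_mean_rec (big_fsetD1 x) //=; congr (_ + _).
  rewrite -[RHS](greedy_mean_cst (S `\ x) (contract I x)).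
  apply: eq_greedy_mean => t _; rewrite inE.
  rewrite (negPf (loop_notin_greedy t (matroid_contract x mI) (contract_self I x))) orbF.
  by case: ifP; rewrite inE ?eqxx.
apply: eq_big_seq => z; rewrite -[_ \in _]/(z \in S `\ x) !inE => /andP [zx _].
apply: eq_greedy_mean => t _; rewrite inE; case: ifP => _; rewrite inE //.
by rewrite eq_sym (negPf zx).
Qed.

(** Induction on the size of [S], by conditioning on the first item of the order. If it is [x] or
    [z], the contributions are symmetric in the two items; if it is another item [v], the identity
    is that for the contraction by [v]. *)
Lemma greedy_prob_contractC S I x z : matroid I -> x \in S -> z \in S ->
  greedy_prob S I x + greedy_prob S (contract I x) z =
  greedy_prob S I z + greedy_prob S (contract I z) x.
Proof.
elim/ltn_ind: {S}#|` S| {-2}S (erefl #|` S|) I => n IH S Sn I mI xS zS.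
case: (eqVneq x z) => [->//|xz].
have [xI|xI] := boolP (I [fset x]); last first.
  rewrite (contract_loop xI) (greedy_prob_loop S mI xI) add0r.
  by rewrite (greedy_prob_loop S (matroid_contract z mI) (contract_loop_loop z mI xI)) addr0.
have [zI|zI] := boolP (I [fset z]); last first.
  rewrite (contract_loop zI) (greedy_prob_loop S mI zI) add0r.
  by rewrite (greedy_prob_loop S (matroid_contract x mI) (contract_loop_loop x mI zI)) addr0.
have n0 : (0 < n)%N by rewrite -Sn cardfs_gt0; apply/fset0Pn; exists z.
have cSR : n%:R = (n.-1)%:R + 1 :> R by rewrite natr1 prednK.
pose rest := S `\ x `\ z.
have loopE y w : y \in S -> w \in S -> w != y ->
    greedy_prob S (contract I y) w = greedy_prob (S `\ y) (contract I y) w.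
  move=> yS wS _; apply: greedy_mean_loop => //; first exact: matroid_contract.
  exact: contract_self.
(* Multiplied by [n], one side of the identity becomes symmetric in [y] and [w] up to the last sum.
   A contracted item is a loop and can be removed from the order, which yields a second conditioning
   on [n.-1] items. *)
have half y w : y \in S -> w \in S -> w != y -> rest = S `\ y `\ w -> I [fset y] ->
    n%:R * (greedy_prob S I y + greedy_prob S (contract I y) w) =
    1 + (contract I y [fset w])%:R + greedy_prob S (contract I w) y +
    greedy_prob S (contract I y) w + \sum_(v <- enum_fset rest)
      (greedy_prob (S `\ v) (contract I v) y +
       greedy_prob (S `\ v) (contract (contract I v) y) w).
  move=> yS wS wy eR yI; rewrite mulrDr -{1}Sn greedy_prob_rec // yI.
  have wSy : w \in S `\ y by rewrite !inE wy.
  rewrite (big_fsetD1 w) //= -eR big_split /= -(loopE w y) //; last by rewrite eq_sym.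
  rewrite cSR mulrDl mul1r {1}(loopE y w) //.
  have cSy : #|` S `\ y| = n.-1 by apply: card_remove => //; rewrite prednK.
  rewrite -cSy greedy_prob_rec //; last exact: matroid_contract.
  rewrite -eR [X in _ = _ + (_ + X)](_ : _ = \sum_(v <- enum_fset rest)
    greedy_prob (S `\ y `\ v) (contract (contract I y) v) w); first by ring.
  apply: eq_big_seq => v; rewrite -[_ \in _]/(v \in rest) eR !inE => /and3P [vw vy vS].
  rewrite contractC // (_ : S `\ y `\ v = S `\ v `\ y); last by rewrite !fsetDDl fsetUC.
  apply: greedy_mean_loop; [by do 2!apply: matroid_contract | |].
    exact: contract_loop_loop (matroid_contract y mI) (contract_self I y).
  by rewrite !inE eq_sym vy.
apply: (@mulfI _ n%:R); first by rewrite pnatr_eq0 -lt0n.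
rewrite (half x z) ?(half z x) // 1?eq_sym //; last by rewrite /rest !fsetDDl fsetUC.
have -> : contract I x [fset z] = contract I z [fset x].
  by rewrite /contract xI zI !inE xz eq_sym xz fsetUC.
rewrite (eq_big_seq (fun v => greedy_prob (S `\ v) (contract I v) z +
    greedy_prob (S `\ v) (contract (contract I v) z) x)).
  by congr (_ + _); rewrite addrAC.
move=> v; rewrite -[_ \in _]/(v \in rest) !inE => /and3P [vz vx vS].
apply: (IH n.-1); rewrite ?prednK //.
- by apply: card_remove => //; rewrite prednK.
- exact: matroid_contract.
- by rewrite !inE eq_sym vx.
- by rewrite !inE eq_sym vz.
Qed.

(* A loop counts for [0]: it is never requested. *)
Definition fault S I x : R := (I [fset x])%:R - greedy_prob S I x.

(* By [greedy_prob_contractC] the expected number of faults caused by requesting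
   the items of [t] in turn does not depend on their order. *)
Fixpoint psi S I t : R :=
  if t is z :: t' then fault S I z + psi S (contract I z) t' else 0.

Lemma fault_ge0 S I x : matroid I -> 0 <= fault S I x.
Proof. by move=> mI; rewrite subr_ge0 greedy_prob_le. Qed.

Lemma fault_loop S I x : matroid I -> ~~ I [fset x] -> fault S I x = 0.
Proof. by move=> mI xI; rewrite /fault greedy_prob_loop // (negPf xI) subrr. Qed.

Lemma psi_ge0 S I t : matroid I -> 0 <= psi S I t.
Proof.
elim: t I => [//|z t IH] I mI /=.
by rewrite addr_ge0 ?fault_ge0 // IH //; exact: matroid_contract.
Qed.

(** [x] moves to the front of [t] by successive exchanges; at its old place it has already been
    contracted and, being a loop, contributes 0. *)
Lemma psi_contract S I t x : matroid I -> {subset t <= S} -> x \in t ->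
  psi S I t = fault S I x + psi S (contract I x) t.
Proof.
elim: t I => [//|z t IH] I mI tS; rewrite inE /=.
have tS' : {subset t <= S} by move=> w wt; apply: tS; rewrite inE wt orbT.
have [->|xz /= xt] := eqVneq x z.
  have zl := contract_self I z.
  by rewrite (fault_loop _ (matroid_contract z mI) zl) add0r (contract_loop zl).
rewrite IH //; last exact: matroid_contract.
rewrite (contractC x z mI) !addrA; congr (_ + _).
have := greedy_prob_contractC mI (tS _ (mem_head z t)) (tS' _ xt).
rewrite /fault; suff : ((I [fset z])%:R + (contract I z [fset x])%:R =
    (I [fset x])%:R + (contract I x [fset z])%:R :> R) by lra.
have [xI|xI] := boolP (I [fset x]); last first.
  by rewrite (contract_loop xI) (negPf (contract_loop_loop _ mI xI)) addrC.
have [zI|zI] := boolP (I [fset z]); last first.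
  by rewrite (contract_loop zI) (negPf (contract_loop_loop _ mI zI)) xI addrC.
by rewrite /contract xI zI !inE (eq_sym z) xz fsetUC.
Qed.

Lemma psi_loops S I t : matroid I -> (forall z, ~~ I [fset z]) -> psi S I t = 0.
Proof.
by move=> mI nI; elim: t => //= z t IH; rewrite contract_loop // IH fault_loop // addr0.
Qed.

Lemma greedy_prob_coloop S I x z : matroid I -> ~~ I [fset x] -> x \in S ->
  greedy_prob S (coloop x I) z = (z == x)%:R + greedy_prob S I z.
Proof.
move=> mI xI xS; rewrite -[X in X + _](greedy_mean_cst S I) /greedy_prob /greedy_mean -fmeanD.
apply: eq_fmean_in => p pS; rewrite greedy_coloop //; last by rewrite (mem_shuffle x erefl pS).
rewrite !inE; case: eqVneq => [->|_]; last by rewrite add0r.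
by rewrite (negPf (loop_notin_greedy _ mI xI)) addr0.
Qed.

(** A coloop is always in the greedy basis and never causes a fault. *)
Lemma psi_coloop S I x t : matroid I -> ~~ I [fset x] -> x \in S ->
  psi S (coloop x I) t = psi S I t.
Proof.
elim: t I => [//|z t IH] I mI xI xS /=; have [I0 _ _] := mI.
have e : fault S (coloop x I) z = fault S I z.
  rewrite /fault greedy_prob_coloop // coloopE //; case: eqVneq => [->|_]; last by rewrite add0r.
  by rewrite greedy_prob_loop // (negPf xI) /= addr0 !subrr.
rewrite e; congr (_ + _); case: (eqVneq x z) => [<-|xz].
  by rewrite contract_coloop_self // contract_loop.
by rewrite contract_coloop // IH //; [exact: matroid_contract | exact: contract_loop_loop].
Qed.

(** By the invariance of [psi] under reordering, a cleverly chosen item of the basis [B] may be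
    requested first. Its fault probability rises by at most [1 / #|B|] under truncation, and
    contracting it lowers both ranks by one. Summed over the ranks this gives
    [1 / (r + 1) + ... + 1 / 2]. *)
Lemma psi_trunc S I t r B : matroid I -> S =i t ->
  (forall X, I X -> (#|` X| <= r.+1)%N) -> I B -> #|` B| = r.+1 -> B `<=` S ->
  psi S (trunc r I) t <= psi S I t + harm R r.+1 - 1.
Proof.
move=> + St; have tS : {subset t <= S} by move=> w; rewrite St.
elim: r I B => [|r IH] I B mI le_r IB cB BS.
  rewrite psi_loops; first by rewrite /harm big_nat1 invr1 addrK psi_ge0.
    exact: matroid_trunc.
  by move=> z; rewrite /trunc cardfs1 andbF.
have mT := matroid_trunc r.+1 mI.
(* Truncation removes at most one item from a greedy basis, so over the [r.+2] items of [B] the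
   probabilities of presence fall by at most 1 in total, and some item loses at most the average. *)
have [x xB xle] : exists2 x, x \in B &
    greedy_prob S I x <= greedy_prob S (trunc r.+1 I) x + r.+2%:R^-1.
  apply: contrapT => nex.
  have : \sum_(x <- enum_fset B) greedy_prob S I x <=
      \sum_(x <- enum_fset B) greedy_prob S (trunc r.+1 I) x + 1.
    rewrite /greedy_prob /greedy_mean -!fmean_sum.
    rewrite -[X in _ + X](fmean_cst 1 (fdist_shuffle (erefl #|` S|))).
    rewrite -fmeanD; apply: fmean_le => p pS.
      by case: (fdist_shuffle (erefl #|` S|)) => + _; apply.
    have [[y yg ->]|[-> _]] := greedy_trunc p.2 mI le_r; last by rewrite lerDl.
    apply: le_trans (_ : \sum_(x <- enum_fset B) ((x \in greedy I p.2 `\ y)%:R +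
        (x == y)%:R) <= _).
      apply: ler_sum => x _; rewrite -natrD ler_nat !inE.
      by case: (x == y); case: (x \in _).
    rewrite big_split lerD2l /=; have [yB|yB] := boolP (y \in B).
      rewrite (big_fsetD1 y) //= eqxx big_seq big1 ?addr0 // => z.
      by rewrite !inE => /andP [/negPf ->].
    rewrite big_seq big1 // => z zB; case: eqVneq => // e.
    by rewrite -e [_ \in _]zB in yB.
  apply/negP; rewrite -ltNge.
  have -> : 1 = \sum_(x <- enum_fset B) r.+2%:R^-1 :> R.
    rewrite big_const_seq count_predT iter_addr_0 -[size _]/(#|` B|) cB.
    by rewrite -[RHS]mulr_natl mulfV ?pnatr_eq0.
  rewrite -big_split /= big_seq [ltRHS]big_seq.
  have ne : B != fset0 by rewrite -cardfs_eq0 cB.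
  have [y yB] := fset0Pn _ ne.
  apply: ltr_sum; first by apply/hasP; exists y.
  by move=> x xB; rewrite ltNge; apply/negP => h; apply: nex; exists x.
have xI : I [fset x] by case: mI => _ Isub _; apply: Isub IB; rewrite fsub1set.
have xt : x \in t by rewrite -St (fsubsetP BS).
rewrite (psi_contract mT tS xt) (psi_contract mI tS xt) contract_trunc xI (harmS r.+1).
have : psi S (trunc r (contract I x)) t <= psi S (contract I x) t + harm R r.+1 - 1.
  apply: (IH _ (B `\ x)); first exact: matroid_contract.
  - by move=> X; rewrite /contract xI => /andP [xX /le_r]; rewrite cardfsU1 xX add1n ltnS.
  - by rewrite /contract xI !inE eqxx fsetD1K.
  - by apply: card_remove.
  - by apply: fsubset_trans BS; exact: fsubsetDl.
rewrite /fault xI (_ : trunc r.+1 I [fset x] = true); last by rewrite /trunc xI cardfs1.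
move: xle; move: (psi _ _ _) (psi _ (contract I x) _) (harm _ _) (_^-1) => a b c d.
move: (greedy_prob _ _ _) (greedy_prob _ _ _) => e f.
lra.
Qed.

End Shuffles.

(** * Layers as a laminar matroid *)

Section Layers.
Local Open Scope fset_scope.
Local Open Scope nat_scope.
Implicit Types (x y z : item) (A B X U : cache) (L : seq cache).

Lemma layers_cover_nil : layers_cover [::] = fset0.
Proof. by rewrite /layers_cover big_nil. Qed.

Lemma layers_cover_cons B L : layers_cover (B :: L) = B `|` layers_cover L.
Proof. by rewrite /layers_cover big_cons. Qed.

Lemma mem_layers_cover x L : (x \in layers_cover L) = has (fun B : cache => x \in B) L.
Proof.
by elim: L => [|B L IH]; rewrite ?layers_cover_nil // layers_cover_cons inE IH.
Qed.

Fixpoint layered L : bool :=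
  if L is B :: L' then
    [&& B != fset0, [disjoint B & layers_cover L']%fset & layered L']
  else true.

(** The complementary form of the condition on optimal caches: for a cache of [k] items, having at
    least [i] of them in the first [i] layers means having at most [k - i] in the later ones. Upper
    bounds pass to subsets and concern nested sets, so they define a matroid. *)
Fixpoint slack L X : bool :=
  if L is B :: L' then (#|` X `&` layers_cover L| <= size L) && slack L' X
  else true.

Definition layer_indep L X := (X `<=` layers_cover L) && slack L X.

(** The rest of the layer of [x] joins the next layer; if there is none it disappears, since its
    items become loops. *)
Fixpoint contract_layer L x : seq cache :=
  if L is B :: L' then
    if x \in B then merge_next (B `\ x) L' else B :: contract_layer L' x
  else [::].

Definition trunc_layers L := merge_next (head fset0 L) (behead L).

Lemma merge_next_cover B L : layers_cover (merge_next B L) `<=` B `|` layers_cover L.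
Proof.
case: L => [|B' L] /=; first by rewrite layers_cover_nil fsub0set.
by rewrite !layers_cover_cons fsetUA.
Qed.

Lemma contract_layer_cover x L : layered L ->
  layers_cover (contract_layer L x) `<=` layers_cover L `\ x.
Proof.
elim: L => [|B L IH] /=; first by rewrite !layers_cover_nil fsub0set.
move=> /and3P [_ dis wL]; rewrite layers_cover_cons; case: ifP => xB.
  apply: fsubset_trans (merge_next_cover _ _) _; rewrite fsetDUl.
  apply: fsetUS; rewrite [X in _ `<=` X]mem_fsetD1 //.
  by move/fdisjointP: dis; apply.
by rewrite layers_cover_cons fsetDUl [B `\ x]mem_fsetD1 ?xB // fsetUS // IH.
Qed.

Lemma trunc_layers_cover L : layers_cover (trunc_layers L) `<=` layers_cover L.
Proof.
case: L => [|B L]; first by rewrite layers_cover_nil fsub0set.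
by rewrite layers_cover_cons; exact: merge_next_cover.
Qed.

Lemma layered_merge B L : layered L -> [disjoint B & layers_cover L]%fset ->
  layered (merge_next B L).
Proof.
case: L => [//|B' L] /= /and3P [B'0 dis wL]; rewrite layers_cover_cons fdisjointXU.
move=> /andP [_ BL]; rewrite wL andbT fdisjointUX BL dis !andbT.
by apply: contraNneq B'0 => /eqP; rewrite fsetU_eq0 => /andP [].
Qed.

Lemma layered_contract x L : layered L -> layered (contract_layer L x).
Proof.
elim: L => [//|B L IH] /= /and3P [B0 dis wL]; case: ifP => xB.
  by apply: layered_merge => //; apply: fdisjointWl dis; exact: fsubsetDl.
rewrite /= B0 IH // andbT; apply: fdisjointWr dis.
by apply: fsubset_trans (contract_layer_cover x wL) _; exact: fsubsetDl.
Qed.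

Lemma layered_trunc L : layered L -> layered (trunc_layers L).
Proof. by case: L => [//|B L] /= /and3P [_ dis wL]; exact: layered_merge. Qed.

Lemma size_merge B L : size (merge_next B L) = size L.
Proof. by case: L. Qed.

Lemma size_contract_layer x L : x \in layers_cover L -> (size (contract_layer L x)).+1 = size L.
Proof.
elim: L => [|B L IH] /=; first by rewrite layers_cover_nil inE.
rewrite layers_cover_cons inE; case: ifP => xB /=; first by rewrite size_merge.
by move=> /IH ->.
Qed.

Lemma slack_cap L X U : layers_cover L `<=` U -> slack L (X `&` U) = slack L X.
Proof.
elim: L => [//|B L IH] h /=.
rewrite IH; last by apply: fsubset_trans h; rewrite layers_cover_cons fsubsetUr.
by rewrite -fsetIA (fsetIidPr h).
Qed.

Lemma slack_sub L A B : A `<=` B -> slack L B -> slack L A.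
Proof.
move=> AB; elim: L => [//|C L IH] /= /andP [h /IH ->]; rewrite andbT.
by apply: leq_trans h; apply: fsubset_leq_card; exact: fsetSI.
Qed.

(** For the exchange axiom, if [C] has more items than [A] below the first layer, the exchange takes
    place there by induction. Otherwise [C] has more items in the first layer alone, and any of them
    that is not in [A] affects only the bound on the total size. *)
Lemma matroid_layer_indep L : layered L -> matroid (layer_indep L).
Proof.
elim: L => [|B L IH].
  move=> _; split=> [|A C AC|A C].
  - by rewrite /layer_indep fsub0set.
  - by rewrite /layer_indep !andbT layers_cover_nil; exact: fsubset_trans.
  - rewrite /layer_indep layers_cover_nil !andbT !fsubset0 => /eqP -> /eqP ->.
    by rewrite cardfs0.
move=> wL; have /= /and3P [_ dis wL'] := wL; have [I0 Isub Iex] := IH wL'.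
have small X : layer_indep (B :: L) X -> #|` X| <= (size L).+1.
  by move=> /andP [sX /= /andP [+ _]]; rewrite (fsetIidPl sX).
split=> [|A C AC|A C IA IC AC].
- rewrite /layer_indep fsub0set /= fset0I cardfs0 /=.
  by case/andP: I0.
- rewrite /layer_indep => /andP [h1 h2]; rewrite (fsubset_trans AC h1) /=.
  exact: slack_sub h2.
have small_add y : y \in C `\` A -> #|` y |` A| <= (size L).+1.
  rewrite inE => /andP [yA _]; rewrite cardfsU1 yA add1n.
  exact: leq_trans AC (small _ IC).
have sA := IA; have sC := IC.
move: sA sC => /andP [sA /= /andP [_ kA]] /andP [sC /= /andP [_ kC]].
have cap X : slack L X -> layer_indep L (X `&` layers_cover L).
  by move=> kX; rewrite /layer_indep fsubsetIr slack_cap // kX.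
have [lt|ge] := ltnP #|` A `&` layers_cover L| #|` C `&` layers_cover L|.
  have [y] := Iex _ _ (cap _ kA) (cap _ kC) lt; rewrite !inE => /andP [+ /andP [yC yL]].
  rewrite yL andbT => yA /andP [_ kyA].
  have yCA : y \in C `\` A by rewrite inE yA.
  exists y => //; rewrite /layer_indep fsubUset sA fsub1set layers_cover_cons inE yL orbT /=.
  apply/andP; split.
    by apply: leq_trans (small_add _ yCA); apply: fsubset_leq_card; exact: fsubsetIl.
  move: kyA; rewrite -(slack_cap (y |` A) (fsubset_refl _)) fsetIUl.
  have -> // : [fset y] `&` layers_cover L = [fset y] by apply/fsetIidPl; rewrite fsub1set.
have : #|` A `\` layers_cover L| < #|` C `\` layers_cover L|.
  have := cardfsID (layers_cover L) A; have := cardfsID (layers_cover L) C.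
  by move: AC ge; clear; clia.
move=> lt; have /fset0Pn [y] : (C `\` layers_cover L) `\` A != fset0.
  apply: contraTneq lt => /eqP; rewrite fsetD_eq0 => h; rewrite -leqNgt.
  apply: fsubset_leq_card; apply/fsubsetP => y yC; have := fsubsetP h y yC.
  by move: yC; rewrite !inE => /andP [-> _] ->.
rewrite !inE => /and3P [yA yL yC]; have yCA : y \in C `\` A by rewrite inE yA.
exists y => //; rewrite /layer_indep fsubUset sA fsub1set (fsubsetP sC) //=.
apply/andP; split.
  by apply: leq_trans (small_add _ yCA); apply: fsubset_leq_card; exact: fsubsetIl.
rewrite -(slack_cap (y |` A) (fsubset_refl _)) fsetIUl.
rewrite (_ : [fset y] `&` _ = fset0) ?fset0U ?slack_cap //.
by apply/eqP; rewrite fsetI_eq0 fdisjoint1X.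
Qed.

Lemma layer_indep1 L x : layered L -> x \in layers_cover L -> layer_indep L [fset x].
Proof.
move=> wL xL; rewrite /layer_indep fsub1set xL /=; elim: L {wL xL} => [//|B L IH] /=.
rewrite IH andbT; apply: leq_trans (_ : #|` [fset x]| <= _); last by rewrite cardfs1.
by apply: fsubset_leq_card; exact: fsubsetIl.
Qed.

Lemma layer_indep_loop L x : x \notin layers_cover L -> ~~ layer_indep L [fset x].
Proof. by move=> xL; rewrite /layer_indep fsub1set (negPf xL). Qed.

Lemma layer_indep_cons B L X : layer_indep (B :: L) X =
  [&& X `<=` B `|` layers_cover L, #|` X| <= (size L).+1 & layer_indep L (X `&` layers_cover L)].
Proof.
rewrite {1}/layer_indep layers_cover_cons /= layers_cover_cons.
case: (boolP (X `<=` _)) => //= sX; rewrite (fsetIidPl sX).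
by rewrite /layer_indep fsubsetIr slack_cap.
Qed.

Lemma layer_indep_merge B L X : layer_indep (merge_next B L) X =
  [&& X `<=` B `|` layers_cover L, #|` X| <= size L & layer_indep L (X `&` layers_cover L)].
Proof.
case: L => [|B' L] /=.
  rewrite /layer_indep layers_cover_nil /= fsetI0 fsub0set fsubset0 !andbT leqn0 cardfs_eq0.
  by apply/idP/andP => [/eqP ->|[_ //]]; rewrite fsub0set.
rewrite !layer_indep_cons layers_cover_cons -fsetUA; case: (boolP (X `<=` _)) => //= _.
rewrite fsubsetIr /= -fsetIA (fsetIidPr (fsubsetUr _ _)).
case: (leqP #|` X|) => //= h; rewrite (leq_trans _ h) //.
by apply: fsubset_leq_card; exact: fsubsetIl.
Qed.

Lemma layer_indep_contract L x : layered L -> x \in layers_cover L ->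
  layer_indep (contract_layer L x) = contract (layer_indep L) x.
Proof.
move=> wL xL; apply/funext => X; rewrite /contract layer_indep1 //.
elim: L X wL xL => [|B L IH] X wL; first by rewrite layers_cover_nil inE.
have /= /and3P [_ dis wL'] := wL; rewrite layers_cover_cons inE.
case: ifP => xB /=.
  move=> _; have xL : x \notin layers_cover L by move/fdisjointP: dis; apply.
  rewrite layer_indep_merge layer_indep_cons fsubUset fsub1set inE xB /=.
  have -> : (x |` X) `&` layers_cover L = X `&` layers_cover L.
    apply/fsetP => y; rewrite !inE; case: (eqVneq y x) => [->|//].
    by rewrite (negPf xL) !andbF.
  case: (boolP (x \in X)) => xX /=.
    rewrite (_ : (X `<=` _) = false) //; apply/negP => /fsubsetP /(_ x xX).
    by rewrite !inE eqxx (negPf xL).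
  rewrite cardfsU1 xX add1n ltnS; congr (_ && _); apply/fsubsetP/fsubsetP => h y yX.
    by have := h y yX; rewrite !inE => /orP [/andP [_ ->]|->]; rewrite ?orbT.
  have := h y yX; rewrite !inE => /orP [yB|->]; last by rewrite orbT.
  by rewrite yB andbT; case: (eqVneq y x) => // e; rewrite e (negPf xX) in yX.
move=> xL; rewrite !layer_indep_cons (size_contract_layer xL) IH //.
have sub := contract_layer_cover x wL'.
rewrite fsubUset fsub1set inE xL orbT /=.
have eU : (x |` X) `&` layers_cover L = x |` (X `&` layers_cover L).
  apply/fsetP => y; rewrite !inE; case: (eqVneq y x) => [->|//].
  by rewrite xL.
rewrite eU; apply/and3P/and4P => [[sX cX /andP [_ lX]]|[xX sX cX lX]].
  have sX' : X `<=` B `|` layers_cover L.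
    apply: fsubset_trans sX _; apply: fsetUS; apply: fsubset_trans sub _.
    exact: fsubsetDl.
  have xX : x \notin X.
    apply/negP => /(fsubsetP sX); rewrite inE xB /= => /(fsubsetP sub).
    by rewrite !inE eqxx.
  split=> //; first by rewrite cardfsU1 xX.
  rewrite (_ : X `&` layers_cover L = X `&` layers_cover (contract_layer L x)) //.
  apply/fsetP => y; rewrite !inE; case: (boolP (y \in X)) => //= yX.
  apply/idP/idP => [yL|/(fsubsetP sub)]; last by rewrite !inE => /andP [].
  have := fsubsetP sX y yX; rewrite inE => /orP [yB|//].
  by move/fdisjointP: dis => /(_ y yB); rewrite yL.
have xX' : x \notin X `&` layers_cover L by rewrite inE (negPf xX).
have : layer_indep (contract_layer L x) (X `&` layers_cover L) by rewrite IH // xX'.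
move=> /andP [sXL _].
have eI : X `&` layers_cover (contract_layer L x) = X `&` layers_cover L.
  apply/fsetP => y; rewrite !inE; case: (boolP (y \in X)) => //= yX.
  apply/idP/idP => [/(fsubsetP sub)|yL]; first by rewrite !inE => /andP [].
  by apply: (fsubsetP sXL); rewrite inE yX.
split; last by rewrite eI xX'.
  apply/fsubsetP => y yX; have := fsubsetP sX y yX; rewrite !inE.
  case: (y \in B) => //= yL; apply: (fsubsetP sXL); rewrite inE yX //.
by move: cX; rewrite cardfsU1 xX add1n.
Qed.

Lemma layer_indep_trunc L : 0 < size L ->
  layer_indep (trunc_layers L) = trunc (size L).-1 (layer_indep L).
Proof.
case: L => [//|B L] _; apply/funext => X.
rewrite /trunc_layers /trunc /= layer_indep_merge layer_indep_cons.
case: (leqP #|` X|) => h; last by rewrite !andbF.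
by rewrite leqW // andbT.
Qed.

Lemma layer_indep_coloop L x : layered L -> x \notin layers_cover L ->
  layer_indep ([fset x] :: L) = coloop x (layer_indep L).
Proof.
move=> wL xL; apply/funext => X; rewrite layer_indep_cons /coloop.
have eD : X `<=` x |` layers_cover L -> X `&` layers_cover L = X `\ x.
  move=> sX; apply/fsetP => y; rewrite !inE; case: (boolP (y \in X)) => yX; last by rewrite !andbF.
  rewrite andbT /=; have := fsubsetP sX y yX; rewrite !inE.
  by case: (eqVneq y x) => //= -> _; rewrite (negPf xL).
apply/and3P/idP => [[sX cX]|lX]; first by rewrite eD.
have sX : X `<=` x |` layers_cover L.
  case/andP: lX => /fsubsetP h _; apply/fsubsetP => y yX.
  by have := h y; rewrite !inE yX andbT; case: eqVneq => //= _; apply.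
split=> //; last by rewrite eD.
apply: leq_trans (_ : #|` X `\ x|.+1 <= _).
  by rewrite (cardfsD1 x X); case: (x \in X); rewrite ?add1n ?add0n.
rewrite ltnS; case: L lX {xL eD sX wL} => [|B L].
  by move=> /andP []; rewrite layers_cover_nil fsubset0 => /eqP ->; rewrite cardfs0.
by rewrite layer_indep_cons => /and3P [].
Qed.

Lemma card_layer_indep L X : layered L -> layer_indep L X -> #|` X| <= size L.
Proof.
case: L => [|B L] _; last by rewrite layer_indep_cons => /and3P [].
by move=> /andP []; rewrite layers_cover_nil fsubset0 => /eqP ->; rewrite cardfs0.
Qed.

Lemma layer_indep_basis L : layered L -> exists2 X, layer_indep L X & #|` X| = size L.
Proof.
elim: L => [|B L IH] wL; first by exists fset0; rewrite ?cardfs0 // /layer_indep fsub0set.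
have /= /and3P [B0 dis wL'] := wL; have [X lX cX] := IH wL'.
have [y yB] := fset0Pn _ B0.
have yL : y \notin layers_cover L by move/fdisjointP: dis; apply.
have /andP [sX _] := lX.
have yX : y \notin X by apply: contraNN yL; exact: (fsubsetP sX).
exists (y |` X); last by rewrite cardfsU1 yX cX.
rewrite layer_indep_cons cardfsU1 yX cX leqnn fsubUset fsub1set inE yB /=.
rewrite (fsubset_trans sX) ?fsubsetUr //= (_ : _ `&` _ = X) //.
apply/fsetP => z; rewrite !inE; case: (eqVneq z y) => [->|_] /=.
  by rewrite (negPf yL) (negPf yX).
by apply/andb_idr; exact: (fsubsetP sX).
Qed.

Lemma layers_stepE k L x : layers_step k L x =
  if x \in layers_cover L then [fset x] :: contract_layer L x
  else if size L < k then [fset x] :: L else [fset x] :: trunc_layers L.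
Proof.
rewrite /layers_step mem_layers_cover has_find; case: ifP => // h; congr (_ :: _).
elim: L h => [//|B L IH] /=; case: ifP => _ //= h.
  by rewrite drop0.
by rewrite IH.
Qed.

Lemma layers_rcons k s x : layers k (rcons s x) = layers_step k (layers k s) x.
Proof. by rewrite /layers -cats1 foldl_cat. Qed.

Lemma layered_cons1 L x : layered L -> x \notin layers_cover L -> layered ([fset x] :: L).
Proof.
move=> wL xL /=; rewrite wL fdisjoint1X xL !andbT.
by apply/fset0Pn; exists x; rewrite inE.
Qed.

Lemma notin_contract_layer x L : layered L -> x \notin layers_cover (contract_layer L x).
Proof. by move=> wL; apply/negP => /(fsubsetP (contract_layer_cover x wL)); rewrite !inE eqxx. Qed.

Lemma notin_trunc_layers x L : x \notin layers_cover L -> x \notin layers_cover (trunc_layers L).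
Proof. by apply: contraNN; exact: (fsubsetP (trunc_layers_cover L)). Qed.

Lemma layers_valid k s : 0 < k ->
  [/\ layered (layers k s), size (layers k s) <= k & {subset layers_cover (layers k s) <= s}].
Proof.
move=> k0; elim/last_ind: s => [|s x [wL cL sub]].
  by split=> // y; rewrite layers_cover_nil inE.
rewrite layers_rcons layers_stepE; move: (layers k s) wL cL sub => L wL cL sub.
have sub' L' : {subset layers_cover L' <= layers_cover L} ->
    {subset layers_cover ([fset x] :: L') <= rcons s x}.
  move=> h y; rewrite layers_cover_cons mem_rcons !inE.
  by move=> /orP [->//|/h /sub ->]; rewrite orbT.
case: ifPn => xL; last case: ltnP => lk.
- split; first exact: layered_cons1 (layered_contract x wL) (notin_contract_layer x wL).
    by rewrite /= size_contract_layer.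
  by apply: sub' => y /(fsubsetP (contract_layer_cover x wL)); rewrite !inE => /andP [].
- split=> //; first exact: layered_cons1.
  by apply: sub'.
- split; first exact: layered_cons1 (layered_trunc wL) (notin_trunc_layers xL).
    by rewrite /= size_merge size_behead; case: (size L) cL k0 => //= n; clear; clia.
  by apply: sub'; exact: (fsubsetP (trunc_layers_cover L)).
Qed.

End Layers.

(** * Equitable as a random greedy basis *)

Section Sampling.
Context {R : realType}.
Local Open Scope fset_scope.
Local Open Scope ring_scope.
Implicit Types (I : cache -> bool) (x y z : item) (A B S X U : cache) (L : seq cache).

Lemma greedy_mean_subset S S' I (f : cache -> R) : matroid I -> S `<=` S' ->
  (forall z, z \in S' -> z \notin S -> ~~ I [fset z]) -> greedy_mean S' I f = greedy_mean S I f.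
Proof.
move=> mI; elim: {S'}#|` S' `\` S| {-2}S' (erefl #|` S' `\` S|) => [|n IH] S' e sub lp.
  suff -> : S' = S by [].
  by apply/eqP; rewrite eqEfsubset sub andbT -fsetD_eq0 -cardfs_eq0 e.
have /fset0Pn [z] : S' `\` S != fset0 by rewrite -cardfs_eq0 e.
rewrite inE => /andP [zS zS']; rewrite (greedy_mean_loop _ mI (lp z zS' zS) zS'); apply: IH.
- have := cardfsD1 z (S' `\` S); rewrite e inE zS zS' /= => -[->].
  by rewrite !fsetDDl fsetUC.
- apply/fsubsetP => y yS; rewrite !inE (fsubsetP sub) // andbT.
  by apply: contraNneq zS => <-.
- by move=> y; rewrite !inE => /andP [_]; exact: lp.
Qed.

(* Conditioning on the first item of the random order: it only matters if it is
   neither a loop nor a coloop. *)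
Lemma greedy_mean_average S I U (f : cache -> R) : matroid I -> U `<=` S -> U != fset0 ->
  (forall z, z \in U -> I [fset z]) ->
  (forall z, z \in S -> z \notin U -> I [fset z] -> I = coloop z (contract I z)) ->
  greedy_mean S I f = unif (enum_fset U) (fun z => greedy_mean S (coloop z (contract I z)) f).
Proof.
move=> mI US U0 nl cl; rewrite /unif -[size _]/(#|` U|).
have cU : #|` U|%:R != 0 :> R by rewrite pnatr_eq0 cardfs_eq0.
apply: (mulIf cU); rewrite divfK //.
have nonloop z : z \in S -> I [fset z] ->
    greedy_mean (S `\ z) (contract I z)
      (fun X => f ((if I [fset z] then [fset z] else fset0) `|` X))
    = greedy_mean S (coloop z (contract I z)) f.
  move=> zS zI; rewrite zI -(greedy_mean_loop _ (matroid_contract z mI) (contract_self I z)) //.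
  apply: eq_fmean_in => p pS; rewrite greedy_coloop //.
  - exact: matroid_contract.
  - exact: contract_self.
  - by rewrite (mem_shuffle z erefl pS).
have h : \sum_(z <- enum_fset U)
    (greedy_mean S (coloop z (contract I z)) f - greedy_mean S I f) = 0.
  transitivity (\sum_(z <- enum_fset S) (greedy_mean (S `\ z) (contract I z)
      (fun X => f ((if I [fset z] then [fset z] else fset0) `|` X)) -
      greedy_mean S I f)); last first.
    rewrite big_split /= -greedy_mean_rec sumrN big_const_seq count_predT iter_addr_0.
    by rewrite mulr_natl subrr.
  rewrite -(big_fset_incl _ US) /=.
    by apply: eq_big_seq => z zU; rewrite nonloop ?nl ?(fsubsetP US).
  move=> z zS zU; have [zI|zI] := boolP (I [fset z]).
    by have := nonloop z zS zI; rewrite zI -(cl z zS zU zI) => ->; rewrite subrr.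
  rewrite (contract_loop zI); apply/eqP; rewrite subr_eq0; apply/eqP.
  rewrite [RHS](greedy_mean_loop _ mI zI) //; apply: eq_greedy_mean => t _; by rewrite fset0U.
move/eqP: h; rewrite big_split /= sumrN subr_eq0 => /eqP ->.
by rewrite big_const_seq count_predT iter_addr_0 mulr_natr.
Qed.

(** The number of layers from the first one that is not a singleton: each sampled request decreases
    it, which justifies the number of rounds allowed to the sampling. *)
Fixpoint hidden L : nat :=
  if L is B :: L' then if #|` B| == 1%N then hidden L' else size L else 0%N.

Lemma hidden_le L : (hidden L <= size L)%N.
Proof. by elim: L => [//|B L IH] /=; case: ifP => // _; apply: leq_trans IH _. Qed.

Lemma unrevealed_sub L : unrevealed L `<=` layers_cover L.
Proof.
elim: L => [|B L IH] /=; first exact: fsub0set.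
by case: ifP => // _; rewrite layers_cover_cons; apply: fsubset_trans IH (fsubsetUr _ _).
Qed.

Lemma unrevealed_hidden L : layered L -> (unrevealed L == fset0) = (hidden L == 0%N).
Proof.
elim: L => [|B L IH] /=; first by rewrite !eqxx.
move=> /and3P [B0 _ wL]; case: ifP => _; first exact: IH.
by rewrite layers_cover_cons; apply/negP => /eqP e; move: B0; rewrite -fsubset0 -e fsubsetUl.
Qed.

Lemma greedy_layer0 (t : seq item) : greedy (layer_indep [::]) t = fset0.
Proof.
have m0 : matroid (layer_indep [::]) by exact: matroid_layer_indep.
apply/eqP; rewrite -fsubset0; apply/fsubsetP => y /(mem_greedy m0) [].
by rewrite /layer_indep fsub1set layers_cover_nil inE.
Qed.

Lemma greedy_revealed L (t : seq item) : layered L -> hidden L = 0%N ->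
  {subset layers_cover L <= t} -> greedy (layer_indep L) t = layers_cover L.
Proof.
elim: L => [|B L IH]; first by rewrite greedy_layer0 layers_cover_nil.
move=> wL; have /= /and3P [B0 dis wL'] := wL.
case: eqP => // /eqP /cardfs1P [a eB] hL sub; rewrite eB in dis *.
have aL : a \notin layers_cover L by rewrite fdisjoint1X in dis.
rewrite layer_indep_coloop // greedy_coloop ?IH ?layers_cover_cons //.
- by move=> y yL; apply: sub; rewrite layers_cover_cons inE yL orbT.
- exact: matroid_layer_indep.
- exact: layer_indep_loop.
- by apply: sub; rewrite layers_cover_cons eB !inE eqxx.
Qed.

Lemma hidden_contract z L : layered L -> z \in unrevealed L ->
  (hidden (contract_layer L z) < hidden L)%N.
Proof.
elim: L => [|B L IH] /=; first by rewrite inE.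
move=> /and3P [B0 dis wL]; case: ifP => B1 zL.
  have zB : z \notin B.
    apply: contraTN dis => zB; apply/fdisjointP => /(_ z zB).
    by rewrite (fsubsetP (unrevealed_sub L)).
  by rewrite (negPf zB) /= B1 IH.
apply: leq_ltn_trans (hidden_le _) _; rewrite ltnS; case: ifP => zB.
  by rewrite size_merge.
by rewrite /= size_contract_layer //; move: zL; rewrite layers_cover_cons inE zB.
Qed.

Lemma hidden_contract0 x L : hidden L = 0%N -> hidden (contract_layer L x) = 0%N.
Proof.
elim: L => [//|B L IH] /=; case: eqP => // B1 hL; case: ifP => xB /=; last first.
  by rewrite B1 eqxx IH.
have -> : B `\ x = fset0.
  by apply/eqP; rewrite -cardfs_eq0; have := cardfsD1 x B; rewrite xB B1 add1n => -[<-].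
by case: L hL {IH} => [//|B' L] /=; rewrite fset0U.
Qed.

Lemma revealed_coloop L z : layered L -> z \in layers_cover L -> z \notin unrevealed L ->
  layer_indep L = coloop z (contract (layer_indep L) z).
Proof.
elim: L => [|B L IH]; first by rewrite layers_cover_nil inE.
move=> wL; have /= /and3P [B0 dis wL'] := wL.
case: eqP => [/eqP /cardfs1P [a eB]|_]; last by move=> ->.
rewrite eB in dis *; have aL : a \notin layers_cover L by rewrite fdisjoint1X in dis.
have mL := matroid_layer_indep wL'; have aI := layer_indep_loop aL.
rewrite layers_cover_cons layer_indep_coloop // !inE.
case: (eqVneq z a) => [->|za] /= zL zU; first by rewrite contract_coloop_self.
rewrite contract_coloop 1?eq_sym // {1}(IH wL' zL zU).
apply/funext => X; rewrite /coloop; congr (contract _ _ _).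
by rewrite !fsetDDl fsetUC.
Qed.

(** Items outside of the layers are loops and revealed items are coloops, so a round of the sampling
    conditions the random order on its first unrevealed item, which is uniform. *)
Lemma sampleE k n L S (f : cache -> R) : layered L -> layers_cover L `<=` S ->
  (hidden L <= n)%N -> equitable_sample k n L f = greedy_mean S (layer_indep L) f.
Proof.
have revealed L' : layered L' -> layers_cover L' `<=` S -> hidden L' = 0%N ->
    f (layers_cover L') = greedy_mean S (layer_indep L') f.
  move=> wL sL hL; rewrite -[LHS](greedy_mean_cst S (layer_indep L')).
  apply: eq_greedy_mean => t St.
  by rewrite greedy_revealed // => y /(fsubsetP sL); rewrite St.
elim: n L => [|n IH] L wL sL.
  by rewrite leqn0 => /eqP; exact: revealed.
move=> hn /=; rewrite unrevealed_hidden //; case: eqP => [|/eqP hL]; first exact: revealed.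
have mL := matroid_layer_indep wL.
have sU := unrevealed_sub L.
rewrite (@greedy_mean_average S _ (unrevealed L)) //.
- congr (_ / _); apply: eq_big_seq => z zU; have zL := fsubsetP sU z zU.
  rewrite layers_stepE zL IH.
  + rewrite layer_indep_coloop ?layer_indep_contract //.
      exact: layered_contract.
    exact: notin_contract_layer.
  + exact: layered_cons1 (layered_contract z wL) (notin_contract_layer z wL).
  + rewrite layers_cover_cons fsubUset fsub1set (fsubsetP sL) //=.
    apply: fsubset_trans sL; apply: fsubset_trans (contract_layer_cover z wL) _.
    exact: fsubsetDl.
  + rewrite /= cardfs1 /= -ltnS; apply: leq_trans (hidden_contract wL zU) _.
    exact: hn.
- exact: fsubset_trans sU sL.
- by rewrite unrevealed_hidden.
- by move=> z /(fsubsetP sU); exact: layer_indep1.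
- move=> z zS zU zI; apply: revealed_coloop => //.
  by apply: contraTT zI; exact: layer_indep_loop.
Qed.

Definition requested (s : seq item) : cache := [fset x in s].

Lemma requested_rcons s x : requested (rcons s x) = x |` requested s.
Proof. by apply/fsetP => y; rewrite !inE mem_rcons inE. Qed.

Definition equitable_dist k (s : seq item) : seq (R * cache) :=
  [seq (p.1, greedy (layer_indep (layers k s)) p.2)
    | p <- shuffle #|` requested s| (requested s)].

Lemma fmean_equitable_dist k s f :
  fmean (equitable_dist k s) f = greedy_mean (requested s) (layer_indep (layers k s)) f.
Proof. exact: (fmean_map (greedy (layer_indep (layers k s)))). Qed.

Lemma fdist_equitable_dist k s : fdist (equitable_dist k s).
Proof. exact/fdist_map/fdist_shuffle. Qed.

Lemma layers_requested k s : (0 < k)%N -> layers_cover (layers k s) `<=` requested s.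
Proof.
by move=> k0; have [_ _ sub] := layers_valid s k0; apply/fsubsetP => x /sub; rewrite inE.
Qed.

Lemma equitable_lawE k s C : (0 < k)%N -> equitable_law R k s C =
  fmean (equitable_dist k s) (fun X => (C == X)%:R).
Proof.
move=> k0; have [wL sL _] := layers_valid s k0.
rewrite fmean_equitable_dist /equitable_law.
by apply: sampleE (layers_requested s k0) (leq_trans (hidden_le _) sL).
Qed.

(** As long as there are fewer than [k] layers they are singletons: loading an item adds a
    singleton, and a requested layer that has become empty leaves the next one unchanged when it
    joins it. *)
Lemma layers_hidden k s : (0 < k)%N -> (size (layers k s) < k)%N ->
  hidden (layers k s) = 0%N.
Proof.
move=> k0; elim/last_ind: s => [//|s x]; rewrite layers_rcons layers_stepE.
have [wL sL _] := layers_valid s k0.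
move: (layers k s) wL sL => L wL sL IH; case: ifPn => xL; last case: (ltnP (size L)) => lk.
- by rewrite /= cardfs1 size_contract_layer // => /IH; exact: hidden_contract0.
- by rewrite /= cardfs1 => _; exact: IH.
- rewrite /= size_merge size_behead prednK ?ltnNge ?lk //.
  by rewrite -ltnNge (leq_trans k0 lk).
Qed.

Lemma card_greedy_layers L (t : seq item) : layered L -> {subset layers_cover L <= t} ->
  #|` greedy (layer_indep L) t| = size L.
Proof.
move=> wL sub; have mL := matroid_layer_indep wL; apply/eqP; rewrite eqn_leq.
rewrite card_layer_indep ?greedy_indep //=; have [X lX <-] := layer_indep_basis wL.
apply: card_greedy => // y yX; apply: sub.
by case/andP: lX => /fsubsetP /(_ y yX).
Qed.

(** Both caches are computed with the same random order, which includes [x]; an [x] never requested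
    before is a loop of the old matroid. By [greedy_contract] and [greedy_trunc] the two bases
    differ by one swap at most. *)
Lemma equitable_coupling k s x : (0 < k)%N -> exists J,
  lazy_coupling k x (equitable_dist k s) (equitable_dist k (rcons s x)) J.
Proof.
move=> k0; pose S := x |` requested s.
have [wL sL _] := layers_valid s k0; have hid := layers_hidden (s := s) k0.
have sub := layers_requested s k0.
have mL := matroid_layer_indep wL.
pose g t := (greedy (layer_indep (layers k s)) t,
  greedy (layer_indep (layers k (rcons s x))) t).
exists [seq (p.1, g p.2)
  | p <- shuffle #|` S| S]; split.
- move=> _ /mapP [p pS ->] /=; by case: (fdist_shuffle (R := R) (erefl #|` S|)) => + _; apply.
- move=> f; rewrite (fmean_map g).
  rewrite fmean_equitable_dist; apply: greedy_mean_subset => //; first exact: fsubsetU1.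
  move=> z; rewrite !inE => /orP [_ zs|/[swap] /negPf ->//]; apply: layer_indep_loop.
  by apply: contra zs => /(fsubsetP sub); rewrite inE.
- move=> f; rewrite (fmean_map g).
  by rewrite fmean_equitable_dist requested_rcons.
move=> _ /mapP [p pS ->] _ /=; set t := p.2.
have St y : (y \in t) = (y \in S) by exact: mem_shuffle pS.
have xt : x \in t by rewrite St fset1U1.
have Lt : {subset layers_cover (layers k s) <= t}.
  by move=> y /(fsubsetP sub) ys; rewrite St !inE in ys *; rewrite ys orbT.
have cC := card_greedy_layers wL Lt.
rewrite layers_rcons layers_stepE; move: (layers k s) wL sL hid sub mL Lt cC => L.
move=> wL sL hid sub mL Lt cC; case: ifPn => xL; last case: ltnP => lk.
- have xI := layer_indep1 wL xL.
  rewrite layer_indep_coloop; [|exact: layered_contract|exact: notin_contract_layer].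
  rewrite layer_indep_contract // greedy_coloop //; [|exact: matroid_contract|exact: contract_self].
  have [y yC [-> xy]] := greedy_contract mL xI xt.
  have [xC|xC] := boolP (x \in greedy (layer_indep L) t).
    by rewrite (xy xC) fsetD1K //; apply: lazy_move_hit; rewrite ?cC.
  apply: lazy_move_swap => //; rewrite cC; apply/eqP; rewrite eqn_leq sL leqNgt.
  apply: contra xC => /hid hL; rewrite greedy_revealed //.
- have xI := layer_indep_loop xL.
  rewrite layer_indep_coloop // greedy_coloop //; apply: lazy_move_load; last by rewrite cC.
  exact: loop_notin_greedy.
- have xI := layer_indep_loop xL; have eL : size L = k by apply/eqP; rewrite eqn_leq sL.
  rewrite layer_indep_coloop; [|exact: layered_trunc|exact: notin_trunc_layers].
  rewrite layer_indep_trunc ?eL // greedy_coloop //; last first.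
  + by rewrite /trunc (negPf xI).
  + exact: matroid_trunc.
  have le_k X : layer_indep L X -> (#|` X| <= k.-1.+1)%N.
    by rewrite prednK // -eL; exact: card_layer_indep.
  have [[y yC ->]|[_]] := greedy_trunc t mL le_k; last first.
    by rewrite cC eL; move: k0; clear; clia.
  apply: lazy_move_swap => //; last by rewrite cC.
  exact: loop_notin_greedy.
Qed.

Lemma exists_equitable k : (0 < k)%N -> exists Q : randalg R, is_equitable k Q.
Proof.
move=> k0; apply: (exists_lazy_with_law (d := equitable_dist k)) => //.
- by move=> s; exact: fdist_equitable_dist.
- move=> f; rewrite fmean_equitable_dist.
  rewrite -[RHS](greedy_mean_cst (requested [::]) (layer_indep [::])).
  by apply: eq_greedy_mean => t _; rewrite greedy_layer0.
- by move=> s x; exact: equitable_coupling.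
- by move=> s C; exact: equitable_lawE.
Qed.

Fixpoint layer_constraints U (n : nat) L : seq (nat * cache) :=
  if L is B :: L' then (n.+1, U `|` B) :: layer_constraints (U `|` B) n.+1 L'
  else [::].

(** [m] is 1 while the cache fills, where the layers shift by one, and 0 for a new request, where
    the merge of the first two layers undoes the shift. *)
Lemma layer_constraints_add m x U n L p : x \notin U -> x \notin layers_cover L ->
  p \in layer_constraints (x |` U) (m + n) L ->
  exists2 q, q \in layer_constraints U n L &
    [/\ x \notin q.2, x |` q.2 `<=` p.2 & (p.1 <= m + q.1)%N].
Proof.
elim: L U n => [//|B L IH] U n xU; rewrite layers_cover_cons inE negb_or => /andP [xB xL].
have xUB : x \notin U `|` B by rewrite inE negb_or xU xB.
rewrite /= inE => /predU1P [->|].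
  exists (n.+1, U `|` B); first by rewrite inE eqxx.
  by split; rewrite //= ?fsetUA ?addnS.
rewrite -fsetUA -addnS => /(IH _ _ xUB xL) [q qL h].
by exists q => //; rewrite inE qL orbT.
Qed.

Lemma layer_constraints_contract x U n L p : layered L -> x \notin U -> x \in layers_cover L ->
  p \in layer_constraints (x |` U) n.+1 (contract_layer L x) ->
  constraint_step false x (layer_constraints U n L) p.
Proof.
elim: L U n => [|B L IH] U n; first by rewrite layers_cover_nil inE.
move=> /= /and3P [_ _ wL] xU; rewrite layers_cover_cons inE; case: ifP => xB /=.
  move=> _ pL; apply: Or32; split=> //; exists p => //; rewrite inE; apply/orP; right.
  case: L pL {IH wL} => [//|B' L] /=.
  rewrite (_ : x |` U `|` (B `\ x `|` B') = U `|` B `|` B') //.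
  apply/fsetP => y; rewrite !inE; case: (eqVneq y x) => [->|_] /=.
    by rewrite xB orbT.
  by rewrite orbA.
move=> xL; rewrite inE => /predU1P [->|pL].
  apply: Or33; exists (n.+1, U `|` B); first by rewrite inE eqxx.
  by rewrite /= inE negb_or xU xB -fsetUA.
rewrite -fsetUA in pL; have xUB : x \notin U `|` B by rewrite inE negb_or xU xB.
have [h|[_ [q qW h]]|[q qW h]] := IH _ _ wL xUB xL pL; first exact: Or31.
  by apply: Or32; split=> //; exists q => //; rewrite inE qW orbT.
by apply: Or33; exists q => //; rewrite inE qW orbT.
Qed.

Definition layer_new k L x : bool := (x \notin layers_cover L) && (size L == k).

Lemma layer_constraints_full U n L x : (0 < size L)%N -> x \notin U ->
  x \notin layers_cover L ->
  exists2 q, q \in layer_constraints U n L & ((n + size L)%N <= q.1)%N /\ x \notin q.2.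
Proof.
elim: L U n => [//|B L IH] U n _ xU; rewrite layers_cover_cons inE negb_or => /andP [xB xL].
have xUB : x \notin U `|` B by rewrite inE negb_or xU xB.
case: (posnP (size L)) => [/size0nil ->|L0].
  exists (n.+1, U `|` B); first by rewrite inE eqxx.
  by split; rewrite //= addn1.
have [q qL h] := IH (U `|` B) n.+1 L0 xUB xL.
by exists q; rewrite ?inE ?qL ?orbT // /= addnS -addSn.
Qed.

Lemma equitable_occurrences k s : (0 < k)%N ->
  (occurrences (fun s => layer_new k (layers k s)) s <= optn k s)%N.
Proof.
move=> k0; apply: (occurrences_le_optn
  (W := fun s => layer_constraints fset0 0 (layers k s)) k0) => //.
- move=> {}s x p; have [wL sL _] := layers_valid s k0.
  rewrite layers_rcons layers_stepE /layer_new; move: (layers k s) wL sL => L wL sL.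
  have x0 : x \notin fset0 by rewrite inE.
  have first q : q = (1%N, fset0 `|` [fset x]) -> x \in q.2 /\ (q.1 <= 1)%N.
    by move=> ->; rewrite fset0U inE.
  have eU : fset0 `|` [fset x] = x |` fset0 by rewrite fsetUC.
  case: ifPn => xL /=; last case: ltnP => lk; rewrite /= ?inE.
  + move=> /predU1P [/first|]; first exact: Or31.
    by rewrite eU; exact: layer_constraints_contract.
  + rewrite ltn_eqF //= => /predU1P [/first|]; first exact: Or31.
    rewrite eU => /(layer_constraints_add (m := 1) x0 xL) [q qL h].
    by apply: Or33; exists q.
  + have -> : (size L == k) = true by rewrite eqn_leq sL lk.
    move=> /predU1P [/first|]; first exact: Or31.
    case: L xL {sL lk wL} => [//|B L]; rewrite layers_cover_cons inE negb_or.
    move=> /andP [xB xL]; case: L xL => [//|B' L].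
    rewrite layers_cover_cons inE negb_or => /andP [xB' xL] /=.
    rewrite inE => /predU1P [->|].
      apply: Or33; exists (2%N, fset0 `|` B `|` B'); first by rewrite !inE eqxx orbT.
      by rewrite /= !fset0U inE negb_or xB xB'.
    rewrite (_ : fset0 `|` [fset x] `|` _ = x |` (fset0 `|` B `|` B')); last by rewrite !fset0U.
    have xU : x \notin fset0 `|` B `|` B' by rewrite fset0U inE negb_or xB.
    move=> /(layer_constraints_add (m := 0) xU xL) [q qL h].
    by apply: Or33; exists q => //; rewrite !inE qL !orbT.
- move=> {}s x /andP [xL /eqP sL].
  have L0 : (0 < size (layers k s))%N by rewrite sL.
  have x0 : x \notin fset0 by rewrite inE.
  by have [q qL] := layer_constraints_full 0 L0 x0 xL; rewrite add0n sL; exists q.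
Qed.

(** The expected faults if all the items were requested in turn, plus one for each place of the
    cache that is still to be filled. *)
Definition layer_potential k N (s : seq item) : R :=
  (k - size (layers k s))%:R + psi (universe N) (layer_indep (layers k s)) (iota 0 N).

(** A request inside the layers releases exactly its fault probability from [psi]. A new request
    costs one fault and truncates the matroid, which raises [psi] by at most [H(k) - 1]. *)
Lemma equitable_ratio_le k (Q : randalg R) eps : (0 < k)%N -> is_equitable k Q ->
  (rand_ratio k eps Q <= (harm R k)%:E)%E.
Proof.
move=> k0 eQ; have [oQ lQ _] := eQ.
apply: (@potential_ratio R k Q eps (layer_potential k)
  (fun s => layer_new k (layers k s)) _ k%:R k0 oQ lQ) => //.
- by apply: le_trans ler01 _; case: k k0 {eQ oQ lQ} => // k _; exact: harm_ge1.
- move=> N s; have [wL _ _] := layers_valid s k0.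
  by rewrite addr_ge0 // psi_ge0 //; exact: matroid_layer_indep.
- move=> N; rewrite /layer_potential /= subn0 psi_loops ?addr0 //.
    exact: matroid_layer_indep.
  by move=> z; apply: layer_indep_loop; rewrite layers_cover_nil inE.
- by move=> s; exact: equitable_occurrences.
move=> N s x; rewrite all_rcons => /andP [xN sN].
have [wL sL sub] := layers_valid s k0; have mL := matroid_layer_indep wL.
have xU : x \in universe N by rewrite in_universe.
have absentE : absent Q s x = 1 - greedy_prob (universe N) (layer_indep (layers k s)) x.
  rewrite (absent_law x (fdist_equitable_dist k s) (fun C => equitable_lawE s C k0) eQ).
  rewrite fmean_equitable_dist /greedy_prob (greedy_mean_subset (S := requested s)) //; first last.
  + move=> z _ zs; apply: layer_indep_loop; apply: contra zs.
    exact: (fsubsetP (layers_requested s k0)).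
  + apply/fsubsetP => y; rewrite inE in_universe => ys.
    by have /allP/(_ y ys) := sN.
  apply/eqP; rewrite eq_sym subr_eq.
  rewrite -{1}(greedy_mean_cst (requested s) (layer_indep (layers k s)) 1).
  rewrite /greedy_mean -fmeanD; apply/eqP; apply: eq_fmean_in => p _.
  by case: (x \in _); rewrite ?addr0 ?add0r.
have sU : {subset iota 0 N <= universe N} by move=> y; rewrite mem_iota in_universe.
have xI : x \in iota 0 N by rewrite mem_iota.
have eU : universe N =i iota 0 N by move=> y; rewrite mem_iota in_universe.
rewrite absentE /layer_potential layers_rcons layers_stepE /layer_new.
move: (layers k s) wL sL sub mL {absentE} => L wL sL sub mL.
case: ifPn => xL /=; last case: (ltnP (size L)) => lk /=.
- rewrite size_contract_layer // mulr0 addr0.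
  rewrite layer_indep_coloop; [|exact: layered_contract|exact: notin_contract_layer].
  rewrite layer_indep_contract // psi_coloop //; [|exact: matroid_contract|exact: contract_self].
  rewrite (psi_contract mL sU xI) /fault (layer_indep1 wL xL) mulr1n.
  by move: (greedy_prob _ _ _) (psi _ _ _) _%:R => a b c; lra.
- have xl := layer_indep_loop xL.
  rewrite ltn_eqF // mulr0 addr0 greedy_prob_loop // subr0 layer_indep_coloop // psi_coloop //.
  rewrite (_ : (k - size L)%N = (k - (size L).+1).+1); last by rewrite subnSK.
  by rewrite -natr1; lra.
- have xl := layer_indep_loop xL; have eL : size L = k by apply/eqP; rewrite eqn_leq sL.
  rewrite eL eqxx mulr1 subnn size_merge size_behead eL prednK // subnn greedy_prob_loop // subr0.
  rewrite layer_indep_coloop; [|exact: layered_trunc|exact: notin_trunc_layers].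
  rewrite layer_indep_trunc ?eL // psi_coloop //; last first.
  + by rewrite /trunc (negPf xl).
  + exact: matroid_trunc.
  have le_k X : layer_indep L X -> (#|` X| <= k.-1.+1)%N.
    by rewrite prednK // -eL; exact: card_layer_indep.
  have [B lB cB] := layer_indep_basis wL.
  have BU : B `<=` universe N.
    apply/fsubsetP => y yB; rewrite in_universe.
    by case/andP: lB => /fsubsetP /(_ y yB) /sub ys _; have /allP/(_ y ys) := sN.
  have cB' : #|` B| = k.-1.+1 by rewrite cB eL prednK.
  have := psi_trunc (R := R) mL eU le_k lB cB' BU; rewrite prednK //.
  by move: (psi _ _ _) (psi _ _ _) (harm _ _) => a b c; lra.
Qed.

End Sampling.

(** * The randomized marking algorithm *)

Section Swap.
Local Open Scope fset_scope.
Implicit Types (x y z : item) (C M : cache).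

Definition swap_item y z x : item := if x == y then z else if x == z then y else x.

Lemma swap_itemK y z : involutive (swap_item y z).
Proof.
move=> x; rewrite /swap_item; case: (eqVneq x y) => [->|xy].
  by case: (eqVneq z y) => [//|_]; rewrite eqxx.
case: (eqVneq x z) => [->|xz]; first by rewrite eqxx.
by rewrite (negPf xy) (negPf xz).
Qed.

Definition swap_items y z C : cache := [fset swap_item y z x | x in C].

Lemma mem_swap_items y z x C : (x \in swap_items y z C) = (swap_item y z x \in C).
Proof.
apply/imfsetP/idP => [[w /= wC ->]|xC]; first by rewrite swap_itemK.
by exists (swap_item y z x); rewrite ?swap_itemK.
Qed.

Lemma card_swap_items y z C : #|` swap_items y z C| = #|` C|.
Proof. by rewrite card_imfset //; exact: inv_inj (swap_itemK y z). Qed.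

Lemma swap_items_in y z C : y \in C -> z \in C -> swap_items y z C = C.
Proof.
move=> yC zC; apply/fsetP => x; rewrite mem_swap_items /swap_item.
by case: eqVneq => [->|_]; rewrite ?yC //; case: eqVneq => [->|//]; rewrite yC zC.
Qed.

Lemma swap_items_out y z C : y \notin C -> z \notin C -> swap_items y z C = C.
Proof.
move=> /negPf yC /negPf zC; apply/fsetP => x; rewrite mem_swap_items /swap_item.
by case: eqVneq => [->|_]; rewrite ?yC //; case: eqVneq => [->|//]; rewrite yC zC.
Qed.

Lemma swap_item_out y z x : x != y -> x != z -> swap_item y z x = x.
Proof. by rewrite /swap_item => /negPf -> /negPf ->. Qed.

End Swap.

(** * The law of the cache of RMark and its exchangeability *)

Section RMarkLaw.
Context {R : realType}.
Local Open Scope fset_scope.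
Local Open Scope ring_scope.
Implicit Types (s : seq item) (x y z : item) (C M : cache).

Definition rmark_dist k C M x : seq (R * cache) :=
  if x \in C then fpoint C
  else if (#|` C| < k)%N then fpoint (x |` C)
  else funif [seq x |` (C `\ y) | y <- enum_fset (C `\` M)].

Lemma rmark_stepE k C M x C' :
  rmark_step R k C M x C' = fmean (rmark_dist k C M x) (fun X => (C' == X)%:R).
Proof.
rewrite /rmark_step /rmark_dist; case: ifP => _; first by rewrite fmean_point.
case: ifP => _; first by rewrite fmean_point.
by rewrite fmean_unif /unif big_map size_map.
Qed.

Lemma unmarked_neq0 k C M x : (0 < k)%N -> (#|` C| <= k)%N -> x \notin C ->
  ~~ (#|` C| < k)%N -> C `\` erase k C M x != fset0.
Proof.
move=> k0 Ck xC; rewrite -leqNgt => kC; have cC : #|` C| = k by apply/eqP; rewrite eqn_leq Ck.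
rewrite /erase xC cC eqxx /=; case: ifPn => CM; last by rewrite fsetD_eq0.
by rewrite fsetD0 -cardfs_eq0 cC -lt0n.
Qed.

Lemma fdist_rmark_dist k C M x : (0 < k)%N -> (#|` C| <= k)%N ->
  fdist (rmark_dist k C (erase k C M x) x).
Proof.
move=> k0 Ck; rewrite /rmark_dist; case: ifPn => xC; first exact: fdist_point.
case: ifPn => lt; first exact: fdist_point.
apply: fdist_unif; rewrite -size_eq0 size_map -[size _]/(#|` _|) cardfs_eq0.
exact: unmarked_neq0.
Qed.

Variant rmark_move k C M x : cache -> Prop :=
| RMarkHit of x \in C : rmark_move k C M x C
| RMarkLoad of x \notin C & (#|` C| < k)%N : rmark_move k C M x (x |` C)
| RMarkSwap y of x \notin C & (k <= #|` C|)%N & y \in C & y \notin M :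
    rmark_move k C M x (x |` (C `\ y)).

Lemma mem_rmark_dist k C M x p : p \in rmark_dist k C M x -> rmark_move k C M x p.2.
Proof.
rewrite /rmark_dist; case: ifPn => xC; first by rewrite inE => /eqP ->; exact: RMarkHit.
case: ltnP => Ck; first by rewrite inE => /eqP ->; exact: RMarkLoad.
move=> /mem_funif /mapP [y]; rewrite -[_ \in _]/(y \in C `\` M) inE => /andP [yM yC] ->.
exact: RMarkSwap.
Qed.

Lemma rmark_step_move k C M x C' : 0 < rmark_step R k C M x C' -> rmark_move k C M x C'.
Proof.
rewrite rmark_stepE => h; have d0 p : p \in rmark_dist k C M x -> 0 <= p.1.
  rewrite /rmark_dist; case: ifP => _; first by rewrite inE => /eqP ->; exact: ler01.
  case: ifP => _; first by rewrite inE => /eqP ->; exact: ler01.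
  by move=> /mapP [y _ ->] /=; rewrite invr_ge0.
have [p [pd _ /eqP ->]] := fmean_gt0 d0 h; exact: mem_rmark_dist.
Qed.

Lemma lazy_move_rmark k C M x C' : (#|` C| <= k)%N -> rmark_move k C M x C' ->
  lazy_move k x C C'.
Proof.
move=> Ck [xC|xC lt|y xC le yC yM]; first exact: lazy_move_hit.
  exact: lazy_move_load.
by apply: lazy_move_swap => //; apply/eqP; rewrite eqn_leq Ck.
Qed.

Lemma rmark_lazy_marking k (A : alg) : A [::] = fset0 ->
  (forall s x, (#|` A s| <= k)%N ->
     rmark_move k (A s) (erase k (A s) (marks k A s) x) x (A (rcons s x))) ->
  lazy_marking k A.
Proof.
move=> A0 step; have [oA lA] : online k A /\ lazy k A.
  by apply: lazy_moves_online => // s x As; apply: lazy_move_rmark (step s x As).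
split=> //; split=> // s x y; rewrite inE => /andP [yA' yA].
have := step s x (online_card s oA); set C' := A (rcons s x) in yA' *.
move=> h; case: h yA' => [xC|xC lt|z xC le zC zM]; first by rewrite yA.
  by rewrite !inE yA orbT.
by rewrite !inE yA andbT negb_or negbK => /andP [_ /eqP ->].
Qed.

(** The marks are replaced by the set of the current phase, with which they agree for any marking
    algorithm; thus the law can be computed from the caches alone. *)
Fixpoint rmark_law_rev k (r : seq item) : seq (R * cache) :=
  if r is x :: r' then
    fbind (rmark_law_rev k r') (fun C =>
      rmark_dist k C (erase k C (ph_cur (phases k (rev r'))) x) x)
  else fpoint fset0.

Definition rmark_law k s := rmark_law_rev k (rev s).

Lemma rmark_law_rcons k s x : rmark_law k (rcons s x) =
  fbind (rmark_law k s) (fun C => rmark_dist k C (erase k C (ph_cur (phases k s)) x) x).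
Proof. by rewrite /rmark_law rev_rcons /= revK. Qed.

Lemma erase_phase k C M x : (#|` M| < k)%N -> erase k C M x = M.
Proof.
move=> Mk; rewrite /erase; case: and3P => // -[_ /eqP cC CM].
by move: Mk; rewrite -cC ltnNge (fsubset_leq_card CM).
Qed.

Lemma erase_full k C M x : M `<=` C -> (#|` C| <= k)%N -> #|` M| = k -> x \notin M ->
  C = M /\ erase k C M x = fset0.
Proof.
move=> MC Ck Mk xM; have -> : C = M.
  by apply/esym/eqP; rewrite eqEfcard MC Mk.
by rewrite /erase xM Mk eqxx fsubset_refl.
Qed.

Lemma mem_rmark_law k s p : (0 < k)%N -> p \in rmark_law k s ->
  let ph := phases k s in
  [/\ ph_cur ph `<=` p.2, (#|` p.2| <= k)%N &
      (0 < ph_num ph)%N -> #|` p.2| = k /\ p.2 `<=` ph_old ph `|` ph_cur ph].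
Proof.
move=> k0; elim/last_ind: s p => [|s x IH] p /=.
  by rewrite inE => /eqP ->; split=> //; rewrite ?fsub0set ?cardfs0.
rewrite rmark_law_rcons => /mem_fbind [q [q' [qL q'd ->]]] /=.
have [MC Ck full] := IH q qL; have := mem_rmark_dist q'd.
rewrite phases_rcons /phase_step.
have [lM hO _ _] := phases_inv s k0.
case: (phases k s) MC Ck full lM hO {qL q'd IH} => O M F N /= MC Ck full lM hO.
set C' := q'.2; move: C' => C' mv.
have [xMv cC' _ _] := lazy_move_rmark Ck mv.
have cswap y : x \notin q.2 -> y \in q.2 -> #|` x |` (q.2 `\ y)| = #|` q.2|.
  move=> xC yC; rewrite cardfsU1 !inE (negPf xC) andbF /=.
  by have := cardfsD1 y q.2; rewrite yC => ->.
case: (boolP (x \in M)) => xM /=.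
  by case: mv => [//|xC|y xC]; rewrite (fsubsetP MC) in xC.
case: (ltnP #|` M| k) => Mk /=.
  rewrite erase_phase // in mv; split=> //.
    case: mv xMv {cC'} => [xC|xC lt|y xC le yC yM] _; rewrite fsubUset fsub1set ?MC ?xC //.
      by rewrite fset1U1 (fsubset_trans MC) // fsubsetUr.
    rewrite fset1U1 /=; apply/fsubsetP => w wM; rewrite !inE (fsubsetP MC) // andbT.
    by apply/orP; right; apply: contraNneq yM => <-.
  move=> F0; have [cC sC] := full F0.
  case: mv {xMv cC'} => [xC|xC lt|y xC le yC yM].
  - by split=> //; rewrite fsetUCA; apply: fsubset_trans sC _; exact: fsubsetUr.
  - by rewrite cC ltnn in lt.
  - rewrite cswap // cC; split=> //; rewrite fsetUCA; apply: fsetUS.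
    by apply: fsubset_trans sC; exact: fsubsetDl.
have Mk' : #|` M| = k by apply/eqP; rewrite eqn_leq lM.
have [eC eE] := erase_full MC Ck Mk' xM; rewrite eE eC in mv; rewrite eC in cswap.
rewrite fsub1set; split=> // _.
case: mv {xMv cC'} => [xC|xC|y xC le yC _]; first by rewrite xC in xM.
  by rewrite Mk' ltnn.
by rewrite cswap // Mk'; split=> //; rewrite fsetUC fsetSU // fsubsetDl.
Qed.

Lemma fdist_rmark_law k s : (0 < k)%N -> fdist (rmark_law k s).
Proof.
move=> k0; elim/last_ind: s => [|s x IH]; first exact: fdist_point.
rewrite rmark_law_rcons; apply: fdist_bind => // p pL; apply: fdist_rmark_dist => //.
by have [] := mem_rmark_law k0 pL.
Qed.

Lemma rmark_dist_swap k C M x y z f : swap_item y z x = x -> swap_items y z M = M ->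
  fmean (rmark_dist k (swap_items y z C) M x) f =
  fmean (rmark_dist k C M x) (fun X => f (swap_items y z X)).
Proof.
move=> ex eM; have xE : (x \in swap_items y z C) = (x \in C) by rewrite mem_swap_items ex.
rewrite /rmark_dist xE card_swap_items; case: ifP => _; first by rewrite !fmean_point.
have U B : swap_items y z (x |` B) = x |` swap_items y z B.
  apply/fsetP => w; rewrite !(inE, mem_swap_items) -{1}ex.
  by rewrite (inv_eq (swap_itemK y z)) swap_itemK.
case: ifP => _; first by rewrite !fmean_point U.
rewrite !fmean_unif /unif !big_map !size_map.
rewrite -[size _]/(#|` _|) -[size (enum_fset (C `\` M))]/(#|` _|).
have e : swap_items y z C `\` M = swap_items y z (C `\` M).
  apply/fsetP => w; rewrite !(inE, mem_swap_items); congr (_ && _).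
  by rewrite -{1}eM mem_swap_items.
rewrite e card_swap_items; congr (_ / _).
have pe : perm_eq (enum_fset (swap_items y z (C `\` M)))
    [seq swap_item y z w | w <- enum_fset (C `\` M)].
  apply: uniq_perm; rewrite ?fset_uniq ?map_inj_uniq ?fset_uniq //.
    exact: inv_inj (swap_itemK y z).
  move=> w; rewrite -[LHS]/(w \in swap_items y z (C `\` M)) mem_swap_items.
  by rewrite -{2}(swap_itemK y z w) mem_map //; exact: inv_inj (swap_itemK y z).
rewrite (perm_big _ pe) big_map; apply: eq_bigr => w _; rewrite U; congr (f (_ |` _)).
apply/fsetP => v; rewrite !(inE, mem_swap_items); congr (~~ _ && _).
by rewrite -(inv_eq (swap_itemK y z)).
Qed.

Lemma erase_swap k C M x y z : swap_item y z x = x -> swap_items y z M = M ->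
  erase k (swap_items y z C) M x = erase k C M x.
Proof.
move=> ex eM; rewrite /erase mem_swap_items ex card_swap_items.
suff -> : (swap_items y z C `<=` M) = (C `<=` M) by [].
rewrite -{1}eM; apply/fsubsetP/fsubsetP => h w; last by rewrite !mem_swap_items; exact: h.
by have := h (swap_item y z w); rewrite !mem_swap_items swap_itemK.
Qed.

(** At the start of a phase the cache is the whole set of the previous phase, on which the eviction
    is uniform; afterwards every step commutes with the exchange of two items that have not been
    requested in the phase. *)
Lemma rmark_law_swap k s y z f : (0 < k)%N -> let ph := phases k s in
  (0 < ph_num ph)%N -> y \in ph_old ph `\` ph_cur ph -> z \in ph_old ph `\` ph_cur ph ->
  fmean (rmark_law k s) (fun C => f (swap_items y z C)) = fmean (rmark_law k s) f.
Proof.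
move=> k0; elim/last_ind: s f => [//|s x IH] f /=.
have supp p := @mem_rmark_law k s p k0.
have [lM _ _ _] := phases_inv s k0.
rewrite rmark_law_rcons phases_rcons /phase_step !fmean_bind.
case: (phases k s) supp IH lM => O M F N /= supp IH lM.
case: (boolP (x \in M)) => xM /=.
  have st g : fmean (rmark_law k s) (fun C => fmean (rmark_dist k C (erase k C M x) x) g)
      = fmean (rmark_law k s) g.
    apply: eq_fmean_in => p /supp [MC _ _].
    by rewrite /rmark_dist (fsubsetP MC) // fmean_point.
  by rewrite !st; exact: IH.
case: (ltnP #|` M| k) => Mk /=.
  rewrite !inE !negb_or => F0 /andP [/andP [yx yM] yO] /andP [/andP [zx zM] zO].
  have ex : swap_item y z x = x by rewrite swap_item_out // eq_sym.
  have eM : swap_items y z M = M by rewrite swap_items_out.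
  rewrite -[RHS]IH ?inE ?yM ?zM //; apply: eq_fmean_in => p _.
  by rewrite erase_swap // erase_phase // rmark_dist_swap.
rewrite !inE => _ /andP [yx yM] /andP [zx zM].
have ex : swap_item y z x = x by rewrite swap_item_out // eq_sym.
have eM : swap_items y z M = M by rewrite swap_items_in.
apply: eq_fmean_in => p /supp [MC Ck _].
have Mk' : #|` M| = k by apply/eqP; rewrite eqn_leq lM.
have [-> ->] := erase_full MC Ck Mk' xM.
by rewrite -rmark_dist_swap ?eM // /swap_items imfset0.
Qed.

(** The cache has [k] items of the two phases and contains all of the current one, so the number of
    missing old items is always the number of new ones; by exchangeability each is missing with the
    same probability. *)
Lemma rmark_absent_old k s x : (0 < k)%N -> let ph := phases k s in
  (0 < ph_num ph)%N -> x \in ph_old ph `\` ph_cur ph ->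
  fmean (rmark_law k s) (fun C => (x \notin C)%:R) =
  #|` ph_cur ph `\` ph_old ph|%:R / #|` ph_old ph `\` ph_cur ph|%:R.
Proof.
move=> k0 ph F0 xO; set D := ph_old ph `\` ph_cur ph in xO *.
have cD : #|` D|%:R != 0 :> R.
  by rewrite pnatr_eq0 cardfs_eq0; apply/fset0Pn; exists x.
apply: (mulIf cD); rewrite divfK //.
have [_ hO _ _] := phases_inv s k0; have [cO _] := hO F0.
transitivity (fmean (rmark_law k s) (fun C => \sum_(y <- enum_fset D) (y \notin C)%:R)).
  rewrite fmean_sum mulr_natr -iter_addr_0 -(count_predT (enum_fset D)) -big_const_seq.
  apply: eq_big_seq => y yD.
  rewrite -[RHS](rmark_law_swap _ k0 F0 xO yD); apply: eq_fmean_in => p _.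
  by rewrite mem_swap_items /swap_item; case: (eqVneq y x) => [->|]; rewrite ?eqxx.
rewrite -[RHS](fmean_cst _ (fdist_rmark_law s k0)); apply: eq_fmean_in => p pL.
have [MC _ full] := mem_rmark_law k0 pL; have [cC sC] := full F0.
rewrite -natr_sum; congr _%:R.
have -> : (\sum_(y <- enum_fset D) (y \notin p.2) = #|` D `\` p.2|)%N.
  rewrite (eq_bigr (fun y => if y \notin p.2 then 1%N else 0%N)); last first.
    by move=> y _; case: (_ \notin _).
  rewrite -big_mkcond sum1_count -size_filter; apply: perm_size; apply: uniq_perm.
  - by apply: filter_uniq; exact: fset_uniq.
  - exact: fset_uniq.
  - by move=> y; rewrite mem_filter -[RHS]/(y \in D `\` p.2) [RHS]in_fsetD.
have -> : D `\` p.2 = (ph_old ph `|` ph_cur ph) `\` p.2.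
  apply/fsetP => y; rewrite !inE; case: (boolP (y \in p.2)) => //= yp.
  have /negPf -> : y \notin ph_cur ph by apply: contraNN yp; exact: (fsubsetP MC).
  by rewrite orbF.
by rewrite cardfsD (fsetIidPr sC) cC cardfsUD cO addKn.
Qed.

End RMarkLaw.

(** * RMark as a distribution over algorithms *)

Section RMarkAlgorithm.
Context {R : realType}.
Local Open Scope classical_set_scope.
Local Notation algT := (g_sigma_algebraType cylinders).
Implicit Types (s : seq item) (x : item) (C : cache) (A : alg) (Q : randalg R) (h : seq cache).

(** An algorithm that holds the caches of [h]: the marks depend on an algorithm only through its
    past caches and so become a function of the history. *)
Definition replay h : alg := fun t => nth fset0 h (size t).

Lemma marks_eq k A B s : (forall i, (i < size s)%N -> A (take i s) = B (take i s)) ->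
  marks k A s = marks k B s.
Proof.
elim/last_ind: s => [//|s x IH] AB; rewrite !marks_rcons.
have -> : A s = B s.
  by have := AB (size s); rewrite size_rcons ltnS leqnn -cats1 take_size_cat //; apply.
rewrite IH // => i lt; have := AB i; rewrite size_rcons => /(_ (leqW lt)).
by rewrite -cats1 takel_cat // ltnW.
Qed.

Lemma marks_replay k A s : marks k (replay (history A s)) s = marks k A s.
Proof.
apply: marks_eq => i lt; rewrite /replay size_takel ?(ltnW lt) // /history.
rewrite (nth_map 0%N) ?size_iota; last by rewrite ltnS ltnW.
by rewrite nth_iota // ltnS ltnW.
Qed.

Definition rmark_next k s h x C' : R :=
  rmark_step R k (last fset0 h) (erase k (last fset0 h) (marks k (replay h) s) x) x C'.

Lemma rmark_nextE k A s x C' : rmark_next k s (history A s) x C' =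
  rmark_step R k (A s) (erase k (A s) (marks k A s) x) x C'.
Proof. by rewrite /rmark_next last_history marks_replay. Qed.

Lemma rmark_step_ge0 k C M x C' : 0 <= rmark_step R k C M x C'.
Proof.
rewrite /rmark_step; case: ifP => _ //; case: ifP => _ //.
by rewrite /unif divr_ge0 // sumr_ge0.
Qed.

Lemma exists_rmark k : (0 < k)%N -> exists Q : randalg R, is_rmark k Q.
Proof.
move=> k0.
(* Histories ending with more than [k] items have probability 0; the point mass there only keeps [K]
   a family of distributions. *)
pose d s h x : seq (R * cache) := if (#|` last fset0 h| <= k)%N
  then rmark_dist k (last fset0 h)
         (erase k (last fset0 h) (marks k (replay h) s) x) x
  else fpoint fset0.
have dP s h x : fdist (d s h x).
  by rewrite /d; case: ifP => [le|_]; [exact: fdist_rmark_dist | exact: fdist_point].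
pose K s h x C' := fmean (d s h x) (fun X => (C' == X)%:R).
have KE A s x C' : (#|` A s| <= k)%N -> K s (history A s) x C' =
    rmark_step R k (A s) (erase k (A s) (marks k A s) x) x C'.
  by move=> le; rewrite /K /d last_history le marks_replay rmark_stepE.
have K0 s h x C' : 0 <= K s h x C' by exact: fmean_ge0.
have Ks s h x C : C \notin undup (map snd (d s h x)) -> K s h x C = 0.
  rewrite mem_undup => CS; rewrite /K /fmean big_seq big1 // => p pd.
  case: (eqVneq C p.2) => [e|_]; last by rewrite mulr0.
  by rewrite e map_f in CS.
have K1 s h x : \sum_(C <- undup (map snd (d s h x))) K s h x C = 1.
  rewrite -[RHS](fmean_cst 1 (dP s h x)) [RHS]fmean_undup.
  by apply: eq_bigr => C _; rewrite mul1r.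
have [Q [Qsure Qstep]] := exists_randalg K0 (fun s h x => undup_uniq _) Ks K1.
have oQ : Q [set A : alg | online k A] = 1%:E.
  apply: Qsure => A A0 pos; apply: (proj1 (proj1 (rmark_lazy_marking A0 _))) => s x le.
  by apply: (@rmark_step_move R); rewrite -KE.
exists Q; split=> // A0 s x C; rewrite Qstep.
have [le|gt] := leqP #|` A0 s| k; first by rewrite KE.
suff -> : Q (agree A0 s) = 0%:E by rewrite !mul0e.
have eA : agree A0 s = [set A : alg | history A s = history A0 s].
  by apply/seteqP; split=> A /agreeP.
have mA : measurable (agree A0 s : set algT).
  by rewrite eA; exact: (measurable_history s (fun h => h = history A0 s)).
rewrite -(prob_setI1 mA (measurable_online k) oQ).
rewrite (_ : _ `&` _ = set0) ?measure0 //; apply/seteqP; split=> A // [/agreeP eh oA].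
have := online_card s oA; have := last_history A s; rewrite eh last_history => <-.
by rewrite leqNgt gt.
Qed.

Section Analysis.
Variables (k : nat) (Q : randalg R).
Hypotheses (k0 : (0 < k)%N) (rQ : is_rmark k Q).

Let sure_step s x (A : alg) :=
  0 < rmark_step R k (A s) (erase k (A s) (marks k A s) x) x (A (rcons s x)).

Let sure_stepE s x A : sure_step s x A =
  (0 < rmark_next k s (take (size s).+1 (history A (rcons s x))) x
         (last fset0 (history A (rcons s x)))).
Proof.
rewrite history_rcons last_rcons -cats1 take_size_cat ?rmark_nextE //.
by rewrite size_map size_iota.
Qed.

Let measurable_sure_step s x : measurable ([set A : alg | sure_step s x A] : set algT).
Proof.
have := measurable_history (rcons s x)
  (fun h => 0 < rmark_next k s (take (size s).+1 h) x (last fset0 h)).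
rewrite (_ : [set A : alg | sure_step s x A] = [set A : alg |
  0 < rmark_next k s (take (size s).+1 (history A (rcons s x))) x
         (last fset0 (history A (rcons s x)))]) //.
by apply/seteqP; split=> A; rewrite /mkset sure_stepE.
Qed.

Let sure := [set A : alg | online k A /\ forall s x, sure_step s x A].

Let measurable_sure : measurable (sure : set algT).
Proof.
have := measurableI _ _ (@measurable_online k) (measurable_all_steps measurable_sure_step).
by congr measurable; apply/seteqP; split=> A.
Qed.

(** The specification prescribes transition probabilities one at a time. There are countably many
    prefixes, requests and caches, so almost surely no transition of probability 0 ever occurs, and
    then the algorithm is a lazy marking algorithm. *)
Let sure_prob : Q sure = 1%:E.
Proof.
have neg : Q.-negligible (~` sure).
  pose F i := [set A : alg | exists s x, choice.pickle (s, x) = i /\ ~ sure_step s x A].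
  apply: (@negligibleS _ _ _ Q (~` [set A : alg | online k A] `|` \bigcup_i F i)).
    move=> A nA; have [oA|noA] := pselect (online k A); last by left.
    right; have /existsNP [s /existsNP [x nsx]] : ~ forall s x, sure_step s x A.
      by move=> h; apply: nA.
    by exists (choice.pickle (s, x)) => //; exists s, x.
  apply: negligibleU.
    apply/negligibleP; first by apply: measurableC; exact: measurable_online.
    rewrite [LHS](probability_setC Q (measurable_online k)) [X in (_ - X)%E](proj1 rQ).
    by rewrite subee.
  apply: negligible_bigcup => i.
  have [[[s x] e]|ne] := pselect (exists sx : seq item * item, choice.pickle sx = i); last first.
    rewrite (_ : F i = set0); first exact: negligible_set0.
    by apply/seteqP; split=> A // [s [x [e _]]]; apply: ne; exists (s, x).
  pose G j := [set A : alg | exists C, choice.pickle C = j /\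
     rmark_next k s (history A s) x C = 0 /\ A (rcons s x) = C].
  apply: (@negligibleS _ _ _ Q (\bigcup_j G j)).
    move=> A [s' [x' [e' nA]]]; move: e'; rewrite -e => /(pcan_inj choice.pickleK) [es ex].
    rewrite es ex in nA; exists (choice.pickle (A (rcons s x))) => //.
    exists (A (rcons s x)); split=> //; split=> //; rewrite rmark_nextE.
    by apply/eqP; apply: contra_notT nA => h; rewrite /sure_step lt_def h rmark_step_ge0.
  apply: negligible_bigcup => j.
  have [[C eC]|nC] := pselect (exists C : cache, choice.pickle C = j); last first.
    rewrite (_ : G j = set0); first exact: negligible_set0.
    by apply/seteqP; split=> A // [C [eC _]]; apply: nC; exists C.
  have -> : G j = [set A : alg | rmark_next k s (history A s) x C = 0] `&`
      [set A : alg | A (rcons s x) = C].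
    apply/seteqP; split=> A /=; last by move=> [h1 h2]; exists C.
    by move=> [C' [+ h]]; rewrite -eC => /(pcan_inj choice.pickleK) <-.
  apply/negligibleP.
    apply: measurableI; last exact: measurable_cache.
    exact: (measurable_history s (fun h => rmark_next k s h x C = 0)).
  apply: etrans (prob_given_history (P := fun h => rmark_next k s h x C = 0)
    (lexx 0) (measurable_cache _ _) _) _; last by rewrite mule0.
  by move=> A0; rewrite rmark_nextE => h; rewrite (proj2 rQ) h.
have := probability_setC Q measurable_sure.
rewrite (measure_negligible (measurableC measurable_sure) neg) => /esym/eqP.
by rewrite sube_eq ?add0e // => /eqP.
Qed.

Let sure_lazy_marking A : sure A -> lazy_marking k A.
Proof.
move=> [[A0 _] st]; apply: rmark_lazy_marking => // s x _.
exact: rmark_step_move (st s x).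
Qed.

Lemma rmark_lazy : Q [set A : alg | lazy k A] = 1%:E.
Proof.
have mL := @measurable_lazy k.
apply/eqP; rewrite eq_le probability_le1 //= -sure_prob.
by apply: le_measure; rewrite ?inE //= => A /sure_lazy_marking [].
Qed.

(** The specification conditions on the whole history, while the step depends only on the cache and
    the marks. Almost surely the marks are the current phase set ([T]), so conditioning on the cache
    is enough. *)
Lemma rmark_has_law s : has_law Q s (rmark_law k s).
Proof.
elim/last_ind: s => [|s x IH] C'.
  rewrite /rmark_law /= fmean_point.
  have Q0 : Q [set A : alg | A [::] = fset0] = 1%:E.
    have m0 := measurable_cache [::] fset0.
    apply/eqP; rewrite eq_le probability_le1 //= -sure_prob.
    by apply: le_measure; rewrite ?inE //= => A [[]].
  case: eqVneq => [->|Cn]; first by rewrite Q0.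
  rewrite -(prob_setI1 (measurable_cache _ _) (measurable_cache _ _) Q0).
  rewrite (_ : (_ `&` _)%classic = set0) ?measure0 //.
  by apply/seteqP; split=> A //= [-> e]; rewrite e eqxx in Cn.
pose M := ph_cur (phases k s).
have dd := fdist_rmark_law (R := R) s k0.
rewrite (law_split dd IH (measurable_cache _ _)) rmark_law_rcons fmean_bind.
rewrite fmean_undup -sumEFin; apply: eq_bigr => C _.
rewrite -rmark_stepE -/M.
pose T := [set A : alg | marks k A s = M].
have mT : measurable (T : set algT).
  have := measurable_history s (fun h => marks k (replay h) s = M).
  by congr measurable; apply/seteqP; split=> A /=; rewrite /T /= marks_replay.
have QT : Q T = 1%:E.
  apply/eqP; rewrite eq_le probability_le1 //= -sure_prob.
  apply: le_measure; rewrite ?inE //= => A /sure_lazy_marking [mA _].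
  by have [] := marking_phases s k0 mA.
have mC := measurable_cache s C; have mC' := measurable_cache (rcons s x) C'.
rewrite -(prob_setI1 (measurableI _ _ mC mC') mT QT) setIAC.
have -> : [set A : alg | A s = C] `&` T =
    [set A : alg | last fset0 (history A s) = C /\ marks k (replay (history A s)) s = M].
  by apply/seteqP; split=> A; rewrite /mkset last_history marks_replay.
apply: etrans (prob_given_history
  (P := fun h => last fset0 h = C /\ marks k (replay h) s = M)
  (rmark_step_ge0 k C (erase k C M x) x C') mC' _) _; last first.
  have -> : [set A : alg | last fset0 (history A s) = C /\
      marks k (replay (history A s)) s = M] = [set A : alg | A s = C] `&` T.
    by apply/seteqP; split=> A; rewrite /mkset last_history marks_replay.
  by rewrite prob_setI1 // IH -EFinM mulrC.
by move=> A0 []; rewrite last_history marks_replay => <- <-; exact: (proj2 rQ).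
Qed.

Lemma rmark_absent s x : absent Q s x = fmean (rmark_law k s) (fun C => (x \notin C)%:R).
Proof.
rewrite /absent (law_prob (fun C => x \notin C) (fdist_rmark_law s k0)) //.
exact: rmark_has_law.
Qed.

End Analysis.

End RMarkAlgorithm.

(** * The bound [2 H(k) - 1] for RMark *)

Section RMarkCompetitive.
Context {R : realType}.
Local Open Scope fset_scope.
Local Open Scope ring_scope.
Implicit Types (s : seq item) (x : item) (X M O : cache).

(** With [c = 2 H(k) - 1], a phase with [m] new items costs at most [c m / 2] when [m >= 2], because
    then [H(m) >= 3 / 2], but [(c + 1) / 2] when [m = 1]. So [c / 2] per item missed by the optimum
    is kept for the next phase, and the additional [1 / 2] covers the case [m = 1]. *)
Definition rmark_phi (c : R) (d : nat) : R := if d == 0%N then 0 else (c * d%:R + 1) / 2.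

Lemma rmark_phi_ge0 c d : 0 <= c -> 0 <= rmark_phi c d.
Proof.
move=> c0; rewrite /rmark_phi; case: eqP => // _.
by rewrite divr_ge0 // addr_ge0 // mulr_ge0.
Qed.

Lemma rmark_phi_le c d k : 0 <= c -> (d <= k)%N -> rmark_phi c d <= (c * k%:R + 1) / 2.
Proof.
move=> c0 dk; rewrite /rmark_phi; case: eqP => _.
  by rewrite divr_ge0 // addr_ge0 // mulr_ge0.
by rewrite ler_pM2r ?invr_gt0 // lerD2r ler_wpM2l // ler_nat.
Qed.

(** An eviction of the optimum pays [c / 2] for the current phase, through [m <= d + a], and [c / 2]
    for the next one, through [d' <= a]. When [d = 0] the potential gives nothing, and the strict
    inequality [d' < a] together with [1 <= c] compensates. *)
Lemma rmark_phase (H hm : R) (m a d d' : nat) : 1 <= H -> (0 < m)%N ->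
  (m = 1%N -> hm = 1) -> ((1 < m)%N -> 3 / 2 <= hm) ->
  (m <= d + a)%N -> (d' <= a)%N -> (d = 0%N -> (d' < a)%N) ->
  m%:R * (1 + H - hm) + rmark_phi (2 * H - 1) d' <=
  (2 * H - 1) * a%:R + rmark_phi (2 * H - 1) d.
Proof.
move=> H1 m0 m1 m2 mda d'a d0a; set c := 2 * H - 1.
have c1 : 1 <= c by rewrite /c; lra.
have c0 : 0 <= c by lra.
have cm (u v : nat) : (u <= v)%N -> c * u%:R <= c * v%:R.
  by move=> uv; rewrite ler_wpM2l // ler_nat.
have f1 : m = 1%N -> m%:R * (1 + H - hm) = (c + 1) / 2.
  by move=> e; rewrite e m1 // /c; lra.
have f2 : (1 < m)%N -> m%:R * (1 + H - hm) <= c * m%:R / 2.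
  move=> lt; have := ler_wpM2l (ler0n R m) (m2 lt); rewrite /c; lra.
have h1 := cm _ _ mda; rewrite natrD mulrDr in h1.
have h2 := cm _ _ d'a.
rewrite /rmark_phi; case: (eqVneq d 0%N) => [dz|dn].
  have d'1 := d0a dz; have h3 := cm _ _ d'1; rewrite -natr1 mulrDr mulr1 in h3.
  rewrite dz mulr0 add0r in h1.
  have [|m_gt1|m_eq1] := ltngtP m 1; first by rewrite ltnNge m0.
    have := f2 m_gt1; case: eqP => _; have := cm 0%N m (leq0n _); lra.
  rewrite f1 // m_eq1 in h1 *; case: eqP => [_|d'n]; first by lra.
  have : (1 <= d')%N by rewrite lt0n; apply/eqP.
  by move=> /cm; lra.
have d1 : (1 <= d)%N by rewrite lt0n.
have hd := cm _ _ d1.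
have [|m_gt1|m_eq1] := ltngtP m 1; first by rewrite ltnNge m0.
  by have := f2 m_gt1; have := cm 0%N a (leq0n _); case: eqP => _; lra.
rewrite f1 //; have := cm 0%N a (leq0n _); case: eqP => [_|d'n]; first by lra.
have : (1 <= d')%N by rewrite lt0n; apply/eqP.
by move=> /cm; lra.
Qed.

Lemma missing_step (A X X' : cache) (x : item) : x \in X' ->
  (#|` (x |` A) `\` X'| <= #|` A `\` X| + #|` X `\` X'|)%N.
Proof.
move=> xX'; apply: leq_trans (leq_card_fsetU _ _); apply: fsubset_leq_card.
apply/fsubsetP => y; rewrite !inE; case: eqVneq => [->|_] /=; first by rewrite xX'.
by case: (y \in X) => /andP [->] //= ->.
Qed.

Lemma harm_mono m n : (m <= n)%N -> harm R m <= harm R n.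
Proof.
move=> /subnKC <-; elim: (n - m)%N => [|j IH]; first by rewrite addn0.
by rewrite addnS harmS; apply: le_trans IH _; rewrite lerDl invr_ge0.
Qed.

Lemma harm_ge32 m : (1 < m)%N -> 3 / 2 <= harm R m.
Proof.
move=> /harm_mono; apply: le_trans; rewrite harmS /harm big_nat1 invr1; lra.
Qed.

Section Bound.
Variables (k : nat) (Q : randalg R).
Hypotheses (k0 : (0 < k)%N) (rQ : is_rmark k Q).

Let H := harm R k.
Let c := 2 * H - 1.
(** The faults of the first phase, at most [k], and the largest value of the potential. *)
Let b := k%:R + (c * k%:R + 1) / 2.

Let H_ge1 : 1 <= H.
Proof. by rewrite /H; case: k k0 => // n _; exact: harm_ge1. Qed.

Let c_ge0 : 0 <= c.
Proof. by rewrite /c; have := H_ge1; lra. Qed.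

(* The cost of the phases so far is paid for by [c0] evictions of the optimal
   schedule, up to a potential depending on the number [d] of the items of the
   previous phase that its cache missed when the current phase started; [a] is
   the number of its evictions since then. *)
Let paid s X (e : nat) : Prop :=
  let: Phase old M F _ := phases k s in
  if F is 0%N then (cumul (absent Q) s <= #|` M|%:R : Prop)
  else exists d a c0, [/\ (c0 + a)%N = e, (#|` M `\` X| <= a)%N,
    (#|` (old `|` M) `\` X| <= d + a)%N, (d = 0 -> #|` M `\` X| < a)%N &
    cumul (absent Q) s + rmark_phi c d <=
      c * c0%:R + b + #|` M `\` old|%:R * (1 + H - harm R #|` old `\` M|)].

(** Inside a phase the expected cost is bounded by [m (1 + H(k) - H(o))], where [m] is the number of
    new items and [o] that of the unmarked old ones. At the end of the phase [o = m], and
    [rmark_phase] closes the account. *)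
Let paid_step s x X X' e : (#|` X| <= k)%N -> paid s X e -> x \in X' ->
  (#|` X'| <= k)%N -> paid (rcons s x) X' (e + #|` X `\` X'|).
Proof.
move=> Xk + xX' X'k; rewrite /paid phases_rcons /phase_step.
have [lM hO _ _] := phases_inv s k0.
have absent_le1 : absent Q s x <= 1 by case/andP: (absent01 Q s x).
have absent_in : x \in ph_cur (phases k s) -> absent Q s x = 0.
  move=> xM; rewrite (rmark_absent k0 rQ) /fmean big_seq big1 // => p pL.
  have [MC _ _] := mem_rmark_law k0 pL.
  by rewrite (fsubsetP MC _ xM) mulr0.
have absent_old := rmark_absent_old (R := R) (s := s) (x := x) k0.
rewrite -(rmark_absent k0 rQ) in absent_old.
rewrite cumul_rcons.
case: (phases k s) lM hO absent_in absent_old => O M F N /= lM hO absent_in absent_old.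
case: (boolP (x \in M)) => xM /=.
  rewrite absent_in // addr0; case: F {hO absent_old} => [//|F].
  have xMM : x |` M = M.
    by apply/fsetP => z; rewrite !inE; case: eqP => [->|].
  move=> [d [a [c0 [e0 h1 h2 h3 h4]]]]; exists d, (a + #|` X `\` X'|)%N, c0.
  have s1 := missing_step M X xX'; have s2 := missing_step (O `|` M) X xX'.
  rewrite fsetUCA xMM in s2; rewrite xMM in s1; split=> //.
  - by rewrite addnA e0.
  - by move: s1 h1; clear; clia.
  - by move: s2 h2; clear; clia.
  - by move=> /h3; move: s1; clear; clia.
case: (ltnP #|` M| k) => Mk /=.
  case: F hO absent_old => [|F] hO absent_old.
    by rewrite cardfsU1 xM natrD => h; rewrite addrC lerD.
  move=> [d [a [c0 [e0 h1 h2 h3 h4]]]]; exists d, (a + #|` X `\` X'|)%N, c0.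
  have s1 := missing_step M X xX'; have s2 := missing_step (O `|` M) X xX'.
  rewrite fsetUCA in s2; split=> //.
  - by rewrite addnA e0.
  - by move: s1 h1; clear; clia.
  - by move: s2 h2; clear; clia.
  - by move=> /h3; move: s1; clear; clia.
  have [cO _] := hO isT; case: (boolP (x \in O)) => xO.
    have xD : x \in O `\` M by rewrite inE xM.
    have eM : (x |` M) `\` O = M `\` O.
      by apply/fsetP => z; rewrite !inE; case: eqVneq => [->|]; rewrite ?xO.
    have eO : O `\` (x |` M) = (O `\` M) `\ x.
      by apply/fsetP => z; rewrite !inE negb_or andbA.
    (* The fault probability [m / o] is [m] times what [H(o)] loses when one of the [o] old items
       gets marked. *)
    rewrite absent_old // eM eO; have := cardfsD1 x (O `\` M); rewrite xD add1n => eD.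
    by move: h4; rewrite eD harmS; move: (_%:R) (harm _ _) (_^-1) => u v w; lra.
  have eM : #|` (x |` M) `\` O| = #|` M `\` O|.+1.
    rewrite fsetDUl [[fset x] `\` O](_ : _ = [fset x]) ?cardfsU1 ?inE ?(negPf xM) ?andbF //.
    by apply/fsetP => z; rewrite !inE; case: eqVneq => [->|]; rewrite ?xO ?andbF.
  have eO : O `\` (x |` M) = O `\` M.
    apply/fsetP => z; rewrite !inE negb_or; case: eqVneq => [->|//].
    by rewrite (negPf xO) !andbF.
  rewrite eM eO -natr1; have : harm R #|` O `\` M| <= H.
    by apply: harm_mono; rewrite -cO; apply: fsubset_leq_card; exact: fsubsetDl.
  by move: h4; lra.
have Mk' : #|` M| = k by apply/eqP; rewrite eqn_leq lM.
(* If [X] misses no item of [M], it equals [M], and serving [x] forces an eviction; this is the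
   strict inequality required when [d = 0]. *)
have start : [/\ (#|` [fset x] `\` X'| <= #|` X `\` X'|)%N,
   (#|` (M `|` [fset x]) `\` X'| <= #|` M `\` X| + #|` X `\` X'|)%N &
   (#|` M `\` X| = 0 -> #|` [fset x] `\` X'| < #|` X `\` X'|)%N].
  have -> : [fset x] `\` X' = fset0.
    by apply/eqP; rewrite fsetD_eq0 fsub1set.
  rewrite cardfs0; split=> //; first by rewrite fsetUC; exact: missing_step.
  move=> /eqP; rewrite cardfs_eq0 fsetD_eq0 => MX; rewrite lt0n cardfs_eq0 fsetD_eq0.
  have eX : X = M by apply/esym/eqP; rewrite eqEfcard MX Mk'.
  rewrite eX; apply/negP => MX'.
  have : (#|` x |` M| <= #|` X'|)%N.
    by apply: fsubset_leq_card; rewrite fsubUset fsub1set xX'.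
  by rewrite cardfsU1 xM Mk' add1n; move: X'k; clear; clia.
have newE : #|` [fset x] `\` M|%:R * (1 + H - harm R #|` M `\` [fset x]|) = 1.
  rewrite mem_fsetD1 // Mk' -/H addrK mulr1.
  rewrite (_ : _ `\` _ = [fset x]) ?cardfs1 //.
  by apply/fsetP => z; rewrite !inE; case: eqVneq => [->|]; rewrite ?xM ?andbF.
have d'k : (#|` M `\` X| <= k)%N.
  by rewrite -Mk'; apply: fsubset_leq_card; exact: fsubsetDl.
have [st1 st2 st3] := start.
move=> inv; exists #|` M `\` X|, #|` X `\` X'|, e; split=> //.
rewrite newE; suff : cumul (absent Q) s + rmark_phi c #|` M `\` X| <= c * e%:R + b.
  by move: absent_le1; lra.
case: F hO absent_old inv => [|F] hO absent_old.
  rewrite Mk' => acck; have := rmark_phi_le c_ge0 d'k.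
  have := mulr_ge0 c_ge0 (ler0n R e); rewrite /b; lra.
move=> [d [a [c0 [e0 h1 h2 h3 h4]]]].
have [cO fresh] := hO isT; rewrite /ph_fresh /= in fresh.
have eO : #|` O `\` M| = #|` M `\` O|.
  have := cardfsUD O M; have := cardfsUD M O; rewrite (fsetUC M) cO Mk'.
  by clear; clia.
have mda : (#|` M `\` O| <= d + a)%N.
  apply: leq_trans h2; have := cardfsID X (O `|` M); have := cardfsUD O M.
  rewrite cO; have : (#|` (O `|` M) `&` X| <= k)%N.
    by apply: leq_trans Xk; apply: fsubset_leq_card; exact: fsubsetIr.
  by clear; clia.
have := rmark_phase H_ge1 fresh (hm := harm R #|` M `\` O|) _ _ mda h1 h3.
rewrite -/c; rewrite eO in h4.
have m1 : #|` M `\` O| = 1%N -> harm R #|` M `\` O| = 1.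
  by move=> ->; rewrite /harm big_nat1 invr1.
move=> /(_ m1 (@harm_ge32 _)); rewrite -e0 natrD mulrDr; move: h4; lra.
Qed.

Lemma rmark_ratio_le eps : (rand_ratio k eps Q <= (2 * harm R k - 1)%:E)%E.
Proof.
have oQ := proj1 rQ.
apply: (@lazy_ratio_le _ k Q k0 oQ eps _ (b + k%:R * (1 + H))) => //; first exact: rmark_lazy.
move=> s; have [[X rX] _] := optnP s k0.
have paid0 : paid [::] fset0 0 by rewrite /paid /= cumul_nil.
have [_] := reach_ind paid0 (@paid_step) rX.
rewrite /paid; have [lM hO _ _] := phases_inv s k0.
case: (phases k s) lM hO => O M F N /= lM hO.
have Hk : 0 <= k%:R * (1 + H) by rewrite mulr_ge0 // addr_ge0 // (le_trans ler01).
have co := mulr_ge0 c_ge0 (ler0n R (optn k s)).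
have b0 : k%:R <= b.
  by rewrite /b lerDl divr_ge0 // addr_ge0 // mulr_ge0.
case: F hO => [|F] hO.
  move=> h; have : #|` M|%:R <= k%:R :> R by rewrite ler_nat.
  by rewrite -/c; lra.
move=> [d [a [c0 [e0 _ _ _ h]]]].
have phi0 := rmark_phi_ge0 d c_ge0.
have [cO _] := hO isT.
have : #|` M `\` O|%:R * (1 + H - harm R #|` O `\` M|) <= k%:R * (1 + H).
  apply: ler_pM => //.
  - rewrite subr_ge0 (@le_trans _ _ H) ?lerDr //; apply: harm_mono.
    by rewrite -cO; apply: fsubset_leq_card; exact: fsubsetDl.
  - rewrite ler_nat; apply: leq_trans lM; apply: fsubset_leq_card; exact: fsubsetDl.
  - by rewrite gerBl /harm sumr_ge0 // => i _; rewrite invr_ge0.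
have : c * c0%:R <= c * (optn k s)%:R by rewrite ler_wpM2l // ler_nat -e0 leq_addr.
by move: h phi0; rewrite -/c; lra.
Qed.

End Bound.
End RMarkCompetitive.

(** * The theorem *)

Lemma harm_rev (R : realType) k : \sum_(1 <= i < k.+1) (k.+1%:R - i%:R)^-1 = harm R k.
Proof.
rewrite /harm [RHS]big_nat_rev; apply: eq_big_nat => i /andP [_ ik].
by rewrite add1n subSS natrB // ltnW.
Qed.

Lemma rand_ratio_ge_harm (R : realType) k (Q : randalg R) eps : (0 < k)%N ->
  rand_online k Q -> k.+1%:R^-1 <= eps -> ((harm R k)%:E <= rand_ratio k eps Q)%E.
Proof.
move=> k0 oQ ek; apply: (rand_ratio_ge k0 oQ (ltnSn k) ek); last by rewrite harm_rev.
by rewrite /harm sumr_ge0 // => i _; rewrite invr_ge0.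
Qed.

(** The uniform adversary gives the sum of [1 / (N - i)] for [i] from [1] to [k], whose first
    [k - 1] terms are those of [Phi] at [1 / N]. *)
Lemma rand_ratio_ge_Phi_sub1 (R : realType) k N (Q : randalg R) eps : (0 < k)%N ->
  rand_online k Q -> (k < N)%N -> N%:R^-1 <= eps ->
  ((Phi (N%:R^-1) k - 1)%:E <= rand_ratio k eps Q)%E.
Proof.
move=> k0 oQ kN eN; have N0 : 0 < N%:R :> R by rewrite ltr0n (leq_ltn_trans _ kN).
rewrite Phi_sub1 ?invr_gt0 //; last by rewrite lef_pV2 ?posrE // ler_nat.
rewrite invrK; have pos i : (i < N)%N -> 0 <= (N%:R - i%:R)^-1 :> R.
  by move=> iN; rewrite invr_ge0 subr_ge0 ler_nat ltnW.
apply: (rand_ratio_ge k0 oQ kN eN).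
  rewrite big_nat_cond sumr_ge0 // => i; rewrite andbT => /andP [_ ik].
  exact/pos/(ltn_trans ik).
by rewrite [leRHS]big_nat_recr //= lerDl pos.
Qed.

Unset Implicit Arguments.

Theorem theorem1 (R : realType) (k : nat) (eps : R)
    (hk : (0 < k)%N) (heps : 0 < eps <= 1) :
  let eps' : R := ((Num.ceil eps^-1)%:~R)^-1 in
  (eps <= (k.+1%:R)^-1 ->
     ((Phi eps k - 1)%:E <= opt_det_ratio k eps)%E /\
     (opt_det_ratio k eps <= (2 * Phi eps k)%:E)%E /\
     ((Phi eps' k - 1)%:E <= opt_rand_ratio k eps)%E /\
     (opt_rand_ratio k eps <= (2 * Phi eps k)%:E)%E) /\
  ((k.+1%:R)^-1 <= eps ->
     ((Phi eps k)%:E <= opt_det_ratio k eps)%E /\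
     (opt_det_ratio k eps <= (2 * Phi eps k)%:E)%E /\
     opt_rand_ratio k eps = (harm R k)%:E) /\
  (forall A : alg, lazy_marking k A ->
     (det_ratio k eps A <= (2 * Phi eps k)%:E)%E) /\
  lazy_marking k (lru k) /\
  (exists Q : randalg R, is_partition k Q) /\
  (exists Q : randalg R, is_equitable k Q) /\
  (exists Q : randalg R, is_rmark k Q) /\
  ((k.+1%:R)^-1 <= eps ->
     (forall Q : randalg R, is_partition k Q ->
        rand_ratio k eps Q = (harm R k)%:E) /\
     (forall Q : randalg R, is_equitable k Q ->
        rand_ratio k eps Q = (harm R k)%:E) /\
     (forall Q : randalg R, is_rmark k Q ->
        (rand_ratio k eps Q <= (2 * harm R k - 1)%:E)%E)).
Proof.
case/andP: heps => e0 e1 eps'.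
have det_le : (opt_det_ratio k eps <= (2 * Phi eps k)%:E)%E.
  have lmL := lru_lazy_marking hk; apply: le_trans (lazy_marking_upper hk e0 lmL).
  by apply: ereal_inf_lbound; exists (lru k) => //; case: lmL => -[].
have [Qp pQ] := exists_partition (R := R) hk.
split; [|split; [|split; [|split; [|split; [|split; [|split]]]]]].
- move=> ek; split; first exact: opt_det_ge_Phi_sub1.
  split=> //; split; last exact: le_trans (opt_rand_le_det k eps) det_le.
  apply: le_ereal_inf_tmp => _ [Q oQ <-].
  have kc : k%:R + 1 <= eps^-1.
    by rewrite natr1 -[leLHS]invrK lef_pV2 // posrE invr_gt0.
  have c0 : 0 <= Num.ceil eps^-1.
    by rewrite -(ler_int R); apply: le_trans (ceil_ge _); rewrite invr_ge0 ltW.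
  have eN : (Num.ceil eps^-1)%:~R = `|Num.ceil eps^-1|%N%:R :> R.
    by rewrite natr_absz ger0_norm.
  rewrite /eps' eN; apply: rand_ratio_ge_Phi_sub1 => //.
    by rewrite -(ltr_nat R) -eN; apply: lt_le_trans (ceil_ge _); lra.
  rewrite -eN invf_ple ?posrE //; first exact: ceil_ge.
  by apply: lt_le_trans (ceil_ge _); rewrite invr_gt0.
- move=> ek; split; first exact: opt_det_ge_Phi.
  split=> //; apply/eqP; rewrite eq_le; apply/andP; split.
    apply: le_trans (partition_ratio_le eps hk pQ).
    by apply: ereal_inf_lbound; exists Qp => //; case: pQ.
  by apply: le_ereal_inf_tmp => _ [Q oQ <-]; exact: rand_ratio_ge_harm.
- by move=> A; exact: lazy_marking_upper.
- exact: lru_lazy_marking.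
- by exists Qp.
- exact: exists_equitable.
- exact: exists_rmark.
move=> ek; split; [|split] => Q.
- move=> QP; apply/eqP; rewrite eq_le partition_ratio_le //=.
  by apply: rand_ratio_ge_harm => //; case: QP.
- move=> QE; apply/eqP; rewrite eq_le equitable_ratio_le //=.
  by apply: rand_ratio_ge_harm => //; case: QE.
- by move=> QR; exact: rmark_ratio_le.
Qed.
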